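(* Let $K\ge 4$ be an integer and define $N=K-2$ and $M=N^2-1$. Consider the weights \[ (a,b,c)=\left(KN,\;KN^2-1,\;KMN^2-(M+N)\right).\] Then $X=\operatorname{Bl}_e\mathbb{P}(a,b,c)$ is a Mori Dream Space. The negative curve $C$ in $X$ is supported in the triangle $\Delta$ with horizontal base, top vertex $(N(M+N)-1,\,KN^2-1)$, bottom right vertex $(MN-1,0)$ and left slope $\frac{KN}{M+N}$; its bottom left vertex is $\left(-\frac{K-1}{KN},0\right)$. Furthermore, this curve is special, vanishes to order $m=N(M+N)-1$ at $e$, and has deficiency $\frac{(K-2)(K-3)}{2}$.
   Context: We work over an algebraically closed field $k$ of characteristic zero. For a plane triangle $\Delta$ with rational edge slopes, $X_\Delta$ is the projective toric surface defined by the normal fan of $\Delta$; $e=(1,1)$ is the identity of the torus $T$ (blowing up a general point means blowing up $e$), and $E$ is the exceptional curve of $\operatorname{Bl}_e X_\Delta$. The weighted projective plane $\mathbb{P}(a,b,c)$ is the toric surface $X_\Delta$ of the triangle $\Delta$ in the claim. A negative curve in $X$ is an irreducible curve $C\ne E$ with $C\cdot C\le 0$; it is defined by an irreducible Laurent polynomial $\xi(x,y)$ (as strict transform of the closure of the zero locus of $\xi$ in $T$), and its order of vanishing at $e$ is that of $\xi$. The curve is supported in $\Delta$ if the Newton polygon of $\xi$ lies in $\Delta$ and $\Delta$ is the smallest such triangle among those obtained from it by scaling and translation. A negative curve supported in $\Delta$ and vanishing to order $m$ at $e$ is called special if $\Delta$ contains fewer than $\binom{m+1}{2}+1$ lattice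 points; its deficiency is the difference between $\binom{m+1}{2}+1$ and the number of lattice points in $\Delta$. *)

(* Defs.v *)
From HB Require Import structures.
From mathcomp Require Import all_boot all_order all_algebra.
From mathcomp Require Import finmap.
From mathcomp.multinomials Require Import monalg.
From mathcomp.multinomials Require mpoly.

Set Implicit Arguments.
Unset Strict Implicit.
Unset Printing Implicit Defensive.

Import Order.TTheory GRing.Theory Num.Theory.
Local Open Scope fset_scope.
Local Open Scope ring_scope.

(* The group algebra R[G] of an abelian group G.  As a module it is
   {malg R[G]}; monalg's own product is not available here, since monomType
   excludes monoids with nontrivial invertible elements. *)
Definition grpalg (R : comNzRingType) (G : zmodType) : Type := {malg R[G]}.

HB.instance Definition _ (R : comNzRingType) (G : zmodType) :=
  GRing.Zmodule.on (grpalg R G).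

Section GroupAlgebra.
Variables (R : comNzRingType) (G : zmodType).
Implicit Types (f g h : grpalg R G).

Definition gmono (c : R) (v : G) : grpalg R G := mkmalgU v c.
Definition gsupp f : {fset G} := msupp f.
Definition gcoef f (v : G) : R := mcoeff v f.

Definition gone : grpalg R G := gmono 1 0.
Definition gmul f g : grpalg R G :=
  \sum_(v <- gsupp f) \sum_(w <- gsupp g) gmono (gcoef f v * gcoef g w) (v + w).

Let gmono0 v : gmono 0 v = 0.
Proof. exact: monalgU0. Qed.

Let gmonoD v : {morph gmono^~ v : c d / c + d}.
Proof. exact: monalgUD. Qed.

Let gcoef_out f v : v \notin gsupp f -> gcoef f v = 0.
Proof. exact: mcoeff_outdom. Qed.

Let gsuppU c v : gsupp (gmono c v) `<=` [fset v].
Proof. exact: msuppU_le. Qed.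

Let gcoefU c v : gcoef (gmono c v) v = c.
Proof. exact: mcoeffUU. Qed.

Let gmulw (d e : {fset G}) f g : gsupp f `<=` d -> gsupp g `<=` e ->
  gmul f g =
  \sum_(v <- d) \sum_(w <- e) gmono (gcoef f v * gcoef g w) (v + w).
Proof.
move=> le_d le_e; rewrite /gmul (big_fset_incl _ le_d) /=.
  apply/eq_bigr=> v _; apply/big_fset_incl => // w _ /gcoef_out ->.
  by rewrite mulr0 gmono0.
move=> v _ /gcoef_out fv.
by rewrite big1 => // w _; rewrite fv mul0r gmono0.
Qed.

Fact gmulC : commutative gmul.
Proof.
move=> f g; rewrite /gmul exchange_big /=.
by apply: eq_bigr => v _; apply: eq_bigr => w _; rewrite mulrC addrC.
Qed.

Fact gmulDl : left_distributive gmul +%R.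
Proof.
move=> f g h; set d := gsupp f `|` gsupp g.
have le_fg : gsupp (f + g) `<=` d by exact: msuppD_le.
rewrite (gmulw le_fg (fsubset_refl _)).
rewrite (gmulw (fsubsetUl _ _ : gsupp f `<=` d) (fsubset_refl _)).
rewrite (gmulw (fsubsetUr _ _ : gsupp g `<=` d) (fsubset_refl _)).
rewrite -big_split /=; apply/eq_bigr=> v _.
rewrite -big_split /=; apply/eq_bigr=> w _.
by rewrite -gmonoD -mulrDl /gcoef mcoeffD.
Qed.

Let gmulDr : right_distributive gmul +%R.
Proof. by move=> f g h; rewrite gmulC gmulDl !(gmulC f). Qed.

Let gmul0 : left_zero 0 gmul.
Proof. by move=> f; rewrite /gmul /gsupp msupp0 big_seq_fset0. Qed.

Let gmulr0 : right_zero 0 gmul.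
Proof. by move=> f; rewrite gmulC gmul0. Qed.

Let gE f : f = \sum_(v <- gsupp f) gmono (gcoef f v) v.
Proof. exact: monalgE. Qed.

Let gmulUU c1 c2 v1 v2 :
  gmul (gmono c1 v1) (gmono c2 v2) = gmono (c1 * c2) (v1 + v2).
Proof.
by rewrite (gmulw (gsuppU _ _) (gsuppU _ _)) !big_seq_fset1 !gcoefU.
Qed.

Fact gmul1 : left_id gone gmul.
Proof.
move=> f; rewrite [in LHS](gE f) [RHS]gE.
rewrite (big_morph (gmul gone) (fun _ _ => gmulDr _ _ _) (gmulr0 _)).
by apply: eq_bigr => v _; rewrite gmulUU mul1r add0r.
Qed.

Let gmul_suml (s : seq G) (F : G -> grpalg R G) g :
  gmul (\sum_(v <- s) F v) g = \sum_(v <- s) gmul (F v) g.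
Proof. exact: (big_morph (gmul^~ g) (fun _ _ => gmulDl _ _ _) (gmul0 _)). Qed.

Let gmul_sumr (s : seq G) (F : G -> grpalg R G) f :
  gmul f (\sum_(v <- s) F v) = \sum_(v <- s) gmul f (F v).
Proof. exact: (big_morph (gmul f) (fun _ _ => gmulDr _ _ _) (gmulr0 _)). Qed.

Fact gmulA : associative gmul.
Proof.
move=> f g h; rewrite (gE f) (gE g) (gE h).
move: (enum_fset (gsupp f)) (enum_fset (gsupp g)) (enum_fset (gsupp h)).
move: (gcoef f) (gcoef g) (gcoef h) => a b c r s t.
rewrite !(gmul_suml r (fun v => gmono (a v) v)) (gmul_suml r).
apply: eq_bigr => u _; rewrite (gmul_suml s (fun v => gmono (b v) v)).
rewrite !(gmul_sumr s _ (gmono _ u)) (gmul_suml s).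
apply: eq_bigr => v _; rewrite !(gmul_sumr t).
apply: eq_bigr => w _.
by rewrite !gmulUU mulrA addrA.
Qed.

Fact gone_neq0 : gone != 0.
Proof.
apply/eqP => /(congr1 (fun f => gcoef f 0)) /eqP.
by rewrite gcoefU /gcoef mcoeff0 oner_eq0.
Qed.

HB.instance Definition _ := GRing.Zmodule_isComNzRing.Build (grpalg R G)
  gmulA gmulC gmul1 gmulDl gone_neq0.

End GroupAlgebra.

Definition lattice : zmodType := (int * int)%type.
Definition plane : Type := (rat * rat)%type.

Definition to_plane (v : lattice) : plane := (v.1%:~R, v.2%:~R).
Definition pairing (u v : lattice) : int := u.1 * v.1 + u.2 * v.2.
Definition pairingQ (u : lattice) (p : plane) : rat :=
  u.1%:~R * p.1 + u.2%:~R * p.2.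

Definition conv (I : finType) (P : I -> plane) (p : plane) : Prop :=
  exists t : I -> rat,
    [/\ forall i, 0 <= t i,
        \sum_i t i = 1 &
        p = (\sum_i t i * (P i).1, \sum_i t i * (P i).2)].

Definition triangle : Type := 'I_3 -> plane.

Definition mk_triangle (A B C : plane) : triangle := tnth [tuple A; B; C].

Definition in_triangle (D : triangle) : plane -> Prop := conv D.

Definition homothet (s : rat) (p : plane) (D : triangle) : triangle :=
  fun i => (s * (D i).1 + p.1, s * (D i).2 + p.2).

Definition lattice_count (D : triangle) (n : nat) : Prop :=
  exists s : seq lattice,
    [/\ uniq s, forall v, v \in s <-> in_triangle D (to_plane v) & size s = n].

(* u i is the primitive generator of the i-th ray of the fan. *)
Definition rays : Type := 'I_3 -> lattice.

(* The rays of the normal fan of D: u i is the primitive inner normal of the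
   edge opposite to the vertex D i. *)
Definition normal_fan (D : triangle) (u : rays) : Prop :=
  forall i, coprimez (u i).1 (u i).2 /\
    exists h : rat, h < pairingQ (u i) (D i) /\
      forall j, j != i -> pairingQ (u i) (D j) = h.

(* The fan of P(w 0, w 1, w 2): its lattice is Z^3 / Z w and its rays are
   generated by the images of the standard basis vectors. *)
Definition wps_fan (w : 'I_3 -> int) (u : rays) : Prop :=
  (forall v : lattice, exists c : 'I_3 -> int, \sum_i u i *~ c i = v) /\
  (forall c : 'I_3 -> int,
     \sum_i u i *~ c i = 0 <-> exists t : int, forall i, c i = t * w i).

Section Laurent.
Variable k : closedFieldType.

(* k[x^{+-1}, y^{+-1}]; gmono c (i, j) is c x^i y^j. *)
Definition laurent : comNzRingType := grpalg k lattice.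

Definition lx : laurent := gmono 1 (1, 0).
Definition ly : laurent := gmono 1 (0, 1).

Definition lunit (f : laurent) : Prop := exists g, f * g = 1.

Definition lirreducible (f : laurent) : Prop :=
  [/\ f <> 0, ~ lunit f &
      forall g h, f = g * h -> lunit g \/ lunit h].

(* f lies in the m-th power of the maximal ideal (x - 1, y - 1) of e. *)
Definition vanishes_at_e (f : laurent) (m : nat) : Prop :=
  exists g : 'I_m.+1 -> laurent,
    f = \sum_(j < m.+1) g j * (lx - 1) ^+ j * (ly - 1) ^+ (m - j).

Definition order_at_e (f : laurent) (m : nat) : Prop :=
  vanishes_at_e f m /\ ~ vanishes_at_e f m.+1.

Definition newton_polygon (f : laurent) : plane -> Prop :=
  conv (fun v : gsupp f => to_plane (val v)).

Definition supported_in (f : laurent) (D : triangle) : Prop :=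
  (forall p, newton_polygon f p -> in_triangle D p) /\
  (forall (s : rat) (q : plane), 0 < s ->
     (forall p, newton_polygon f p -> in_triangle (homothet s q D) p) ->
     forall p, in_triangle D p -> in_triangle (homothet s q D) p).

(* The blowup X = Bl_e P(w), where P(w) is the toric surface with rays u.
   D_i denotes both the torus-invariant curve of the ray u i and its pullback
   to X, and H the Weil divisor class of degree 1. *)

(* The order of vanishing of f along D_i. *)
Definition order_along (ui : lattice) (f : laurent) (n : int) : Prop :=
  (forall v, v \in gsupp f -> n <= pairing ui v) /\
  (exists2 v, v \in gsupp f & pairing ui v = n).

(* H^0(X, O(\sum_i n_i D_i - m E)).  A section is regular on T \ {e}, hence on
   T, so it is a Laurent polynomial, of order at least - n_i along D_i and at
   least m along E. *)
Definition H0 (u : rays) (n : 'I_3 -> int) (m : int) (f : laurent) : Prop :=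
  (forall i v, v \in gsupp f -> - n i <= pairing (u i) v) /\
  (forall j : nat, j%:Z = m -> vanishes_at_e f j).

(* The ambient ring of the Cox ring: finitely supported families of Laurent
   polynomials, indexed by pairs (d, m), which stand for the classes
   d H - m E. *)
Definition cox_ambient : comNzRingType := grpalg laurent (int * int)%type.

Definition cox_const (c : k) : cox_ambient := gmono (gmono c 0) 0.

(* The Cox ring \bigoplus_(d, m) H^0(X, O(d H - m E)), where H is represented
   by \sum_i n_i D_i. *)
Definition cox_ring (u : rays) (n : 'I_3 -> int) (F : cox_ambient) : Prop :=
  forall d m : int, H0 u (fun i => d * n i) m (gcoef F (d, m)).

Definition fin_gen_algebra (A : cox_ambient -> Prop) : Prop :=
  exists (r : nat) (g : 'I_r -> cox_ambient),
    (forall i, A (g i)) /\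
    (forall F, A F ->
       exists p : mpoly.mpoly r k, F = mpoly.mmap cox_const g p).

(* X is a normal projective Q-factorial surface and Cl(X) is free on H and E:
   the class of D_i has degree w i.  The choice of the representative of H
   changes the Cox ring only by a graded isomorphism. *)
Definition mori_dream_space (w : 'I_3 -> int) (u : rays) : Prop :=
  exists n : 'I_3 -> int,
    \sum_i n i * w i = 1 /\ fin_gen_algebra (cox_ring u n).

(* The strict transform C of the closure of {f = 0} has class d H - m E.  Since
   div f = C + \sum_i ord_{D_i}(f) D_i + ord_E(f) E, the degree d is
   - \sum_i w_i ord_{D_i}(f), and m is the order of f at e. *)
Definition curve_class (w : 'I_3 -> int) (u : rays) (f : laurent)
    (d : int) (m : nat) : Prop :=
  (exists a : 'I_3 -> int,
     (forall i, order_along (u i) f (a i)) /\ d = - \sum_i w i * a i) /\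
  order_at_e f m.

(* (d H - m E) . (d' H - m' E), from H.H = 1 / (w_0 w_1 w_2), H.E = 0 and
   E.E = -1. *)
Definition intersection (w : 'I_3 -> int) (d m d' m' : int) : rat :=
  (d * d')%:~R / (\prod_i w i)%:~R - (m * m')%:~R.

(* The strict transform of {f = 0}, which is never E, is a negative curve
   (C.C = 0 is allowed).  D_0, D_1, D_2, the only other curves besides E, are
   ample on P(w), so they are not negative. *)
Definition negative_curve (w : 'I_3 -> int) (u : rays) (f : laurent) : Prop :=
  lirreducible f /\
  exists (d : int) (m : nat),
    curve_class w u f d m /\ intersection w d m d m <= 0.

Definition special (w : 'I_3 -> int) (u : rays) (f : laurent) (D : triangle) :
    Prop :=
  [/\ negative_curve w u f, supported_in f D &
      exists m n : nat, [/\ order_at_e f m, lattice_count D n &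
                            (n < 'C(m.+1, 2) + 1)%N]].

Definition has_deficiency (f : laurent) (D : triangle) (q : rat) : Prop :=
  exists m n : nat, [/\ order_at_e f m, lattice_count D n &
                        q = ('C(m.+1, 2) + 1)%N%:R - n%:R].

(* f and g define the same curve in the torus. *)
Definition same_curve (f g : laurent) : Prop :=
  exists h, lunit h /\ g = h * f.

End Laurent.

(* Main.v *)
Require Import Defs.
From HB Require Import structures.
From mathcomp Require Import all_boot all_order all_algebra.
From mathcomp Require Import finmap ring lra zify.
From mathcomp.multinomials Require Import monalg.
From mathcomp.multinomials Require mpoly.
From Stdlib Require Import Classical ClassicalEpsilon.

Set Implicit Arguments.
Unset Strict Implicit.
Unset Printing Implicit Defensive.

Import Order.TTheory GRing.Theory Num.Theory.
Local Open Scope ring_scope.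

(* Write n = N + 1, q = M + N, so that m = n M = N q - 1.  The polynomials
   bpoly i, with (1 - x) bpoly i = (1 - x y)^(i+1) - x^i (1 - y)^(i+1), vanish
   to order i at e.  There is g, vanishing to order q, with
     g * bpoly n = (bpoly N)^K - (-1)^K x^q (1 - y)^(N K),
   and xi is defined by (1 - y) x xi = g^N - (bpoly N)^q.  Its order at e is m,
   and its Newton polygon is read off from the initial forms of bpoly N, bpoly n
   and g along the edges of Delta.

   The curve of bpoly N is disjoint from C.  Let F = xi^N and B = (bpoly N)^m,
   which both vanish to order mu = m N.  In every degree, division by F and B
   leaves a remainder supported in a box with at most mu^2 lattice points, so
   the sections outside (F, B)^i span a space of dimension at most
   mu^2 i (i + 1) / 2, while (F, B)^i contributes at most i + 1 copies of the jets
   of order mu.  These numbers add up to the number of jets of order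
   mu (i + 1), all of which are realized in large degree; hence a section
   vanishing to order mu (i + 1) lies in (F, B)^i, first in large degree, and
   then in every degree because the coordinate x_L is a nonzerodivisor modulo
   (F, B)^i.

   Consequently a section of degree d and order j satisfies b c j <= m d, and xi
   divides one of its powers as soon as d < a m j.  Since b c < a m^2, this gives
   the irreducibility of xi and the uniqueness of the negative curve.  Moreover
   the Cox ring is generated over its subring R generated by x_R, x_L, x_B, F, B
   by the section 1 of degree E and by sections which, up to a shift of the
   E-degree by less than 2 mu, form ideals of R; these are finitely generated by
   Hilbert's basis theorem. *)

(** * Laurent polynomials *)

Section GroupAlgebraTheory.
Variables (R : comNzRingType) (G : zmodType).
Implicit Types (f g h : grpalg R G) (c d : R) (v w : G).

Lemma gcoef_eqP f g : (forall v, gcoef f v = gcoef g v) <-> f = g.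
Proof. exact: malgP. Qed.

Lemma gcoef0 v : gcoef (0 : grpalg R G) v = 0. Proof. exact: mcoeff0. Qed.

Lemma gcoefD f g v : gcoef (f + g) v = gcoef f v + gcoef g v.
Proof. exact: mcoeffD. Qed.

Lemma gcoefN f v : gcoef (- f) v = - gcoef f v.
Proof. exact: mcoeffN. Qed.

Lemma gcoefB f g v : gcoef (f - g) v = gcoef f v - gcoef g v.
Proof. by rewrite gcoefD gcoefN. Qed.

Lemma gcoef_sum (I : Type) (r : seq I) (P : pred I) (F : I -> grpalg R G) v :
  gcoef (\sum_(i <- r | P i) F i) v = \sum_(i <- r | P i) gcoef (F i) v.
Proof. by rewrite (big_morph (fun f => gcoef f v) (fun f g => gcoefD f g v) (gcoef0 v)). Qed.

Lemma gcoef_mono c v w : gcoef (gmono c v) w = c *+ (v == w).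
Proof. exact: mcoeffU. Qed.

Lemma gsuppE f v : (v \in gsupp f) = (gcoef f v != 0).
Proof. by rewrite mcoeff_neq0. Qed.

Lemma gmono0 v : gmono 0 v = 0 :> grpalg R G.
Proof. exact: monalgU0. Qed.

Lemma gmonoD c d v : gmono (c + d) v = gmono c v + gmono d v :> grpalg R G.
Proof. exact: monalgUD. Qed.

Lemma gsumE f : f = \sum_(v <- gsupp f) gmono (gcoef f v) v.
Proof. exact: monalgE. Qed.

Lemma gmonoM c d v w :
  gmono c v * gmono d w = gmono (c * d) (v + w) :> grpalg R G.
Proof.
have [->|c0] := eqVneq c 0; first by rewrite mul0r !gmono0 mul0r.
have [->|d0] := eqVneq d 0; first by rewrite mulr0 !gmono0 mulr0.
rewrite [LHS]/(gmul _ _) /gmul /gsupp /gmono !msuppU (negbTE c0) (negbTE d0).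
by rewrite !big_seq_fset1 /gcoef !mcoeffUU.
Qed.

Lemma gmono1 : gmono 1 0 = 1 :> grpalg R G. Proof. by []. Qed.

Lemma gcoef_monoM c v f w : gcoef (gmono c v * f) w = c * gcoef f (w - v).
Proof.
rewrite {1}[f]gsumE mulr_sumr gcoef_sum.
under eq_bigr => x _ do rewrite gmonoM gcoef_mono.
have eqx x : (v + x == w) = (x == w - v).
  by rewrite [RHS]eq_sym subr_eq eq_sym addrC.
have [H|H] := boolP (w - v \in gsupp f).
  rewrite (big_fsetD1 (w - v)) //= eqx eqxx mulr1n big1_fset ?addr0 // => x.
  by rewrite in_fsetD1 eqx => /andP[/negbTE-> _] _; rewrite mulr0n.
have: gcoef f (w - v) == 0 by move: H; rewrite gsuppE negbK.
move/eqP->; rewrite mulr0 big1_seq // => x /andP[_ xf].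
by rewrite eqx; case: eqP xf H => [->->|].
Qed.

Lemma grpalg_ind (P : grpalg R G -> Prop) :
  P 0 -> (forall f g, P f -> P g -> P (f + g)) ->
  (forall c v, P (gmono c v)) -> forall f, P f.
Proof.
move=> P0 PD PU f; rewrite [f]gsumE; elim/big_ind: _ => // v _; exact: PU.
Qed.

Definition gpart (S : G -> bool) f : grpalg R G :=
  \sum_(v <- gsupp f | S v) gmono (gcoef f v) v.

Lemma gcoef_part S f v : gcoef (gpart S f) v = if S v then gcoef f v else 0.
Proof.
rewrite gcoef_sum; under eq_bigr => x _ do rewrite gcoef_mono.
have [H|H] := boolP (v \in gsupp f); last first.
  have: gcoef f v == 0 by move: H; rewrite gsuppE negbK.
  move/eqP->; rewrite if_same big1_seq // => x /andP[_ xf].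
  by case: eqP xf H => [->->|].
rewrite big_mkcond (big_fsetD1 v) //= eqxx mulr1n big1_fset ?addr0 // => x.
by rewrite in_fsetD1 => /andP[/negbTE-> _] _; rewrite mulr0n if_same.
Qed.

Section Evaluation.
Variables (C : comNzRingType) (phi : {rmorphism R -> C}) (chi : G -> C).
Hypotheses (chi0 : chi 0 = 1) (chiD : {morph chi : v w / v + w >-> v * w}).

Definition geval f : C := \sum_(v <- gsupp f) phi (gcoef f v) * chi v.

Lemma gevalEw (d : {fset G}) f : (gsupp f `<=` d)%fset ->
  geval f = \sum_(v <- d) phi (gcoef f v) * chi v.
Proof.
move=> le_d; rewrite /geval (big_fset_incl _ le_d) //= => v _.
by rewrite gsuppE negbK => /eqP->; rewrite rmorph0 mul0r.
Qed.

Lemma geval_mono c v : geval (gmono c v) = phi c * chi v.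
Proof.
rewrite (@gevalEw [fset v]%fset) ?msuppU_le // big_seq_fset1 gcoef_mono eqxx.
by rewrite mulr1n.
Qed.

Lemma geval_is_additive : {morph geval : f g / f - g}.
Proof.
move=> f g; pose d := (gsupp f `|` gsupp g)%fset.
rewrite (@gevalEw d (f - g)) ?msuppB_le // (@gevalEw d f) ?fsubsetUl //.
rewrite (@gevalEw d g) ?fsubsetUr // -sumrB; apply: eq_bigr => v _.
by rewrite gcoefB rmorphB mulrBl.
Qed.

HB.instance Definition _ :=
  GRing.isZmodMorphism.Build (grpalg R G) C geval geval_is_additive.

Lemma geval_is_monoid : monoid_morphism geval.
Proof.
split; first by rewrite -gmono1 geval_mono rmorph1 chi0 mulr1.
move=> f g; elim/grpalg_ind: f => [|f1 f2 H1 H2|c v].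
- by rewrite mul0r raddf0 mul0r.
- by rewrite mulrDl !raddfD /= H1 H2 mulrDl.
elim/grpalg_ind: g => [|g1 g2 H1 H2|d w].
- by rewrite mulr0 raddf0 mulr0.
- by rewrite mulrDr !raddfD /= H1 H2 mulrDr.
by rewrite gmonoM !geval_mono rmorphM chiD mulrACA.
Qed.

End Evaluation.

End GroupAlgebraTheory.

Section BivariateEvaluation.
Variables (R C : comNzRingType) (phi : {rmorphism R -> C}) (x y : C).

Definition eval2 : {poly {poly R}} -> C :=
  horner_eval y \o map_poly (horner_eval x \o map_poly phi).

HB.instance Definition _ := GRing.RMorphism.on eval2.

Lemma eval2C c : eval2 c%:P%:P = phi c.
Proof. by rewrite /eval2 /= map_polyC /= !horner_evalE hornerC map_polyC /= hornerC. Qed.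

Lemma eval2x : eval2 'X%:P = x.
Proof. by rewrite /eval2 /= map_polyC /= !horner_evalE hornerC map_polyX hornerX. Qed.

Lemma eval2y : eval2 'X = y.
Proof. by rewrite /eval2 /= map_polyX !horner_evalE hornerX. Qed.

End BivariateEvaluation.

#[global] Opaque eval2.

Lemma latticeMn (v : lattice) i : v *+ i = (v.1 *+ i, v.2 *+ i).
Proof. by elim: i => [//|i IH]; rewrite !mulrS IH. Qed.

(* An abstract copy of [laurent k]: unification would otherwise unfold the
   convolution product of the group algebra at every failing rewrite. *)
Record laurentRing (k : closedFieldType) := LaurentRing {
  lring :> comNzRingType;
  lcoef : lring -> lattice -> k;
  lgmono : k -> lattice -> lring;
  lpart : (lattice -> bool) -> lring -> lring;
  lsubst : (lattice -> lring) -> lring -> lring;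
  lcoef_inj : forall f g : lring, (forall v, lcoef f v = lcoef g v) -> f = g;
  lcoefB : forall (f g : lring) v, lcoef (f - g) v = lcoef f v - lcoef g v;
  lcoef_gmono : forall c v w, lcoef (lgmono c v) w = c *+ (v == w);
  lcoef_gmonoM : forall c v (f : lring) w,
    lcoef (lgmono c v * f) w = c * lcoef f (w - v);
  lgmonoM : forall c d v w, lgmono c v * lgmono d w = lgmono (c * d) (v + w);
  lgmono1 : lgmono 1 0 = 1;
  laurent_sum_ind : forall (P : lring -> Prop) (f : lring),
    P 0 -> (forall g h : lring, P g -> P h -> P (g + h)) ->
    (forall v, lcoef f v != 0 -> P (lgmono (lcoef f v) v)) -> P f;
  lcoef_part : forall (S : lattice -> bool) f v,
    lcoef (lpart S f) v = if S v then lcoef f v else 0;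
  lsubst_gmono : forall (chi : lattice -> lring) c v,
    lsubst chi (lgmono c v) = lgmono c 0 * chi v;
  lsubst_is_zmod : forall chi : lattice -> lring, zmod_morphism (lsubst chi);
  lsubst_is_monoid : forall chi : lattice -> lring, chi 0 = 1 ->
    {morph chi : v w / v + w >-> v * w} -> monoid_morphism (lsubst chi)
}.

Section LaurentTheory.
Variables (k : closedFieldType) (L : laurentRing k).
Implicit Types (f g h : L) (c d : k) (v w : lattice) (S T U : lattice -> bool).
Local Notation lgmono := (@lgmono k L).
Local Notation lcoef := (@lcoef k L).

Lemma lcoef_eqP f g : (forall v, lcoef f v = lcoef g v) <-> f = g.
Proof. by split=> [/lcoef_inj|->]. Qed.

Lemma lcoef0 v : lcoef 0 v = 0.
Proof. by rewrite -(subrr (0 : L)) lcoefB subrr. Qed.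

Lemma lcoefN f v : lcoef (- f) v = - lcoef f v.
Proof. by rewrite -[- f]add0r lcoefB lcoef0 add0r. Qed.

Lemma lcoefD f g v : lcoef (f + g) v = lcoef f v + lcoef g v.
Proof. by rewrite -{1}[g]opprK lcoefB lcoefN opprK. Qed.

Lemma laurent_ind (P : L -> Prop) :
  P 0 -> (forall f g, P f -> P g -> P (f + g)) ->
  (forall c v, P (lgmono c v)) -> forall f, P f.
Proof. by move=> P0 PD PU f; apply: laurent_sum_ind => // v _; exact: PU. Qed.

Definition lsupported S f := forall v, lcoef f v != 0 -> S v.

Lemma lsupportedP S f : lsupported S f <-> forall v, lcoef f v != 0 -> S v.
Proof. by []. Qed.

Lemma lsupported0 S : lsupported S 0.
Proof. by move=> v; rewrite lcoef0 eqxx. Qed.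

Lemma lsupportedD S f g : lsupported S f -> lsupported S g -> lsupported S (f + g).
Proof.
move=> Sf Sg v; rewrite lcoefD; have [->|/Sf//] := eqVneq (lcoef f v) 0.
by rewrite add0r => /Sg.
Qed.

Lemma lsupportedN S f : lsupported S f -> lsupported S (- f).
Proof. by move=> Sf v; rewrite lcoefN oppr_eq0 => /Sf. Qed.

Lemma lsupportedB S f g : lsupported S f -> lsupported S g -> lsupported S (f - g).
Proof. by move=> Sf Sg; apply/lsupportedD/lsupportedN. Qed.

Lemma lsupported_gmono S c v : S v -> lsupported S (lgmono c v).
Proof.
by move=> Sv w; rewrite lcoef_gmono; case: (v =P w) => [<-//|_]; rewrite eqxx.
Qed.

Lemma lsupportedW S T f :
  (forall v, S v -> T v) -> lsupported S f -> lsupported T f.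
Proof. by move=> ST Sf v /Sf/ST. Qed.

Lemma lsupportedM S T U f g : (forall v w, S v -> T w -> U (v + w)) ->
  lsupported S f -> lsupported T g -> lsupported U (f * g).
Proof.
move=> STU Sf Tg; apply: (laurent_sum_ind (P := fun f => lsupported U (f * g))).
- by rewrite mul0r; exact: lsupported0.
- by move=> ? ? ? ?; rewrite mulrDl; exact: lsupportedD.
move=> v /Sf Sv; apply: (laurent_sum_ind (P := fun g => lsupported U (_ * g))).
- by rewrite mulr0; exact: lsupported0.
- by move=> ? ? ? ?; rewrite mulrDr; exact: lsupportedD.
by move=> w /Tg Tw; rewrite lgmonoM; exact/lsupported_gmono/STU.
Qed.

Lemma lsupported_part S f : lsupported S (lpart S f).
Proof. by move=> v; rewrite lcoef_part; case: ifP; rewrite ?eqxx. Qed.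

Lemma lsupported_partW S T f : lsupported T f -> lsupported T (lpart S f).
Proof. by move=> Tf v; rewrite lcoef_part; case: ifP; rewrite ?eqxx // => _ /Tf. Qed.

Lemma lpartD S f g : lpart S (f + g) = lpart S f + lpart S g.
Proof.
by apply/lcoef_eqP => v; rewrite !(lcoefD, lcoef_part); case: ifP; rewrite ?addr0.
Qed.

Lemma lpartN S f : lpart S (- f) = - lpart S f.
Proof.
by apply/lcoef_eqP => v; rewrite !(lcoefN, lcoef_part); case: ifP; rewrite ?oppr0.
Qed.

Lemma lpartB S f g : lpart S (f - g) = lpart S f - lpart S g.
Proof. by rewrite lpartD lpartN. Qed.

Lemma lpart_id S f : lsupported S f -> lpart S f = f.
Proof.
move=> Sf; apply/lcoef_eqP => v; rewrite lcoef_part; case: ifP => // Sv.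
by apply/esym/eqP; apply: contraFT Sv => /Sf.
Qed.

Lemma lpart_disj S T f : (forall v, T v -> ~~ S v) -> lsupported T f -> lpart S f = 0.
Proof.
move=> TS Tf; apply/lcoef_eqP => v; rewrite lcoef_part lcoef0.
case: ifP => // Sv; apply/eqP; apply: contraT => /Tf/TS; by rewrite Sv.
Qed.

Definition lconst c : L := lgmono c 0.

Lemma lconst_is_zmod : zmod_morphism lconst.
Proof.
move=> c d; apply/lcoef_eqP => v; rewrite lcoefB !lcoef_gmono; exact: mulrnBl.
Qed.

HB.instance Definition _ := GRing.isZmodMorphism.Build k L lconst lconst_is_zmod.

Lemma lconst_is_monoid : monoid_morphism lconst.
Proof. by split=> [|c d]; rewrite /lconst ?lgmono1 // lgmonoM addr0. Qed.

HB.instance Definition _ := GRing.isMonoidMorphism.Build k L lconst lconst_is_monoid.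

Lemma lconstE c : lconst c = lgmono c 0. Proof. by []. Qed.

Definition lvar1 : L := lgmono 1 (1, 0).
Definition lvar2 : L := lgmono 1 (0, 1).

Definition lmono v : L := lgmono 1 v.

Lemma lmonoD v w : lmono (v + w) = lmono v * lmono w.
Proof. by rewrite /lmono lgmonoM mulr1. Qed.

Lemma lmono0 : lmono 0 = 1. Proof. exact: lgmono1. Qed.

Lemma lmonoK v : lmono (- v) * lmono v = 1.
Proof. by rewrite -lmonoD addNr lmono0. Qed.

Lemma lmonoX v i : lmono v ^+ i = lmono (v *+ i).
Proof.
elim: i => [|i IH]; first by rewrite expr0 mulr0n lmono0.
by rewrite exprS IH -lmonoD mulrS.
Qed.

Lemma lx_mono : lvar1 = lmono (1, 0). Proof. exact: erefl. Qed.
Lemma ly_mono : lvar2 = lmono (0, 1). Proof. exact: erefl. Qed.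

Lemma lgmonoE (c : k) v : lgmono c v = lconst c * lmono v.
Proof. by rewrite lconstE /lmono lgmonoM mulr1 add0r. Qed.

Lemma lcoef_lmonoM v f w : lcoef (lmono v * f) w = lcoef f (w - v).
Proof. by rewrite lcoef_gmonoM mul1r. Qed.

Lemma lmono_inj v f g : lmono v * f = lmono v * g -> f = g.
Proof.
by move/(congr1 (fun h => lmono (- v) * h)); rewrite !mulrA lmonoK !mul1r.
Qed.

Lemma lmono_nat (i j : nat) : lmono (i%:Z, j%:Z) = lvar1 ^+ i * lvar2 ^+ j.
Proof.
rewrite lx_mono ly_mono !lmonoX -lmonoD !latticeMn; apply: congr1.
by congr pair; rewrite /= ?mul0rn ?addr0 ?add0r natz.
Qed.

Definition lpoly : {poly {poly k}} -> L := eval2 lconst lvar1 lvar2.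

HB.instance Definition _ := GRing.RMorphism.on lpoly.

Lemma lpoly0 : lpoly 0 = 0. Proof. exact: rmorph0. Qed.
Lemma lpolyD P Q : lpoly (P + Q) = lpoly P + lpoly Q. Proof. exact: rmorphD. Qed.
Lemma lpolyB P Q : lpoly (P - Q) = lpoly P - lpoly Q. Proof. exact: rmorphB. Qed.
Lemma lpolyM P Q : lpoly (P * Q) = lpoly P * lpoly Q. Proof. exact: rmorphM. Qed.
Lemma lpolyXn P i : lpoly (P ^+ i) = lpoly P ^+ i. Proof. exact: rmorphXn. Qed.
Lemma lpoly1 : lpoly 1 = 1. Proof. exact: rmorph1. Qed.
Lemma lpoly_sum (I : Type) (r : seq I) (A : pred I) (F : I -> {poly {poly k}}) :
  lpoly (\sum_(i <- r | A i) F i) = \sum_(i <- r | A i) lpoly (F i).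
Proof. exact: rmorph_sum. Qed.
Lemma lpolyC c : lpoly c%:P%:P = lconst c. Proof. exact: eval2C. Qed.
Lemma lpolyx : lpoly 'X%:P = lvar1. Proof. exact: eval2x. Qed.
Lemma lpolyy : lpoly 'X = lvar2. Proof. exact: eval2y. Qed.

Lemma lcoef_lpoly_inner (p : {poly k}) v : lcoef (lpoly p%:P) v =
  if (v.2 == 0) && (0 <= v.1) then p`_(absz v.1) else 0.
Proof.
elim/poly_ind: p v => [|p c IH] v.
  by rewrite ?polyC0 lpoly0 lcoef0 coef0 if_same.
rewrite polyCD polyCM lpolyD lpolyM lpolyx lpolyC lcoefD mulrC.
rewrite lx_mono lcoef_lmonoM IH lconstE lcoef_gmono /= coefD coefMX coefC subr0.
case: v => i j /=; rewrite -pair_eqE /= eq_sym [0 == j]eq_sym.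
case: (j == 0); rewrite ?andbF ?andbT /= ?addr0 //.
case: i => [[|i]|i] //=.
- by rewrite subn1 mulr0n.
- by rewrite mulr0n addr0.
Qed.

Lemma lcoef_lpoly P v : lcoef (lpoly P) v =
  if (0 <= v.1) && (0 <= v.2) then P`_(absz v.2)`_(absz v.1) else 0.
Proof.
elim/poly_ind: P v => [|P p IH] v.
  by rewrite ?polyC0 lpoly0 lcoef0 !coef0 if_same.
rewrite lpolyD lpolyM lpolyy lcoefD mulrC ly_mono lcoef_lmonoM IH.
rewrite lcoef_lpoly_inner /= coefD coefMX coefC subr0.
case: v => i j /=; case: (0 <= i); rewrite ?andbF ?addr0 //= andbT.
by case: j => [[|j]|j] //=; rewrite ?add0r ?subn1 ?addr0.
Qed.

Lemma lpoly_inj : injective lpoly.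
Proof.
move=> P Q PQ; apply/polyP => j; apply/polyP => i.
have E := lcoef_lpoly P (i%:Z, j%:Z); have := lcoef_lpoly Q (i%:Z, j%:Z).
by rewrite -PQ E.
Qed.

Lemma lsupported_lpoly f :
  lsupported (fun v => (0 <= v.1) && (0 <= v.2)) f -> exists P, f = lpoly P.
Proof.
move=> /lsupportedP Sf; apply: (laurent_sum_ind (P := fun f => exists P, f = lpoly P)) => [|_ _ [P ->] [Q ->]|v].
- by exists 0; rewrite lpoly0.
- by exists (P + Q); rewrite lpolyD.
move/Sf; case: v => -[i|//] [j|//] /= _.
exists ((lcoef f (i%:Z, j%:Z))%:P%:P * 'X%:P ^+ i * 'X ^+ j).
rewrite !lpolyM !lpolyXn lpolyC lpolyx lpolyy [RHS]/=.
by rewrite -mulrA -lmono_nat -lgmonoE.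
Qed.

Lemma lpoly_dense f : exists (i : nat) (P : {poly {poly k}}),
  lmono (i%:Z, i%:Z) * f = lpoly P.
Proof.
suff [i Hi] : exists i : nat, lsupported
    (fun v => (0 <= v.1) && (0 <= v.2)) (lmono (i%:Z, i%:Z) * f).
  by exists i; exact: lsupported_lpoly.
have: exists i : nat, lsupported (fun v => (- i%:Z <= v.1) && (- i%:Z <= v.2)) f.
  elim/laurent_ind: f => [|f g [i Hi] [j Hj]|c v].
  - by exists 0%N; exact: lsupported0.
  - exists (i + j)%N; apply: lsupportedD; [apply: lsupportedW Hi|apply: lsupportedW Hj];
      by move=> v; lia.
  - by exists (absz v.1 + absz v.2)%N; apply: lsupported_gmono; lia.
case=> i /lsupportedP Hi; exists i; apply/lsupportedP => v.
by rewrite lcoef_lmonoM => /Hi /=; lia.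
Qed.

Lemma laurent_integral f g : f * g = 0 -> f = 0 \/ g = 0.
Proof.
have [i [P fP]] := lpoly_dense f; have [j [Q gQ]] := lpoly_dense g => fg0.
have: P * Q == 0.
  apply/eqP/lpoly_inj; rewrite lpolyM -fP -gQ lpoly0.
  by rewrite mulrACA fg0 mulr0.
rewrite mulf_eq0 => /orP[] /eqP E; [left|right].
- by apply: (@lmono_inj (i%:Z, i%:Z)); rewrite fP E lpoly0 mulr0.
- by apply: (@lmono_inj (j%:Z, j%:Z)); rewrite gQ E lpoly0 mulr0.
Qed.

Lemma lmulf_neq0 f g : f != 0 -> g != 0 -> f * g != 0.
Proof.
move=> f0 g0; apply/eqP => /laurent_integral[] /eqP; exact/negP.
Qed.

Lemma lexpf_neq0 f i : f != 0 -> f ^+ i != 0.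
Proof.
move=> f0; elim: i => [|i IH]; first by rewrite expr0 oner_neq0.
by rewrite exprS lmulf_neq0.
Qed.

Lemma lmulfI f g h : f != 0 -> f * g = f * h -> g = h.
Proof.
move=> f0 /eqP; rewrite -subr_eq0 -mulrBr => /eqP/laurent_integral[] /eqP.
- by rewrite (negbTE f0).
- by rewrite subr_eq0 => /eqP.
Qed.

Lemma lmono_neq0 v : lmono v != 0.
Proof.
by apply/eqP => /lcoef_eqP/(_ v)/eqP; rewrite lcoef_gmono eqxx lcoef0 oner_eq0.
Qed.

End LaurentTheory.

#[global] Opaque lpoly lmono lvar1 lvar2 lconst.

(** * Order of vanishing at e *)

Section PowersOfX.
Variable D : idomainType.
Implicit Types p r u : {poly D}.

Lemma polyX_mul_inj p r : 'X * p = 'X * r -> p = r.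
Proof. by apply: mulfI; rewrite polyX_eq0. Qed.

Lemma dvdX_coef0 p : p`_0 = 0 -> exists r, p = 'X * r.
Proof.
elim/poly_ind: p => [|p c _]; first by exists 0; rewrite mulr0.
rewrite coefD coefMX coefC add0r /= => ->; exists p.
by rewrite addr0 mulrC.
Qed.

Lemma dvdXn_mul M a p r : (exists s, p * r = 'X^M * s) ->
  ~ (exists s, p = 'X^(a.+1) * s) -> exists s, r = 'X^(M - a) * s.
Proof.
elim: M a p r => [|M IH] a p r [s E] Hp.
  by exists r; rewrite sub0n expr0 mul1r.
have: (p * r)`_0 == 0 by rewrite E exprS -mulrA coefXM.
rewrite coef0M mulf_eq0 => /orP[/eqP/dvdX_coef0[p1 Ep]|/eqP/dvdX_coef0[r1 Er]].
  case: a Hp => [|a] Hp; first by case: Hp; exists p1; rewrite expr1.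
  rewrite subSS; apply: (IH a p1); last first.
    by case=> t Et; apply: Hp; exists t; rewrite Ep Et !exprS mulrA.
  by exists s; apply: polyX_mul_inj; rewrite !mulrA -Ep E exprS.
have [s' Es'] : exists s', p * r1 = 'X^M * s'.
  exists s; apply: polyX_mul_inj; rewrite mulrCA -Er E exprS; ring.
have [t Et] := IH a p r1 (ex_intro _ _ Es') Hp.
have [aM|Ma] := leqP a M; last by exists r; rewrite (eqP (_ : M.+1 - a == 0)%N) ?expr0 ?mul1r // subn_eq0.
by exists t; rewrite subSn // Er Et exprS mulrA.
Qed.

End PowersOfX.

Section Vanishing.
Variables (k : closedFieldType) (L : laurentRing k).
Local Notation poly2 := {poly {poly k}}.
Local Notation lmono := (@lmono k L).
Local Notation lpoly := (@lpoly k L).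
Local Notation lconst := (@lconst k L).
Local Notation X := (lvar1 L - 1).
Local Notation Y := (lvar2 L - 1).
Implicit Types (f g h : L) (P Q : poly2).

(* [vanishes_at_e] for an abstract Laurent ring. *)
Definition vanishes f m := exists g : 'I_m.+1 -> L,
  f = \sum_(j < m.+1) g j * X ^+ j * Y ^+ (m - j).

Lemma vanishes0n m : vanishes 0 m.
Proof. by exists (fun=> 0); rewrite big1 // => j _; rewrite !mul0r. Qed.

Lemma vanishesD f g m :
  vanishes f m -> vanishes g m -> vanishes (f + g) m.
Proof.
case=> F -> [H ->]; exists (fun j => F j + H j).
by rewrite -big_split; apply: eq_bigr => j _ /=; rewrite !mulrDl.
Qed.

Lemma vanishesMl f g m : vanishes g m -> vanishes (f * g) m.
Proof.
case=> H ->; exists (fun j => f * H j).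
by rewrite mulr_sumr; apply: eq_bigr => j _ /=; rewrite !mulrA.
Qed.

Lemma vanishesN f m : vanishes f m -> vanishes (- f) m.
Proof. by rewrite -mulN1r; exact: vanishesMl. Qed.

Lemma vanishesB f g m :
  vanishes f m -> vanishes g m -> vanishes (f - g) m.
Proof. by move=> Vf Vg; apply/vanishesD/vanishesN. Qed.

Lemma vanishes_sum (I : Type) (r : seq I) (P : pred I) (F : I -> L) m :
  (forall i, P i -> vanishes (F i) m) ->
  vanishes (\sum_(i <- r | P i) F i) m.
Proof.
by move=> H; apply: (big_ind (fun f => vanishes f m)) => //; [exact: vanishes0n|exact: (fun f g => @vanishesD f g m)].
Qed.

Lemma vanishes_mono h i j m : (m <= i + j)%N ->
  vanishes (h * X ^+ i * Y ^+ j) m.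
Proof.
move=> le_m; have [i0 [i0i i0P i0j]] : exists i0, [/\ i0 <= i, i0 < m.+1 & m - i0 <= j]%N.
  by exists (minn i m); split; lia.
exists (fun l => if l == Ordinal i0P then h * X ^+ (i - i0) * Y ^+ (j - (m - i0)) else 0).
rewrite (bigD1 (Ordinal i0P)) //= eqxx big1 ?addr0; last first.
  by move=> l /negbTE->; rewrite !mul0r.
have Ei : X ^+ i = X ^+ (i - i0) * X ^+ i0 by rewrite -exprD subnK.
have Ej : Y ^+ j = Y ^+ (j - (m - i0)) * Y ^+ (m - i0).
  by rewrite -exprD subnK.
by rewrite Ei Ej; ring.
Qed.

Lemma vanishes_ge0 f : vanishes f 0.
Proof. by have := @vanishes_mono f 0 0 0 (leqnn _); rewrite !expr0 !mulr1. Qed.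

Lemma vanishesW f m m' : (m' <= m)%N -> vanishes f m -> vanishes f m'.
Proof.
move=> le_m [F ->]; apply: vanishes_sum => j _; apply: vanishes_mono.
by have := ltn_ord j; lia.
Qed.

Lemma vanishesM f g m m' :
  vanishes f m -> vanishes g m' -> vanishes (f * g) (m + m').
Proof.
case=> F -> [H ->]; rewrite mulr_suml; apply: vanishes_sum => j _.
rewrite mulr_sumr; apply: vanishes_sum => l _.
have -> : F j * X ^+ j * Y ^+ (m - j) * (H l * X ^+ l * Y ^+ (m' - l)) =
  F j * H l * X ^+ (j + l) * Y ^+ ((m - j) + (m' - l)) by rewrite !exprD; ring.
by apply: vanishes_mono; have := ltn_ord j; have := ltn_ord l; lia.
Qed.

Lemma vanishesX f m i : vanishes f m -> vanishes (f ^+ i) (m * i).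
Proof.
move=> Vf; elim: i => [|i IH]; first by rewrite muln0; exact: vanishes_ge0.
by rewrite exprS mulnS; exact: vanishesM.
Qed.

Lemma vanishes_lmono v f m :
  vanishes (lmono v * f) m <-> vanishes f m.
Proof.
split; last exact: vanishesMl.
by move/(@vanishesMl (lmono (- v))); rewrite mulrA lmonoK mul1r.
Qed.

Lemma vanishes_x1 : vanishes X 1.
Proof. by have := @vanishes_mono 1 1 0 1 (leqnn _); rewrite mul1r expr0 expr1 mulr1. Qed.

Lemma vanishes_y1 : vanishes Y 1.
Proof. by have := @vanishes_mono 1 0 1 1 (leqnn _); rewrite mul1r expr0 expr1 mul1r. Qed.

Lemma lmonoMz (w : lattice) (i : int) :
  exists h, lmono (w *~ i) = 1 + (lmono w - 1) * h.
Proof.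
have P (j : nat) : exists h, lmono w ^+ j = 1 + (lmono w - 1) * h.
  elim: j => [|j [h IH]]; first by exists 0; rewrite expr0 mulr0 addr0.
  by exists (h + lmono w ^+ j); rewrite exprS IH; ring.
case: i => i; first by have [h E] := P i; exists h; rewrite -E lmonoX.
have [h E] := P i.+1; exists (- (lmono (- (w *+ i.+1)) * h)).
have K := lmonoK L (w *+ i.+1); rewrite -lmonoX E in K.
rewrite NegzE mulrNz -pmulrn; move: K; set z := lmono (- _) => K.
transitivity (z * (1 + (lmono w - 1) * h) - (lmono w - 1) * (z * h)); first by ring.
by rewrite K; ring.
Qed.

Lemma lattice_basis (i j : int) : (i, j) = ((1, 0) : lattice) *~ i + (0, 1) *~ j.
Proof.
have M (w : lattice) (l : int) : w *~ l = (w.1 *~ l, w.2 *~ l).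
  case: l => l; first exact: latticeMn.
  by rewrite !NegzE !mulrNz -!pmulrn latticeMn.
by rewrite !M; congr pair; rewrite /= ?mul0rz ?addr0 ?add0r mulrzz mul1r.
Qed.

Lemma lmonoB1 v : exists h h', lmono v = 1 + X * h + Y * h'.
Proof.
case: v => i j; have [h E] := lmonoMz (1, 0) i; have [h' E'] := lmonoMz (0, 1) j.
exists h, (h' * (1 + X * h)).
by rewrite lattice_basis lmonoD E E' -lx_mono -ly_mono; ring.
Qed.

Lemma laurent_dec f : exists c h h', f = lconst c + X * h + Y * h'.
Proof.
elim/laurent_ind: f => [|f g [c [h [h' ->]]] [d [l [l' ->]]]|c v].
- by exists 0, 0, 0; rewrite rmorph0; ring.
- by exists (c + d), (h + l), (h' + l'); rewrite rmorphD /=; ring.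
- have [h [h' E]] := lmonoB1 v; exists c, (lconst c * h), (lconst c * h').
  by rewrite lgmonoE E; ring.
Qed.

Definition taylor m (c : nat -> nat -> k) : L :=
  \sum_(i < m) \sum_(j < m - i) lconst (c i j) * X ^+ i * Y ^+ j.

Lemma taylorD m c d :
  taylor m (fun i j => c i j + d i j) = taylor m c + taylor m d.
Proof.
rewrite /taylor -big_split; apply: eq_bigr => i _ /=.
by rewrite -big_split; apply: eq_bigr => j _ /=; rewrite rmorphD /= !mulrDl.
Qed.

Definition has_taylor m f := exists c, vanishes (f - taylor m c) m.

Lemma has_taylorD m f g : has_taylor m f -> has_taylor m g -> has_taylor m (f + g).
Proof.
case=> c Vc [d Vd]; exists (fun i j => c i j + d i j).
by rewrite taylorD opprD addrACA; exact: vanishesD.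
Qed.

Lemma taylor0 m : taylor m (fun _ _ => 0) = 0.
Proof. by rewrite /taylor big1 // => i _; rewrite big1 // => j _; rewrite rmorph0 !mul0r. Qed.

Lemma has_taylor_vanishes m f : vanishes f m -> has_taylor m f.
Proof. by exists (fun _ _ => 0); rewrite taylor0 subr0. Qed.

Lemma has_taylor_sum m (I : Type) (r : seq I) (P : pred I) (F : I -> L) :
  (forall i, P i -> has_taylor m (F i)) -> has_taylor m (\sum_(i <- r | P i) F i).
Proof.
move=> H; apply: big_ind => //; [exact/has_taylor_vanishes/vanishes0n|].
by move=> f g; exact: has_taylorD.
Qed.

Lemma has_taylor_mono m (c : k) i j : has_taylor m (lconst c * X ^+ i * Y ^+ j).
Proof.
have [le_m|lt_m] := leqP m (i + j)%N.
  exact/has_taylor_vanishes/vanishes_mono.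
exists (fun i' j' => if (i' == i) && (j' == j) then c else 0).
have Hi : (i < m)%N by lia. have Hj : (j < m - i)%N by lia.
rewrite /taylor (bigD1 (Ordinal Hi)) //= (bigD1 (Ordinal Hj)) //= !eqxx /=.
rewrite (@big1 _ _ _ _ _ (fun l => l != Ordinal Hj)) => [|l]; last first.
  by rewrite -val_eqE /= => /negbTE->; rewrite rmorph0 !mul0r.
rewrite (@big1 _ _ _ _ _ (fun l => l != Ordinal Hi)) => [|l]; last first.
  rewrite -val_eqE /= => /negbTE->; rewrite big1 // => l' _.
  by rewrite rmorph0 !mul0r.
by rewrite !addr0 subrr; exact: vanishes0n.
Qed.

Lemma has_taylorP m f : has_taylor m f.
Proof.
elim: m f => [|m IH] f; first exact/has_taylor_vanishes/vanishes_ge0.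
have [c [h [h' ->]]] := laurent_dec f.
have [c1 V1] := IH h; have [c2 V2] := IH h'.
have -> : lconst c + X * h + Y * h' = lconst c * X ^+ 0 * Y ^+ 0 +
  ((X * (h - taylor m c1) + Y * (h' - taylor m c2)) +
   (X * taylor m c1 + Y * taylor m c2)) by ring.
apply: has_taylorD; first exact: has_taylor_mono.
apply: has_taylorD.
  apply/has_taylor_vanishes/vanishesD; rewrite -[m.+1]add1n;
    [exact/(vanishesM vanishes_x1)|exact/(vanishesM vanishes_y1)].
apply: has_taylorD; rewrite /taylor mulr_sumr; apply: has_taylor_sum => i _;
  rewrite mulr_sumr; apply: has_taylor_sum => j _.
- have -> : X * (lconst (c1 i j) * X ^+ i * Y ^+ j) =
    lconst (c1 i j) * X ^+ i.+1 * Y ^+ j by rewrite exprS; ring.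
  exact: has_taylor_mono.
- have -> : Y * (lconst (c2 i j) * X ^+ i * Y ^+ j) =
    lconst (c2 i j) * X ^+ i * Y ^+ j.+1 by rewrite exprS; ring.
  exact: has_taylor_mono.
Qed.

(* Order of vanishing at e is the multiplicity of the root t = 0 after
   substituting x = 1 + X t, y = 1 + Y t. *)
Definition blow : poly2 -> {poly poly2} :=
  eval2 (polyC \o polyC \o polyC : {rmorphism k -> {poly poly2}}) (1 + ('X%:P)%:P * 'X) (1 + 'X%:P * 'X).

HB.instance Definition _ := GRing.RMorphism.on blow.

Lemma blowB P Q : blow (P - Q) = blow P - blow Q. Proof. exact: rmorphB. Qed.
Lemma blowM P Q : blow (P * Q) = blow P * blow Q. Proof. exact: rmorphM. Qed.

Lemma lpoly_dense_ord n (F : 'I_n -> L) : exists (i : nat) (Q : 'I_n -> poly2),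
  forall j, lmono (i%:Z, i%:Z) * F j = lpoly (Q j).
Proof.
elim: n F => [|n IH] F; first by exists 0%N, (fun=> 0); case.
have [i [Q HQ]] := IH (fun j => F (lift ord0 j)).
have [i' [P HP]] := lpoly_dense (F ord0).
exists (i + i')%N, (fun j => if unlift ord0 j is Some l
  then ('X%:P * 'X) ^+ i' * Q l else ('X%:P * 'X) ^+ i * P).
have E (a : nat) : lpoly (('X%:P * 'X) ^+ a) = lmono (a%:Z, a%:Z).
  by rewrite lpolyXn lpolyM lpolyx lpolyy lmono_nat exprMn.
have E2 : lmono ((i + i')%N%:Z, (i + i')%N%:Z) =
  lmono (i%:Z, i%:Z) * lmono (i'%:Z, i'%:Z).
  by rewrite -lmonoD; congr lmono; rewrite !PoszD.
move=> j; rewrite E2; case: unliftP => [l ->|->].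
  by rewrite lpolyM E -HQ; ring.
by rewrite lpolyM E -HP; ring.
Qed.

Lemma blow_vanishes P m : vanishes (lpoly P) m ->
  exists Q : {poly poly2}, blow P = 'X^m * Q.
Proof.
case=> g E; have [i [Q HQ]] := lpoly_dense_ord g.
have EA : lpoly (('X%:P * 'X) ^+ i) = lmono (i%:Z, i%:Z).
  by rewrite lpolyXn lpolyM lpolyx lpolyy lmono_nat exprMn.
have: ('X%:P * 'X) ^+ i * P =
    \sum_(j < m.+1) Q j * ('X%:P - 1) ^+ j * ('X - 1) ^+ (m - j).
  apply: (@lpoly_inj k L); rewrite lpolyM lpoly_sum EA E mulr_sumr.
  apply: eq_bigr => j _; rewrite !lpolyM -HQ !lpolyXn !lpolyB lpoly1.
  by rewrite lpolyx lpolyy !mulrA.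
move/(congr1 blow); rewrite rmorphM rmorph_sum /= => EB.
have bx : blow 'X%:P = 1 + ('X%:P)%:P * 'X by exact: eval2x.
have bY : blow 'X = 1 + 'X%:P * 'X by exact: eval2y.
have EC : blow P * blow (('X%:P * 'X) ^+ i) = 'X^m * (\sum_(j < m.+1)
    blow (Q j) * ('X%:P)%:P ^+ j * 'X%:P ^+ (m - j)).
  rewrite mulrC EB mulr_sumr; apply: eq_bigr => j _.
  rewrite !rmorphM !rmorphXn !rmorphB !rmorph1 /= bx bY.
  have -> : 'X^m = 'X^j * 'X^(m - j) :> {poly poly2}.
    by rewrite -exprD subnKC // -ltnS.
  by rewrite ![1 + _]addrC !addrK !exprMn; ring.
have := @dvdXn_mul _ m 0 (blow (('X%:P * 'X) ^+ i)) (blow P).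
rewrite subn0; apply; first by rewrite mulrC EC; eexists.
case=> s /(congr1 (fun p : {poly poly2} => p`_0)); rewrite expr1 coefXM /= => /eqP.
rewrite rmorphXn rmorphM /= bx bY -horner_coef0 horner_exp !hornerE.
by rewrite ?mulr0 ?addr0 ?mulr1 expr1n oner_eq0.
Qed.

Definition taylorp m (c : nat -> nat -> k) : poly2 :=
  \sum_(i < m) \sum_(j < m - i) (c i j)%:P%:P * ('X%:P - 1) ^+ i * ('X - 1) ^+ j.

Lemma lpoly_taylor m c : lpoly (taylorp m c) = taylor m c.
Proof.
rewrite /taylorp lpoly_sum; apply: eq_bigr => i _; rewrite lpoly_sum.
apply: eq_bigr => j _; rewrite !lpolyM !lpolyXn !lpolyB lpoly1.
by rewrite lpolyC lpolyx lpolyy.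
Qed.

Lemma blow_taylor m c : blow (taylorp m c) = \sum_(i < m) \sum_(j < m - i)
  (((c i j)%:P * 'X^i)%:P * 'X^j)%:P * 'X^(i + j).
Proof.
rewrite /taylorp rmorph_sum; apply: eq_bigr => i _; rewrite rmorph_sum /=.
apply: eq_bigr => j _; rewrite !rmorphM !rmorphXn !rmorphB !rmorph1 /=.
have -> : blow 'X%:P = 1 + ('X%:P)%:P * 'X by exact: eval2x.
have -> : blow 'X = 1 + 'X%:P * 'X by exact: eval2y.
have -> : blow (c i j)%:P%:P = (c i j)%:P%:P%:P by exact: eval2C.
rewrite ![1 + _]addrC !addrK !exprMn exprD; ring.
Qed.

Lemma blow_taylor0 m c (Q : {poly poly2}) : blow (taylorp m c) = 'X^m * Q ->
  forall i j, (i + j < m)%N -> c i j = 0.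
Proof.
move=> E i j Hij; have := congr1 (fun p : {poly poly2} => p`_(i + j)`_j`_i) E.
rewrite coefXnM Hij !coef0 blow_taylor => <-.
have Hi : (i < m)%N by lia. have Hj : (j < m - i)%N by lia.
rewrite !coef_sum (bigD1 (Ordinal Hi)) //= !coef_sum (bigD1 (Ordinal Hj)) //=.
rewrite coefCM coefXn eqxx mulr1 coefCM coefXn eqxx mulr1 coefCM coefXn eqxx mulr1.
rewrite (@big1 _ _ _ _ _ (fun l => l != Ordinal Hj)) => [|l nl]; last first.
  rewrite coefCM coefXn.
  case: eqP => [Es|]; last by rewrite mulr0 !coef0.
  by case/negP: nl; rewrite -val_eqE /=; lia.
rewrite (@big1 _ _ _ _ _ (fun l => l != Ordinal Hi)) => [|l nl]; last first.
  rewrite !coef_sum big1 // => j' _.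
  rewrite coefCM coefXn; case: eqP => [Es|]; last by rewrite mulr0 !coef0.
  rewrite mulr1 coefCM coefXn; case: eqP => [Ej|]; last by rewrite mulr0 coef0.
  by case/negP: nl; rewrite -val_eqE /=; lia.
by rewrite !addr0.
Qed.

Lemma taylor_eq0 m c : vanishes (taylor m c) m ->
  forall i j, (i + j < m)%N -> c i j = 0.
Proof.
by rewrite -lpoly_taylor => /blow_vanishes[Q]; exact: blow_taylor0.
Qed.

Lemma vanishes_blow P m (Q : {poly poly2}) : blow P = 'X^m * Q -> vanishes (lpoly P) m.
Proof.
move=> EP; have [c Vc] := has_taylorP m (lpoly P).
have EP' : lpoly P - taylor m c = lpoly (P - taylorp m c).
  by rewrite lpolyB lpoly_taylor.
rewrite EP' in Vc.
have [Q' EQ'] := blow_vanishes Vc; rewrite blowB EP in EQ'.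
have c0 : forall i j, (i + j < m)%N -> c i j = 0.
  apply: (@blow_taylor0 _ _ (Q - Q')); rewrite mulrBr -EQ'; ring.
have T0 : taylorp m c = 0.
  rewrite /taylorp big1 // => i _; rewrite big1 // => j _.
  rewrite c0 ?polyC0 ?mul0r //; by have := ltn_ord i; have := ltn_ord j; lia.
by rewrite T0 subr0 in Vc.
Qed.

Lemma vanishes_div f g M a : vanishes (f * g) M -> ~ vanishes f a.+1 ->
  vanishes g (M - a).
Proof.
have [i [P fP]] := lpoly_dense f; have [j [Q gQ]] := lpoly_dense g => Vfg nVf.
apply/(vanishes_lmono (j%:Z, j%:Z)); rewrite gQ.
have H1 : exists s : {poly poly2}, blow P * blow Q = 'X^M * s.
  rewrite -blowM; apply: blow_vanishes; rewrite lpolyM -fP -gQ mulrACA.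
  exact: vanishesMl.
have H2 : ~ exists s : {poly poly2}, blow P = 'X^(a.+1) * s.
  case=> s Es; apply/nVf/(vanishes_lmono (i%:Z, i%:Z)); rewrite fP.
  exact: vanishes_blow Es.
have [s Es] := dvdXn_mul H1 H2; exact: vanishes_blow Es.
Qed.

End Vanishing.

Lemma pairingDr u v w : pairing u (v + w) = pairing u v + pairing u w.
Proof. by rewrite /pairing /=; ring. Qed.

Lemma pairingNr u v : pairing u (- v) = - pairing u v.
Proof. by rewrite /pairing /=; ring. Qed.

Lemma pairingNl u v : pairing (- u) v = - pairing u v.
Proof. by rewrite /pairing /=; ring. Qed.

Lemma pairing0r u : pairing u 0 = 0.
Proof. by rewrite /pairing /=; ring. Qed.

Lemma pairingMnr u v i : pairing u (v *+ i) = pairing u v *+ i.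
Proof. by elim: i => [|i IH]; rewrite ?mulr0n ?pairing0r // !mulrS pairingDr IH. Qed.

Section InitialForms.
Variables (k : closedFieldType) (L : laurentRing k).
Implicit Types (f g h : L) (u v w : lattice) (c d e : int).
Local Notation lcoef := (@lcoef k L).
Local Notation lgmono := (@lgmono k L).
Local Notation lmono := (@lmono k L).

Lemma lmonoE v : lmono v = lgmono 1 v.
Proof. by apply/lcoef_eqP => w; rewrite -[lmono v]mulr1 -(lmono0 L) lcoef_lmonoM
  -[lmono 0]mulr1 lcoef_lmonoM -(@lgmono1 k L) lcoef_gmono lcoef_gmono subr0 [in LHS]eq_sym subr_eq0 eq_sym. Qed.

Definition ge u c f := lsupported (fun v => c <= pairing u v) f.
Definition init u c f : L := lpart (fun v => pairing u v == c) f.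

Lemma lcoef_neq0 f : f != 0 -> exists v, lcoef f v != 0.
Proof.
move=> f0; apply: NNPP => H; case/negP: f0; apply/eqP/lcoef_eqP => v.
by rewrite lcoef0; apply/eqP/negPn/negP => fv; apply: H; exists v.
Qed.

Lemma geP u c f : ge u c f <-> forall v, lcoef f v != 0 -> c <= pairing u v.
Proof. by []. Qed.

Lemma ge0l u c : ge u c 0. Proof. exact: lsupported0. Qed.
Lemma geD u c f g : ge u c f -> ge u c g -> ge u c (f + g).
Proof. exact: lsupportedD. Qed.
Lemma geN u c f : ge u c f -> ge u c (- f).
Proof. exact: lsupportedN. Qed.
Lemma geB u c f g : ge u c f -> ge u c g -> ge u c (f - g).
Proof. exact: lsupportedB. Qed.
Lemma ge_gmono u c (x : k) v : c <= pairing u v -> ge u c (lgmono x v).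
Proof. exact: lsupported_gmono. Qed.

Lemma ge1 u c : c <= 0 -> ge u c 1.
Proof. by move=> c0; rewrite -(@lgmono1 k L); apply: ge_gmono; rewrite pairing0r. Qed.

Lemma geW u c d f : d <= c -> ge u c f -> ge u d f.
Proof. by move=> dc; apply: lsupportedW => v; exact: le_trans. Qed.

Lemma geM u c d f g : ge u c f -> ge u d g -> ge u (c + d) (f * g).
Proof. by apply: lsupportedM => v w; rewrite pairingDr; exact: lerD. Qed.

Lemma geX u c f i : ge u c f -> ge u (c *+ i) (f ^+ i).
Proof.
move=> Hf; elim: i => [|i IH]; first by rewrite mulr0n expr0; exact: ge1.
by rewrite mulrS exprS; exact: geM.
Qed.

Lemma ge_init u c d v f : ge v c f -> ge v c (init u d f).
Proof. exact: lsupported_partW. Qed.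

Lemma lsupported_init u c f : lsupported (fun v => pairing u v == c) (init u c f).
Proof. exact: lsupported_part. Qed.

Lemma initD u c f g : init u c (f + g) = init u c f + init u c g.
Proof. exact: lpartD. Qed.
Lemma initB u c f g : init u c (f - g) = init u c f - init u c g.
Proof. exact: lpartB. Qed.
Lemma initN u c f : init u c (- f) = - init u c f.
Proof. exact: lpartN. Qed.

Lemma init_gt u c d f : c < d -> ge u d f -> init u c f = 0.
Proof.
move=> cd; apply: lpart_disj => v dv.
by rewrite gt_eqF // (lt_le_trans cd).
Qed.

Lemma init_id u c f : lsupported (fun v => pairing u v == c) f -> init u c f = f.
Proof. exact: lpart_id. Qed.

Lemma init_gmono u (x : k) v : init u (pairing u v) (lgmono x v) = lgmono x v.
Proof. by apply/init_id/lsupported_gmono. Qed.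

Lemma init_lmono u v : init u (pairing u v) (lmono v) = lmono v.
Proof. by rewrite lmonoE init_gmono. Qed.

Lemma lcoef_init u c f v :
  lcoef (init u c f) v = if pairing u v == c then lcoef f v else 0.
Proof. exact: lcoef_part. Qed.

Lemma lcoef_sub_init u c f v :
  lcoef (f - init u c f) v = if pairing u v == c then 0 else lcoef f v.
Proof. by rewrite lcoefB lcoef_init; case: ifP; rewrite ?subrr ?subr0. Qed.

Lemma ge_sub_init u c f : ge u c f -> ge u (c + 1) (f - init u c f).
Proof.
move=> Hf v; rewrite lcoef_sub_init; case: ifP; rewrite ?eqxx // => vc /Hf /=.
by move: vc; lia.
Qed.

Lemma init_split u c f : ge u c f ->
  exists2 f', ge u (c + 1) f' & f = init u c f + f'.
Proof.
by move=> Hf; exists (f - init u c f); [exact: ge_sub_init|rewrite addrC subrK].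
Qed.

Lemma init_mul u c d f g : ge u c f -> ge u d g ->
  init u (c + d) (f * g) = init u c f * init u d g.
Proof.
move=> Hf Hg; have [f' Hf' Ef] := init_split Hf; have [g' Hg' Eg] := init_split Hg.
rewrite {1}Ef {1}Eg mulrDr mulrDl !initD.
rewrite (init_id (f := init u c f * init u d g)); last first.
  have ST (v w : lattice) : pairing u v == c -> pairing u w == d ->
    pairing u (v + w) == c + d by move=> /eqP Ev /eqP Ew; rewrite pairingDr Ev Ew.
  exact: (lsupportedM ST (@lsupported_init _ _ _) (@lsupported_init _ _ _)).
have S h e : ge u e (init u e h).
  by apply: lsupportedW (@lsupported_init u e h) => v /eqP->.
rewrite (@init_gt _ _ (c + 1 + d) (f' * init u d g)); [|lia|exact: geM].
rewrite (@init_gt _ _ (c + (d + 1)) (_ * g')); [|lia|apply: geM => //].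
  by rewrite addr0 addr0.
by apply: geD (S _ _) _; apply: geW Hf'; lia.
Qed.

Lemma init_exp u c f i : ge u c f -> init u (c *+ i) (f ^+ i) = init u c f ^+ i.
Proof.
move=> Hf; elim: i => [|i IH].
  rewrite mulr0n !expr0; apply/init_id; rewrite -(@lgmono1 k L).
  by apply/lsupported_gmono; rewrite pairing0r.
by rewrite mulrS !exprS init_mul ?IH //; exact: geX.
Qed.

Lemma ge_exists u f : exists c, ge u c f.
Proof.
elim/laurent_ind: f => [|f g [c Hc] [d Hd]|x v].
- by exists 0; exact: ge0l.
- exists (Num.min c d); apply: geD; [apply: geW Hc|apply: geW Hd];
    by rewrite ge_min lexx ?orbT.
- by exists (pairing u v); apply: ge_gmono.
Qed.

Lemma order_exists u f : f != 0 -> exists c, ge u c f /\ init u c f != 0.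
Proof.
move=> /lcoef_neq0[v fv]; have [c Hc] := ge_exists u f.
have [i Ei] : exists i : nat, pairing u v = c + i%:Z.
  by exists (absz (pairing u v - c)); have := Hc _ fv; lia.
elim: i c Hc Ei => [|i IH] c Hc Ei.
  exists c; split=> //; apply/eqP => /lcoef_eqP/(_ v).
  rewrite lcoef_part lcoef0 Ei addr0 eqxx => E; by rewrite E eqxx in fv.
have [E|] := eqVneq (init u c f) 0; last by exists c.
have [f' Hf' Ef] := init_split Hc; rewrite E add0r in Ef.
by apply: (IH (c + 1)); rewrite ?Ef // Ei; lia.
Qed.

Lemma init_supp u c f : init u c f != 0 ->
  exists v, lcoef f v != 0 /\ pairing u v = c.
Proof.
move=> /lcoef_neq0[v]; rewrite lcoef_part; case: ifP; last by rewrite eqxx.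
by move=> /eqP Ev fv; exists v.
Qed.

Lemma supp_init u c f v : lcoef f v != 0 -> pairing u v = c -> init u c f != 0.
Proof.
move=> fv Ev; apply/eqP => /lcoef_eqP/(_ v).
rewrite lcoef_part lcoef0 Ev eqxx => E; by rewrite E eqxx in fv.
Qed.

Lemma order_unique u c d f : ge u c f -> init u c f != 0 ->
  ge u d f -> init u d f != 0 -> c = d.
Proof.
move=> Hc /init_supp[v [fv Ev]] Hd /init_supp[w [fw Ew]].
by have := Hc _ fw; have := Hd _ fv; lia.
Qed.

Lemma ge_le u c d f : ge u c f -> init u d f != 0 -> c <= d.
Proof. by move=> Hc /init_supp[v [/Hc Hv <-]]. Qed.

Lemma ge_div u c d f g : ge u c f -> init u c f != 0 -> ge u d (f * g) ->
  ge u (d - c) g.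
Proof.
move=> Hf If Hfg; have [->|g0] := eqVneq g 0; first exact: ge0l.
have [e [He Ie]] := order_exists u g0; apply: (geW _ He).
have := @ge_le u d (c + e) (f * g) Hfg.
by rewrite (init_mul Hf He) => /(_ (lmulf_neq0 If Ie)); lia.
Qed.

End InitialForms.

#[global] Opaque ge init.

Lemma big_iota0 (R : nmodType) m (F : nat -> R) :
  \sum_(i <- iota 0 m) F i = \sum_(i < m) F i.
Proof. by rewrite -(big_mkord xpredT F) /index_iota subn0. Qed.

Section LinearSpan.
Variables (k : closedFieldType) (L : laurentRing k).
Implicit Types (f g h : L) (S T : seq L).
Local Notation lconst := (@lconst k L).
Local Notation X := (lvar1 L - 1).
Local Notation Y := (lvar2 L - 1).

Definition lincomb S (c : nat -> k) : L := \sum_(i < size S) lconst (c i) * S`_i.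
Definition span S f := exists c, f = lincomb S c.

Lemma lincombD S c d : lincomb S c + lincomb S d = lincomb S (fun i => c i + d i).
Proof.
by rewrite /lincomb -big_split; apply: eq_bigr => i _; rewrite rmorphD mulrDl.
Qed.

Lemma lincomb_cat S T c : lincomb (S ++ T) c =
  lincomb S c + lincomb T (fun i => c (size S + i)%N).
Proof.
rewrite /lincomb size_cat big_split_ord /=; congr (_ + _); apply: eq_bigr => i _.
  by rewrite nth_cat ltn_ord.
by rewrite nth_cat ltnNge leq_addr /= addKn.
Qed.

Lemma lincomb_catE S T c d : lincomb S c + lincomb T d =
  lincomb (S ++ T) (fun i => if (i < size S)%N then c i else d (i - size S)%N).
Proof.
rewrite lincomb_cat; congr (_ + _); apply: eq_bigr => i _.
  by rewrite ltn_ord.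
by rewrite ltnNge leq_addr /= addKn.
Qed.

Lemma lincomb0 S : lincomb S (fun=> 0) = 0.
Proof. by rewrite /lincomb big1 // => i _; rewrite rmorph0 mul0r. Qed.

Lemma span0 S : span S 0. Proof. by exists (fun=> 0); rewrite lincomb0. Qed.

Lemma spanD S f g : span S f -> span S g -> span S (f + g).
Proof. by case=> c -> [d ->]; exists (fun i => c i + d i); rewrite lincombD. Qed.

Lemma span_sum S (I : Type) (r : seq I) (P : pred I) (F : I -> L) :
  (forall i, P i -> span S (F i)) -> span S (\sum_(i <- r | P i) F i).
Proof.
by move=> H; apply: (big_ind (span S)) => //; [exact: span0|exact: spanD].
Qed.

Lemma span_cat S T f g : span S f -> span T g -> span (S ++ T) (f + g).
Proof. by case=> c -> [d ->]; rewrite lincomb_catE; eexists. Qed.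

Lemma span_map S h f : span S f -> span (map ( *%R h) S) (h * f).
Proof.
case=> c ->; exists c; rewrite /lincomb size_map mulr_sumr; apply: eq_bigr => i _.
by rewrite (nth_map 0) // mulrCA.
Qed.

Lemma span_nth S (x : k) i : (i < size S)%N -> span S (lconst x * S`_i).
Proof.
move=> Hi; exists (fun j => if j == i then x else 0).
rewrite /lincomb (bigD1 (Ordinal Hi)) //= eqxx big1 ?addr0 // => j.
by rewrite -val_eqE /= => /negbTE->; rewrite rmorph0 mul0r.
Qed.

Lemma span_supp (E : seq lattice) f : lsupported (fun v => v \in E) f ->
  span (map (@lmono k L) E) f.
Proof.
move=> Ef; apply: (laurent_sum_ind (P := span _)); first exact: span0.
  exact: spanD.
move=> v /Ef vE; rewrite lgmonoE.
have -> : @lmono k L v = (map (@lmono k L) E)`_(index v E).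
  by rewrite (nth_map v) ?nth_index // index_mem.
by apply: span_nth; rewrite size_map index_mem.
Qed.

Definition jet_pairs m := [seq (i, j) | i <- iota 0 m, j <- iota 0 (m - i)].
Definition jets m : seq L := [seq X ^+ p.1 * Y ^+ p.2 | p <- jet_pairs m].

Lemma mem_jet_pairs m i j : ((i, j) \in jet_pairs m) = (i + j < m)%N.
Proof.
apply/allpairsPdep/idP => [[i' [j' [Hi Hj [-> ->]]]]|H].
  by move: Hi Hj; rewrite !mem_iota; lia.
by exists i, j; rewrite !mem_iota; split=> //; lia.
Qed.

Lemma uniq_jet_pairs m : uniq (jet_pairs m).
Proof.
apply: allpairs_uniq_dep; [exact: iota_uniq|by move=> *; exact: iota_uniq|].
by move=> [i j] [i' j'] _ _ /= [-> ->].
Qed.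

Lemma size_jets m : (2 * size (jets m) = m * m.+1)%N.
Proof.
rewrite size_map size_allpairs_dep.
have -> : [seq size (iota 0 (m - x)) | x <- iota 0 m] = [seq (m - x)%N | x <- iota 0 m].
  by apply: eq_map => x; rewrite size_iota.
rewrite sumnE big_map (big_iota0 m (fun i => (m - i)%N)).
elim: m => [|m IH]; first by rewrite big_ord0.
rewrite big_ord_recl subn0 mulnDr; under eq_bigr => i _ do rewrite /bump /= subSS.
by rewrite IH; lia.
Qed.

Lemma taylor_jets m c : taylor L m c =
  \sum_(p <- jet_pairs m) lconst (c p.1 p.2) * (X ^+ p.1 * Y ^+ p.2).
Proof.
rewrite big_allpairs_dep big_iota0; apply: eq_bigr => i _.
by rewrite big_iota0; apply: eq_bigr => j _; rewrite mulrA.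
Qed.

Lemma span_taylor m c : span (jets m) (taylor L m c).
Proof.
rewrite taylor_jets big_seq; apply: span_sum => p pm.
have -> : X ^+ p.1 * Y ^+ p.2 = (jets m)`_(index p (jet_pairs m)).
  by rewrite (nth_map p) ?nth_index // index_mem.
by apply: span_nth; rewrite size_map index_mem.
Qed.

Lemma span_jets m f : exists2 g, span (jets m) g & vanishes (f - g) m.
Proof. by have [c Vc] := has_taylorP m f; exists (taylor L m c) => //; exact: span_taylor. Qed.

Lemma lincomb_jets m z : vanishes (lincomb (jets m) z) m ->
  forall i, (i < size (jets m))%N -> z i = 0.
Proof.
pose c i j := z (index (i, j) (jet_pairs m)).
have -> : lincomb (jets m) z = taylor L m c.
  rewrite taylor_jets (big_nth (0, 0)%N) big_mkord /lincomb size_map.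
  apply: eq_bigr => i _; rewrite (nth_map (0, 0)%N) //; congr (lconst _ * _).
  by rewrite /c -surjective_pairing index_uniq ?uniq_jet_pairs.
move=> /taylor_eq0 H i; rewrite size_map => Hi.
have := mem_nth (0, 0)%N Hi; case E : (nth _ _ i) => [a b].
rewrite mem_jet_pairs => /H; rewrite /c -E index_uniq ?uniq_jet_pairs //.
Qed.

Lemma lincomb_row S (z : 'rV[k]_(size S)) (c : nat -> k) :
  (forall i : 'I_(size S), c i = z 0 i) -> lincomb S c = \sum_i lconst (z 0 i) * S`_i.
Proof. by move=> H; apply: eq_bigr => i _; rewrite H. Qed.

(* A list no longer than a basis of O/m^M which spans O/m^M is itself a basis. *)
Lemma jets_span_free S m (x : L) : (size S <= size (jets m))%N ->
  (forall f, vanishes (x * f) m -> vanishes f m) ->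
  (forall i, exists2 g, span S g & vanishes (x * (jets m)`_i - g) m) ->
  forall c, vanishes (lincomb S c) m -> forall i, (i < size S)%N -> c i = 0.
Proof.
move=> leST xV spanS c Vc.
set t := size (jets m) in leST *.
have H (i : 'I_t) : exists d, vanishes (x * (jets m)`_i - lincomb S d) m.
  by have [g [d ->] V] := spanS i; exists d.
pose D (i : 'I_t) := proj1_sig (constructive_indefinite_description _ (H i)).
have HD (i : 'I_t) : vanishes (x * (jets m)`_i - lincomb S (D i)) m.
  exact: (proj2_sig (constructive_indefinite_description _ (H i))).
pose A : 'M[k]_(t, size S) := \matrix_(i, j) D i j.
have HA (z : 'rV[k]_t) : vanishes (x * (\sum_i lconst (z 0 i) * (jets m)`_i) -
    \sum_j lconst ((z *m A) 0 j) * S`_j) m.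
  have -> : \sum_j lconst ((z *m A) 0 j) * S`_j =
      \sum_i lconst (z 0 i) * lincomb S (D i).
    under eq_bigr => j _ do rewrite mxE rmorph_sum mulr_suml.
    rewrite exchange_big; apply: eq_bigr => i _; rewrite /lincomb mulr_sumr.
    by apply: eq_bigr => j _; rewrite mxE rmorphM /= mulrA.
  rewrite mulr_sumr -sumrB; apply: vanishes_sum => i _.
  by rewrite mulrCA -mulrBr; exact: vanishesMl.
have zE (z : 'rV[k]_t) : vanishes (\sum_j lconst ((z *m A) 0 j) * S`_j) m -> z = 0.
  move=> V; have := vanishesD (HA z) V; rewrite subrK => /xV V'.
  apply/rowP => i; rewrite mxE.
  pose zn j := if insub j is Some l then z 0 (l : 'I_t) else 0.
  have zni (j : 'I_t) : zn j = z 0 j by rewrite /zn valK.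
  by rewrite -zni; apply: (@lincomb_jets m zn); rewrite ?(lincomb_row zni).
have freeA : row_free A.
  rewrite -kermx_eq0; apply/rowV0P => z /sub_kermxP zA.
  apply: zE; rewrite zA big1; first exact: vanishes0n.
  by move=> j _; rewrite mxE rmorph0 mul0r.
have fullA : row_full A.
  rewrite /row_full; move: freeA; rewrite /row_free => /eqP rA.
  by have := rank_leq_col A; rewrite rA eqn_leq => ->; rewrite leST.
move=> i Hi; pose r : 'rV[k]_(size S) := \row_j c j.
have [z Ez] : exists z, r = z *m A by apply/submxP/submx_full.
have : z = 0.
  apply: zE; rewrite -Ez; rewrite -(@lincomb_row S r c) // => j; by rewrite mxE.
move=> z0; have := congr1 (fun B : 'rV[k]_(size S) => B 0 (Ordinal Hi)) Ez.
by rewrite z0 mul0mx !mxE.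
Qed.

End LinearSpan.

#[global] Opaque jets.

(** * Powers of an ideal generated by two disjoint curves *)

Lemma corner_arith (a b c n : nat) (x x' y y' yF rF lF l d : int) : (0 < a)%N ->
  - y = - yF *+ n + d -> d <= - y' ->
  a%:Z * x + b%:Z * - (l + 1) + c%:Z * y = 0 ->
  a%:Z * x' + b%:Z * - (l + 1 - lF *+ n) + c%:Z * y' = 0 ->
  a%:Z * - rF + b%:Z * - lF + c%:Z * yF = 0 -> x + rF *+ n <= x'.
Proof.
have E (t : int) : t *+ n = t * n%:Z by rewrite -mulr_natr natz.
rewrite !E => a0 Ey Hd Ev Ew /(congr1 (fun t => t * n%:Z)).
rewrite mul0r => EF; have : 0 <= c%:Z * (y - y' - yF * n%:Z).
  by apply: mulr_ge0 => //; lia.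
have -> : c%:Z * (y - y' - yF * n%:Z) = a%:Z * (x' - x - rF * n%:Z) by lia.
by rewrite pmulr_rge0 //; lia.
Qed.

Section Key.
Variables (k : closedFieldType) (L : laurentRing k).
Implicit Types (f g h u w : L) (r l b : int).
Local Notation lcoef := (@lcoef k L).
Local Notation lmono := (@lmono k L).
Local Notation lconst := (@lconst k L).
Local Notation X := (lvar1 L - 1).
Local Notation Y := (lvar2 L - 1).

Variables (uR uL uB : lattice) (wa wb wc : nat).
Hypotheses (wa_gt0 : (0 < wa)%N) (wb_gt0 : (0 < wb)%N) (wc_gt0 : (0 < wc)%N).
Hypothesis wE : forall v, wa%:Z * pairing uR v + wb%:Z * pairing uL v +
  wc%:Z * pairing uB v = 0.

Definition cdeg r l b : int := wa%:Z * r + wb%:Z * l + wc%:Z * b.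

(* Sections of the divisor r D_R + l D_L + b D_B. *)
Definition inL r l b f := [/\ ge uR (- r) f, ge uL (- l) f & ge uB (- b) f].

Lemma inL0 r l b : inL r l b 0. Proof. by split; exact: ge0l. Qed.

Lemma inLD r l b f g : inL r l b f -> inL r l b g -> inL r l b (f + g).
Proof. by case=> ? ? ? [? ? ?]; split; exact: geD. Qed.

Lemma inLN r l b f : inL r l b f -> inL r l b (- f).
Proof. by case=> ? ? ?; split; exact: geN. Qed.

Lemma inLB r l b f g : inL r l b f -> inL r l b g -> inL r l b (f - g).
Proof. by move=> ? /inLN; exact: inLD. Qed.

Lemma inLM r l b r' l' b' f g : inL r l b f -> inL r' l' b' g ->
  inL (r + r') (l + l') (b + b') (f * g).
Proof.
by case=> ? ? ? [? ? ?]; split; rewrite opprD; exact: geM.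
Qed.

Lemma inLX r l b f i : inL r l b f -> inL (r *+ i) (l *+ i) (b *+ i) (f ^+ i).
Proof. by case=> ? ? ?; split; rewrite -mulNrn; exact: geX. Qed.

Lemma inLW r l b r' l' b' f : r <= r' -> l <= l' -> b <= b' ->
  inL r l b f -> inL r' l' b' f.
Proof.
by move=> Hr Hl Hb [R1 R2 R3]; split; [apply: geW R1|apply: geW R2|apply: geW R3];
  rewrite lerN2.
Qed.

Lemma inL_cdeg r l b f : cdeg r l b < 0 -> inL r l b f -> f = 0.
Proof.
move=> d0 [HR HL HB]; apply/eqP; apply: contraT => /lcoef_neq0[v fv].
have := HR _ fv; have := HL _ fv; have := HB _ fv; have := wE v.
move: d0; rewrite /cdeg; nia.
Qed.

Variables (F B1 : L) (cF : k) (vF : lattice) (rF lF bF : int) (F1 F2 : L).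
Variables (e z mu : nat).
Hypotheses (FE : F = lgmono L cF vF + F1 + F2) (cF0 : cF != 0).
Hypotheses (F_in : inL rF lF bF F) (vF_R : pairing uR vF = - rF)
  (vF_L : pairing uL vF = - lF) (vF_B : pairing uB vF = z%:Z - bF).
Hypothesis F1_lt : lsupported
  (fun v => (pairing uL v == - lF) && (pairing uB v < pairing uB vF)) F1.
Hypotheses (F1_in : inL rF lF bF F1) (F2_in : inL rF lF bF F2).
Hypothesis F2_gt : ge uL (- lF + 1) F2.
Hypothesis B1_in : inL e%:Z (-1) 0 B1.
Hypotheses (F_van : vanishes F mu) (B_van : vanishes (1 + B1) mu).
Local Notation B := (1 + B1).

Let B_in : inL e%:Z 0 0 B.
Proof.
apply: inLD; last by apply: inLW B1_in.
by split; apply: ge1; rewrite ?oppr0 // oppr_le0.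
Qed.

Definition in_corner r l b g := inL r l b g /\ lsupported
  (fun v => (pairing uR v + r < e%:Z) && (pairing uB v + b < z%:Z)) g.

Lemma in_cornerD r l b f g :
  in_corner r l b f -> in_corner r l b g -> in_corner r l b (f + g).
Proof. by case=> ? ? [? ?]; split; [exact: inLD|exact: lsupportedD]. Qed.

(* Division by F and B, whose leading monomials are a power of the third
   variable and a power of the first one. *)
Definition divides_to r l b f := exists u w g,
  [/\ inL (r - rF) (l - lF) (b - bF) u, inL (r - e%:Z) l b w,
      in_corner r l b g & f = F * u + B * w + g].

Lemma divides_toD r l b f g :
  divides_to r l b f -> divides_to r l b g -> divides_to r l b (f + g).
Proof.
case=> u [w [h [Hu Hw Hh ->]]] [u' [w' [h' [Hu' Hw' Hh' ->]]]].
exists (u + u'), (w + w'), (h + h'); split;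
  [exact: inLD|exact: inLD|exact: in_cornerD|ring].
Qed.

Lemma divides_to0 r l b : divides_to r l b 0.
Proof.
exists 0, 0, 0; split; [exact: inL0|exact: inL0| |ring].
by split; [exact: inL0|exact: lsupported0].
Qed.

Lemma divides_to_F r l b u : inL (r - rF) (l - lF) (b - bF) u ->
  divides_to r l b (F * u).
Proof.
move=> Hu; exists u, 0, 0; split=> //; [exact: inL0| |ring].
by split; [exact: inL0|exact: lsupported0].
Qed.

Lemma divides_to_B r l b u : inL (r - e%:Z) l b u -> divides_to r l b (B * u).
Proof.
move=> Hu; exists 0, u, 0; split=> //; [exact: inL0| |ring].
by split; [exact: inL0|exact: lsupported0].
Qed.

Lemma divides_toW r l b f : divides_to r (l - 1) b f -> divides_to r l b f.
Proof.
case=> u [w [g [Hu Hw [Hg Hg'] ->]]]; exists u, w, g; split=> //;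
  [apply: inLW Hu|apply: inLW Hw|split=> //; apply: inLW Hg]; lia.
Qed.

Lemma inL_divides_to r l b f : inL r l b f -> divides_to r l b f.
Proof.
have [d Hd] : exists d : nat, cdeg r l b < d%:Z.
  by exists (absz (cdeg r l b)).+1; lia.
elim: d r l b Hd f => [|d IH] r l b Hd f Hf.
  by rewrite (inL_cdeg Hd Hf); exact: divides_to0.
have {}IH g : inL r (l - 1) b g -> divides_to r l b g.
  by move=> Hg; apply/divides_toW/IH => //; move: Hd; rewrite /cdeg; nia.
have [HR HL HB] := Hf.
have -> : f = init uL (- l) f + (f - init uL (- l) f) by rewrite addrC subrK.
have HI : inL r l b (init uL (- l) f) by split; exact: ge_init.
apply: divides_toD; last first.
  have [? ? ?] := inLB Hf HI; apply: IH; split=> //.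
  by apply: geW (ge_sub_init HL); lia.
have: lsupported (fun v => pairing uL v == - l) (init uL (- l) f).
  exact: lsupported_init.
move: (init uL (- l) f) HI => {f Hf HR HL HB} f Hf Lf.
have [zz Hz] : exists zz : nat, lsupported (fun v => pairing uB v + b < zz%:Z) f.
  elim/laurent_ind: f {Hf Lf} => [|f g [i Hi] [j Hj]|c v].
  - by exists 0%N; exact: lsupported0.
  - exists (i + j)%N; apply: lsupportedD; [apply: lsupportedW Hi|apply: lsupportedW Hj];
      by move=> v; lia.
  - by exists (absz (pairing uB v + b)).+1; apply: lsupported_gmono; lia.
elim: zz f Hf Lf Hz => [|zz IHz] f Hf Lf Hz.
  suff -> : f = 0 by exact: divides_to0.
  apply/eqP; apply: contraT => /lcoef_neq0[v fv].
  by have [_ _ /(_ _ fv)] := Hf; have := Hz _ fv; lia.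
have -> : f = init uB (zz%:Z - b) f + (f - init uB (zz%:Z - b) f) by rewrite addrC subrK.
have HI : inL r l b (init uB (zz%:Z - b) f) by case: Hf => *; split; exact: ge_init.
apply: divides_toD; last first.
  apply: IHz; first exact: inLB.
    by move=> v; rewrite lcoef_sub_init; case: ifP; rewrite ?eqxx // => _ /Lf.
  by move=> v; rewrite lcoef_sub_init; case: ifP; rewrite ?eqxx // => vz /Hz; move: vz; lia.
have LI : lsupported (fun v => pairing uL v == - l) (init uB (zz%:Z - b) f).
  exact: lsupported_partW.
have: lsupported (fun v => pairing uB v == zz%:Z - b) (init uB (zz%:Z - b) f).
  exact: lsupported_init.
move: (init uB (zz%:Z - b) f) HI LI => {f Hf Lf Hz} P HP LP BP.
have [->|/lcoef_neq0[v0 Pv0]] := eqVneq P 0; first exact: divides_to0.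
have eqR v : lcoef P v != 0 -> pairing uR v = pairing uR v0.
  move=> Pv; have := LP _ Pv; have := LP _ Pv0; have := BP _ Pv; have := BP _ Pv0.
  have := wE v; have := wE v0; move: wa_gt0; nia.
have [le_e|lt_e] := lerP e%:Z (pairing uR v0 + r).
  have HP' : inL (r - e%:Z) l b P.
    by case: HP => ? ? ?; split=> // v /eqR ->; lia.
  have -> : P = B * P + - (B1 * P) by ring.
  apply: divides_toD; first exact: divides_to_B.
  by apply/IH/inLN; apply: inLW (inLM B1_in HP'); lia.
have [le_z|lt_z] := leqP z zz; last first.
  exists 0, 0, P; split; [exact: inL0|exact: inL0| |ring].
  split=> // v Pv; rewrite (eqR _ Pv) lt_e.
  by have := BP _ Pv; lia.
pose u := lgmono L cF^-1 (- vF) * P.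
have Hu : inL (r - rF) (l - lF) (b - bF) u.
  case: HP => HR HL _; split.
  - apply: (@geW _ _ _ (pairing uR (- vF) + - r)); first by rewrite pairingNr vF_R; lia.
    by apply: geM => //; exact: ge_gmono.
  - apply: (@geW _ _ _ (pairing uL (- vF) + - l)); first by rewrite pairingNr vF_L; lia.
    by apply: geM => //; exact: ge_gmono.
  - apply: (@geW _ _ _ (pairing uB (- vF) + (zz%:Z - b))).
      by rewrite pairingNr vF_B; lia.
    apply: geM => //; first exact: ge_gmono.
    by move=> v /BP/eqP->.
have -> : P = F * u + - (F1 * u) + - (F2 * u).
  have EP : lgmono L cF vF * u = P.
    by rewrite /u mulrA lgmonoM mulfV // subrr lgmono1 mul1r.
  by rewrite FE !mulrDl EP; ring.
apply: divides_toD; first apply: divides_toD; first exact: divides_to_F.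
- apply: IHz.
  + by apply: inLN; apply: inLW (inLM F1_in Hu); lia.
  + apply: lsupportedN; apply: (@lsupportedM _ _ (fun v => pairing uL v == - lF)
      (fun v => pairing uL v == - l + lF)).
    * by move=> v w /eqP Ev /eqP Ew; rewrite pairingDr Ev Ew; lia.
    * by move=> v /F1_lt /andP[].
    * apply: (@lsupportedM _ _ (fun v => v == - vF) (fun v => pairing uL v == - l)) => //.
        by move=> v w /eqP -> /eqP Ew; rewrite pairingDr pairingNr vF_L Ew; lia.
      by apply: lsupported_gmono.
  + apply: lsupportedN; apply: (@lsupportedM _ _
      (fun v => pairing uB v < pairing uB vF)
      (fun v => pairing uB v == zz%:Z - b - pairing uB vF)).
    * by move=> v w Hv /eqP Ew; rewrite pairingDr Ew; lia.
    * by move=> v /F1_lt /andP[].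
    * apply: (@lsupportedM _ _ (fun v => v == - vF) (fun v => pairing uB v == zz%:Z - b)) => //.
        by move=> v w /eqP -> /eqP Ew; rewrite pairingDr pairingNr Ew; lia.
      by apply: lsupported_gmono.
- apply/IH/inLN; have [? _ ?] := inLM F2_in Hu; split.
  + by apply: geW; last eassumption; lia.
  + have [_ Hl _] := Hu; apply: geW (geM F2_gt Hl); lia.
  + by apply: geW; last eassumption; lia.
Qed.

(* The degree (r, l, b) part of the ideal (F, B)^i. *)
Fixpoint idealpow i r l b f : Prop :=
  if i is j.+1 then exists g h,
    [/\ inL (r - rF *+ i) (l - lF *+ i) (b - bF *+ i) g,
        idealpow j (r - e%:Z) l b h & f = F ^+ i * g + B * h]
  else inL r l b f.

Lemma idealpow0 i r l b : idealpow i r l b 0.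
Proof.
elim: i r => [|i IH] r; first exact: inL0.
by exists 0, 0; split; [exact: inL0|exact: IH|ring].
Qed.

Lemma idealpowD i r l b f g :
  idealpow i r l b f -> idealpow i r l b g -> idealpow i r l b (f + g).
Proof.
elim: i r f g => [|i IH] r f g; first exact: inLD.
case=> u [w [Hu Hw ->]] [u' [w' [Hu' Hw' ->]]].
by exists (u + u'), (w + w'); split; [exact: inLD|exact: IH|ring].
Qed.

Lemma idealpow_F i r l b h : inL (r - rF *+ i) (l - lF *+ i) (b - bF *+ i) h ->
  idealpow i r l b (F ^+ i * h).
Proof.
case: i => [|i]; first by rewrite !mulr0n !subr0 expr0 mul1r.
by move=> Hh; exists h, 0; split=> //; [exact: idealpow0|ring].
Qed.

Lemma idealpow_inL i r l b f : idealpow i r l b f -> inL r l b f.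
Proof.
elim: i r f => [//|i IH] r f [g [h [Hg /IH Hh ->]]]; apply: inLD.
  by apply: inLW (inLM (inLX i.+1 F_in) Hg); lia.
by apply: inLW (inLM B_in Hh); lia.
Qed.

Hypothesis corner_count : forall r l b, exists E : seq lattice, (size E <= mu * mu)%N /\
  forall v, - r <= pairing uR v -> - l <= pairing uL v -> - b <= pairing uB v ->
    pairing uR v + r < e%:Z -> pairing uB v + b < z%:Z -> v \in E.

Lemma corner_span r l b : exists2 S : seq L, (size S <= mu * mu)%N &
  forall g, in_corner r l b g -> span S g.
Proof.
have [E [szE HE]] := corner_count r l b.
exists (map lmono E); first by rewrite size_map.
move=> g [[HR HL HB] Hg]; apply: span_supp => v gv.
by have /andP[? ?] := Hg _ gv; apply: HE => //; [exact: HR|exact: HL|exact: HB].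
Qed.

Lemma idealpow_step i r l b : exists2 S : seq L, (size S <= i.+1 * (mu * mu))%N &
  forall f, idealpow i r l b f -> exists f' g,
    [/\ idealpow i.+1 r l b f', span S g & f = f' + g].
Proof.
elim: i r => [|i IH] r.
  have [S szS HS] := corner_span r l b; exists S; first by rewrite mul1n.
  move=> f /inL_divides_to[u [w [g [Hu Hw Hg ->]]]].
  exists (F * u + B * w), g; split=> //; last exact: HS.
  by exists u, w; split; rewrite ?mulr1n ?expr1.
have [S szS HS] := IH (r - e%:Z).
have [T szT HT] := corner_span (r - rF *+ i.+1) (l - lF *+ i.+1) (b - bF *+ i.+1).
exists (map ( *%R (F ^+ i.+1)) T ++ map ( *%R B) S).
  by rewrite size_cat !size_map [X in (_ <= X)%N]mulSn leq_add.
move=> f [g [h [/inL_divides_to[u [w [c [Hu Hw /HT Sc ->]]]] /HS[h' [d [Hh' Sd ->]]] ->]]].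
exists (F ^+ i.+2 * u + B * (h' + F ^+ i.+1 * w)), (F ^+ i.+1 * c + B * d); split.
- exists u, (h' + F ^+ i.+1 * w); split=> //.
    by move: Hu; rewrite ![_ *+ i.+2]mulrSr !opprD !addrA.
  apply: idealpowD => //; apply: idealpow_F.
  by move: Hw; rewrite addrAC.
- by apply: span_cat; exact: span_map.
- by rewrite [F ^+ i.+2]exprSr; ring.
Qed.

Lemma idealpow_codim i r l b : exists2 S : seq L, (2 * size S <= mu * mu * (i * i.+1))%N &
  forall f, inL r l b f -> exists f' g,
    [/\ idealpow i r l b f', span S g & f = f' + g].
Proof.
elim: i => [|i [S szS HS]].
  exists [::]; first by [].
  by move=> f Hf; exists f, 0; split=> //; [exact: span0|rewrite addr0].
have [T szT HT] := idealpow_step i r l b.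
exists (T ++ S); first by rewrite size_cat mulnDr; nia.
move=> f /HS[f' [g [/HT[f'' [g' [Hf'' Sg' ->]]] Sg ->]]].
by exists f'', (g' + g); split=> //; [exact: span_cat|ring].
Qed.

(* The second variable is a nonzerodivisor modulo (F, B)^i. *)
Lemma idealpow_saturated i r l b f :
  idealpow i r (l + 1) b f -> inL r l b f -> idealpow i r l b f.
Proof.
elim: i r f => [//|i IH] r f [g [h [Hg Hh Ef]]] Hf.
set r' := r - rF *+ i.+1 in Hg *; set l' := l + 1 - lF *+ i.+1 in Hg *.
set b' := b - bF *+ i.+1 in Hg *.
have [HgR HgL HgB] := Hg.
pose p := init uL (- l') g.
have Hp0 : inL r' l' b' p by split; exact: ge_init.
have Hg' : inL r' (l' - 1) b' (g - p).
  have [? _ ?] := inLB Hg Hp0; split=> //.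
  by apply: geW (ge_sub_init HgL); lia.
have [HFR HFL HFB] := inLX i.+1 F_in.
have [HhR HhL HhB] := idealpow_inL Hh.
have iB : init uL 0 B = 1.
  have [_ HB1 _] := B1_in.
  rewrite initD (@init_gt _ _ _ _ 1 B1) // addr0.
  by rewrite -{1}(pairing0r uL) -(@lgmono1 k L) init_gmono.
have HBL : ge uL 0 B by have [_ + _] := B_in; rewrite oppr0.
have E0 : init uL (- (lF *+ i.+1)) (F ^+ i.+1) * p = - init uL (- (l + 1)) h.
  have : init uL (- (l + 1)) f = 0.
    by have [_ HfL _] := Hf; apply: (init_gt _ HfL); lia.
  have := init_mul HBL HhL; rewrite add0r iB mul1r => EB.
  have := init_mul HFL HgL; rewrite -/p.
  have -> : - (lF *+ i.+1) + - l' = - (l + 1) by rewrite /l'; lia.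
  by move=> EF; rewrite Ef initD EB EF => /eqP; rewrite addr_eq0 => /eqP.
have Hp : inL (r' - e%:Z) l' b' p.
  have [HpR HpL HpB] := Hp0; split=> // w pw; have p0 : p != 0.
    by apply/eqP => E; move: pw; rewrite E lcoef0 eqxx.
  have Lp : forall v, lcoef p v != 0 -> pairing uL v = - l'.
    by move=> v; rewrite lcoef_init; case: ifP => [/eqP|_]; rewrite ?eqxx.
  have [d [Hd Id]] := order_exists (- uB) p0.
  have iF : init uL (- lF) F = lgmono L cF vF + F1.
    rewrite FE !initD -vF_L init_gmono vF_L (init_gt _ F2_gt) ?addr0; last by lia.
    by congr (_ + _); apply: init_id => v /F1_lt/andP[].
  have gF : ge (- uB) (- pairing uB vF) (lgmono L cF vF + F1).
    apply: geD; first by apply: ge_gmono; rewrite pairingNl.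
    by move=> v /F1_lt/andP[_ Hv]; rewrite pairingNl; lia.
  have iiF : init (- uB) (- pairing uB vF) (lgmono L cF vF + F1) = lgmono L cF vF.
    rewrite initD -pairingNl init_gmono pairingNl.
    rewrite (@init_gt _ _ _ _ (- pairing uB vF + 1) F1) ?addr0 //; first by lia.
    by move=> v /F1_lt/andP[_ Hv]; rewrite pairingNl; lia.
  have [_ HF' _] := F_in.
  have : init (- uB) (- pairing uB vF *+ i.+1 + d)
      (init uL (- (lF *+ i.+1)) (F ^+ i.+1) * p) != 0.
    rewrite -mulNrn init_exp // iF init_mul //; last exact: geX.
    rewrite init_exp // iiF lmulf_neq0 // lexpf_neq0 //.
    by apply/eqP => /lcoef_eqP/(_ vF)/eqP; rewrite lcoef_gmono eqxx lcoef0 (negbTE cF0).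
  rewrite E0 => /init_supp[v [hv]]; rewrite pairingNl => EvB.
  have {hv} [hv EvL] : lcoef h v != 0 /\ pairing uL v = - (l + 1).
    by move: hv; rewrite lcoefN oppr_eq0 lcoef_init; case: ifP => [/eqP|_]; rewrite ?eqxx.
  have hR := HhR _ hv; have := Hd _ pw; rewrite pairingNl => Hw.
  have EwL := Lp _ pw; have wv := wE v; have ww := wE w; have wF := wE vF.
  rewrite EvL in wv; rewrite EwL in ww; rewrite vF_R vF_L in wF.
  have := @corner_arith wa wb wc i.+1 _ _ _ _ _ _ _ _ _ wa_gt0 EvB Hw wv ww wF.
  by rewrite /r'; lia.
have HFp : inL (r - e%:Z - rF *+ i) (l + 1 - lF *+ i) (b - bF *+ i) (F * p).
  apply: inLW (inLM F_in Hp); rewrite /r' /l' /b' ?mulrS; lia.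
pose T := h + F ^+ i.+1 * p.
have HT : idealpow i (r - e%:Z) (l + 1) b T.
  by apply: idealpowD => //; rewrite exprSr -mulrA; exact: idealpow_F.
have Hg2 : inL r' (l - lF *+ i.+1) b' (g - p - B1 * p).
  apply: inLB; first by apply: inLW Hg'; rewrite /l'; lia.
  by apply: inLW (inLM B1_in Hp); rewrite /l'; lia.
have Ef' : f = F ^+ i.+1 * (g - p - B1 * p) + B * T by rewrite Ef /T; ring.
exists (g - p - B1 * p), T; split=> //; apply: IH => //.
have [HTR _ HTB] := idealpow_inL HT; split=> //.
rewrite -[- l]subr0; apply: (@ge_div _ _ _ _ _ B).
- exact: HBL.
- by rewrite iB oner_neq0.
have -> : B * T = f - F ^+ i.+1 * (g - p - B1 * p) by rewrite Ef'; ring.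
have [_ HfL _] := Hf; apply: geB => //.
by have [_ ? _] := inLM (inLX i.+1 F_in) Hg2; apply: geW; last eassumption; lia.
Qed.

Fixpoint ideal_jets i : seq L :=
  if i is j.+1 then map ( *%R (F ^+ i)) (jets L mu) ++ map ( *%R B) (ideal_jets j)
  else jets L mu.

Lemma size_ideal_jets i : size (ideal_jets i) = (i.+1 * size (jets L mu))%N.
Proof.
elim: i => [|i IH] /=; first by rewrite mul1n.
by rewrite size_cat (size_map ( *%R (F ^+ i.+1))) (size_map ( *%R B)) IH [RHS]mulSn.
Qed.

Lemma span_ideal_jets i r l b f : idealpow i r l b f ->
  exists2 g, span (ideal_jets i) g & vanishes (f - g) (mu * i.+1).
Proof.
elim: i r f => [|i IH] r f; first by move=> _; rewrite muln1; exact: span_jets.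
case=> g [h [_ /IH[h' Sh' Vh'] ->]]; have [g' Sg' Vg'] := span_jets mu g.
exists (F ^+ i.+1 * g' + B * h'); first by apply: span_cat; exact: span_map.
have -> : F ^+ i.+1 * g + B * h - (F ^+ i.+1 * g' + B * h') =
  F ^+ i.+1 * (g - g') + B * (h - h') by ring.
apply: vanishesD; first by rewrite mulnSr; apply: vanishesM => //; exact: vanishesX.
by rewrite mulnS; exact: vanishesM.
Qed.

Lemma vanishes_idealpow_box i r l b f (v0 : lattice) :
  (forall a c, (a + c < mu * i.+1)%N -> inL r l b (lmono v0 * (X ^+ a * Y ^+ c))) ->
  inL r l b f -> vanishes f (mu * i.+1) -> idealpow i r l b f.
Proof.
move=> box Hf Vf; have [S szS HS] := idealpow_codim i r l b.
have [f' [_ [Hf' [c ->] Ef]]] := HS _ Hf.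
have [_ [d ->] Vd] := span_ideal_jets Hf'.
have szT : (size (ideal_jets i ++ S) <= size (jets L (mu * i.+1)))%N.
  rewrite -(leq_pmul2l (m := 2)) // size_cat size_ideal_jets size_jets mulnDr.
  by rewrite mulnCA size_jets; nia.
pose cd j := if (j < size (ideal_jets i))%N then d j else c (j - size (ideal_jets i))%N.
suff H : forall j, (j < size (ideal_jets i ++ S))%N -> cd j = 0.
  suff c0 : lincomb S c = 0 by rewrite Ef c0 addr0.
  rewrite /lincomb big1 // => j _.
  have Hj : (size (ideal_jets i) + j < size (ideal_jets i ++ S))%N.
    by rewrite size_cat ltn_add2l.
  have := H _ Hj; rewrite /cd ltnNge leq_addr /= addKn => ->.
  by rewrite rmorph0 mul0r.
apply: (@jets_span_free _ _ _ (mu * i.+1) (lmono v0)) => //.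
- by move=> h; rewrite vanishes_lmono.
- move=> j; have [lt_j|ge_j] := ltnP j (size (jets L (mu * i.+1))); last first.
    by exists 0; [exact: span0|rewrite nth_default // mulr0 subr0; exact: vanishes0n].
  have : (jets L (mu * i.+1))`_j \in jets L (mu * i.+1) by exact: mem_nth.
  case/mapP=> -[a a']; rewrite mem_jet_pairs => /box /HS[h [g [Hh Sg E]]] ->.
  have [h' Sh' Vh'] := span_ideal_jets Hh; exists (h' + g); first exact: span_cat.
  by rewrite /= in E *; rewrite E opprD addrACA subrr addr0.
rewrite -lincomb_catE.
have -> : lincomb (ideal_jets i) d + lincomb S c =
    f - (f' - lincomb (ideal_jets i) d) by rewrite Ef; ring.
exact: vanishesB.
Qed.

Hypothesis box_exists : forall r l b M, exists (j : nat) (v0 : lattice),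
  forall a c : nat, (a <= M)%N -> (c <= M)%N ->
  [/\ - r <= pairing uR (v0 + (a%:Z, c%:Z)), - (l + j%:Z) <= pairing uL (v0 + (a%:Z, c%:Z))
     & - b <= pairing uB (v0 + (a%:Z, c%:Z))].

Lemma supported_binomial a c :
  lsupported (fun v => [exists p : 'I_a.+1 * 'I_c.+1, v == (p.1%:Z, p.2%:Z)])
    (X ^+ a * Y ^+ c).
Proof.
have H (v : lattice) i :
    lsupported (fun t : lattice => [exists j : 'I_i.+1, t == v *+ j]) ((lmono v - 1) ^+ i).
  elim: i => [|i IH].
    rewrite expr0 -(@lgmono1 k L); apply: lsupported_gmono.
    by apply/existsP; exists ord0; rewrite mulr0n.
  rewrite exprS; apply: (@lsupportedM _ _ (fun t : lattice => (t == v) || (t == 0))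
    (fun t : lattice => [exists j : 'I_i.+1, t == v *+ j])) => //.
    move=> t t' /orP[]/eqP -> /existsP[j /eqP ->]; apply/existsP.
      by exists (lift ord0 j); rewrite /= /bump /= mulrS.
    by exists (widen_ord (leqnSn _) j); rewrite add0r.
  apply: lsupportedB; first by rewrite lmonoE; apply: lsupported_gmono; rewrite eqxx.
  by rewrite -(@lgmono1 k L); apply: lsupported_gmono; rewrite eqxx orbT.
rewrite lx_mono ly_mono.
apply: (@lsupportedM _ _ (fun t : lattice => [exists j : 'I_a.+1, t == (1, 0) *+ j])
  (fun t : lattice => [exists j : 'I_c.+1, t == (0, 1) *+ j])) => // v t.
move=> /existsP[i /eqP->] /existsP[j /eqP->]; apply/existsP; exists (i, j).
by rewrite !latticeMn /= !mul0rn -pair_eqE /= addr0 add0r !natz !eqxx.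
Qed.

Lemma vanishes_idealpow i r l b f :
  inL r l b f -> vanishes f (mu * i.+1) -> idealpow i r l b f.
Proof.
move=> Hf Vf; have [j [v0 box]] := box_exists r l b (mu * i.+1).
have : idealpow i r (l + j%:Z) b f.
  apply: (@vanishes_idealpow_box _ _ _ _ _ v0) => //; last first.
    by apply: inLW Hf; lia.
  move=> a c ac; have S := supported_binomial (a := a) (c := c).
  suff H v : lcoef (lmono v0 * (X ^+ a * Y ^+ c)) v != 0 -> [/\ - r <= pairing uR v,
      - (l + j%:Z) <= pairing uL v & - b <= pairing uB v].
    by split=> v /H[].
  rewrite lcoef_lmonoM => /S/existsP[[i1 i2] /= /eqP E].
  have -> : v = v0 + (i1%:Z, i2%:Z) by rewrite -E addrC subrK.
  by apply: box; have := ltn_ord i1; have := ltn_ord i2; lia.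
elim: j {box} => [|j IH] H; first by rewrite addr0 in H.
apply: IH; apply: idealpow_saturated; last by apply: inLW Hf; lia.
by rewrite -addrA -PoszD addn1.
Qed.

Local Notation dF := (cdeg rF lF bF).
Hypotheses (mu_gt0 : (0 < mu)%N) (dF_le : dF <= wa%:Z * e%:Z).

Lemma idealpow_cdeg i r l b f : idealpow i r l b f -> f != 0 ->
  i%:Z * dF <= cdeg r l b.
Proof.
have pos r' l' b' g : inL r' l' b' g -> g != 0 -> 0 <= cdeg r' l' b'.
  by move=> Hg; apply: contraNle => /inL_cdeg/(_ Hg) ->.
elim: i r f => [|i IH] r f; first by rewrite mul0r; exact: pos.
case=> g [h [Hg Hh ->]] nz; have [g0|/(pos _ _ _ _ Hg)] := eqVneq g 0; last first.
  have E (t : int) : t *+ i.+1 = i.+1%:Z * t by rewrite -mulr_natl natz.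
  by rewrite /cdeg !E; lia.
have h0 : h != 0.
  by apply/eqP => h0; case/eqP: nz; rewrite g0 h0 !mulr0 addr0.
by have := IH _ _ Hh h0; move: dF_le; rewrite /cdeg; lia.
Qed.

Lemma idealpow_dvd i r l b f : idealpow i r l b f ->
  cdeg r l b < i%:Z * (wa%:Z * e%:Z) -> exists h, f = F * h.
Proof.
elim: i r f => [|i IH] r f.
  by rewrite mul0r => Hf /inL_cdeg/(_ Hf) ->; exists 0; rewrite mulr0.
case=> g [h [Hg Hh ->]] lt_d.
have [|h' ->] := IH _ _ Hh; first by move: lt_d; rewrite /cdeg; lia.
by exists (F ^+ i * g + B * h'); rewrite exprS; ring.
Qed.

Lemma vanishes_cdeg r l b f j : inL r l b f -> f != 0 -> vanishes f j ->
  j%:Z * dF <= mu%:Z * cdeg r l b.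
Proof.
move=> Hf f0 Vf.
have d0 : 0 <= cdeg r l b by move: f0; apply: contraNle => /inL_cdeg/(_ Hf) ->.
case: j Vf => [|j] Vf; first by rewrite mul0r mulr_ge0.
have H t : (j.+1 * t.+1).-1%:Z * dF <= mu%:Z * t.+1%:Z * cdeg r l b.
  have := inLX (mu * t.+1) Hf.
  have := vanishesX (mu * t.+1) Vf; rewrite mulnCA => V /vanishes_idealpow I.
  have {}V : vanishes (f ^+ (mu * t.+1)) (mu * (j.+1 * t.+1).-1.+1).
    by move: V; rewrite prednK // muln_gt0.
  have := idealpow_cdeg (I _ V) (lexpf_neq0 _ f0).
  have E (x : int) : x *+ (mu * t.+1) = mu%:Z * t.+1%:Z * x.
    by rewrite -mulr_natl natz PoszM.
  by rewrite /cdeg !E; lia.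
rewrite leNgt; apply/negP => lt_d.
have [t Ht] : exists t : nat, dF < t%:Z by exists (absz dF).+1; lia.
have := H t; rewrite predn_int ?muln_gt0 // PoszM.
by have : 0 <= t.+1%:Z * (j.+1%:Z * dF - mu%:Z * cdeg r l b - 1);
  [apply: mulr_ge0 => //; lia | lia].
Qed.

Lemma vanishes_dvd r l b f j : inL r l b f -> vanishes f j ->
  mu%:Z * cdeg r l b < j%:Z * (wa%:Z * e%:Z) -> exists i h, f ^+ i = F * h.
Proof.
move=> Hf Vf lt_d.
have [t Ht] : exists t : nat, wa%:Z * e%:Z < t%:Z by exists (absz (wa%:Z * e%:Z)).+1; lia.
case: j Vf lt_d => [|j] Vf lt_d.
  have d0 : cdeg r l b < 0.
    by move: lt_d; rewrite mul0r pmulr_rlt0 //; lia.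
  by exists 1%N, 0; rewrite (inL_cdeg d0 Hf) expr1 mulr0.
exists (mu * t.+1)%N.
have := inLX (mu * t.+1) Hf.
have := vanishesX (mu * t.+1) Vf; rewrite mulnCA => V /vanishes_idealpow I.
have {}V : vanishes (f ^+ (mu * t.+1)) (mu * (j.+1 * t.+1).-1.+1).
  by move: V; rewrite prednK // muln_gt0.
apply: idealpow_dvd (I _ V) _; rewrite predn_int ?muln_gt0 // PoszM.
have E (x : int) : x *+ (mu * t.+1) = mu%:Z * t.+1%:Z * x.
  by rewrite -mulr_natl natz PoszM.
rewrite /cdeg !E in lt_d *.
have : 0 <= t.+1%:Z * (j.+1%:Z * (wa%:Z * e%:Z) - mu%:Z * (wa%:Z * r + wb%:Z * l + wc%:Z * b) - 1).
  by apply: mulr_ge0 => //; lia.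
by lia.
Qed.

End Key.

(** * Construction of the negative curve *)

Section WeightParameters.
Variable s : nat.

(* The parameters of the theorem for K = s + 4; pn stands for N + 1. *)
Definition pN := s.+2.
Definition pn := s.+3.
Definition pK := s.+4.
Definition pM := (s.+1 * s.+3)%N.
Definition pq := (s * s + 5 * s + 5)%N.
Definition pb := (pn * pq)%N.
Definition pm := (pn * pM)%N.
Definition pa := (pK * pN)%N.
Definition pc := (s ^ 5 + 12 * s ^ 4 + 55 * s ^ 3 + 119 * s ^ 2 + 119 * s + 43)%N.

Definition rayR : lattice := (- pb%:Z, (pN * pN)%N%:Z).
Definition rayL : lattice := (pa%:Z, - pq%:Z).
Definition rayB : lattice := (0, 1).

Lemma pbE : (pb.+1 = pK * pN * pN)%N.
Proof. rewrite /pb /pK /pN /pq /pn; lia. Qed.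

Lemma pqE : (pq = pN + pM)%N. Proof. rewrite /pq /pN /pM; lia. Qed.
Lemma pqnN : (pq.+1 = pn * pN)%N. Proof. rewrite /pq /pN /pn; lia. Qed.
Lemma pqnn : (pn * pn = pq + pn.+1)%N. Proof. rewrite /pq /pn; lia. Qed.
Lemma paq : (pa = pq + pn)%N. Proof. rewrite /pa /pq /pK /pN /pn; lia. Qed.
Lemma pmE : (pm.+1 = pN * pq)%N. Proof. rewrite /pm /pN /pq /pM /pn; lia. Qed.
Lemma pcE : (pa * (pN * pN) + pc = pb * pq)%N.
Proof. rewrite /pa /pc /pb /pK /pN /pq /pn !expnS expn0; nia. Qed.
Lemma pcE' : (pc + pa = pa * pM * pN + pn)%N.
Proof. rewrite /pa /pc /pM /pK /pN /pn !expnS expn0; nia. Qed.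
Lemma pamm : (pa * pm * pm = pb * pc + pn)%N.
Proof. rewrite /pa /pm /pb /pc /pM /pK /pN /pq /pn !expnS expn0; nia. Qed.

Lemma count_identity :
  ((pN * pq).+1 * (pN * pq) + pq * pn * (pN * pN) + (pN * pq * pn + pN) + 2 * (pn * pN) +
    pN * pN + pK * (pN * pN) =
  pm * pm.+1 + 2 + pK * (pN * pN * (pN * pN)) + 2 * pb + pq * pn * pN + pN * pq + pN * pn + pN)%N.
Proof. rewrite /pm /pb /pM /pq /pK /pN /pn; lia. Qed.

Lemma pbq : (pb = pn * pq)%N. Proof. by []. Qed.
Lemma pmM : (pm = pn * pM)%N. Proof. by []. Qed.
Lemma paK : (pa = pK * pN)%N. Proof. by []. Qed.
Lemma pMn : (pM = s.+1 * pn)%N. Proof. by []. Qed.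

Lemma ray_relation v :
  pa%:Z * pairing rayR v + pb%:Z * pairing rayL v + pc%:Z * pairing rayB v = 0.
Proof.
have E : pa%:Z * (pN * pN)%N%:Z + pc%:Z = pb%:Z * pq%:Z.
  by have := pcE => /(congr1 Posz); rewrite PoszD !PoszM.
rewrite /pairing /=.
have -> : pc%:Z = pb%:Z * pq%:Z - pa%:Z * (pN * pN)%N%:Z by rewrite -E; ring.
ring.
Qed.

End WeightParameters.

Arguments pN : simpl never.
Arguments pn : simpl never.
Arguments pK : simpl never.

#[global] Opaque pM pq pb pm pa pc.

Section Curves.
Variables (k : closedFieldType) (L : laurentRing k).
Variable s : nat.
Local Notation lcoef := (@lcoef k L).
Local Notation lmono := (@lmono k L).
Local Notation lconst := (@lconst k L).
Local Notation lgmono := (@lgmono k L).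
Local Notation x := (lvar1 L).
Local Notation y := (lvar2 L).
Local Notation N := (pN s).
Local Notation n := (pn s).
Local Notation K := (pK s).
Local Notation q := (pq s).
Implicit Types (f g h : L).

Lemma not_vanishes1 : ~ vanishes (1 : L) 1.
Proof.
have -> : (1 : L) = taylor L 1 (fun _ _ => 1).
  by rewrite /taylor !big_ord1 rmorph1 !expr0 !mulr1.
by move=> /taylor_eq0/(_ 0%N 0%N isT)/eqP; rewrite oner_eq0.
Qed.

Lemma not_vanishes_y : ~ vanishes (1 - y) 2.
Proof.
have -> : 1 - y = taylor L 2 (fun i j => if (i == 0)%N && (j == 1)%N then -1 else 0).
  rewrite /taylor !big_ord_recl !big_ord0 /= !rmorph0 rmorphN rmorph1 !expr0 expr1; ring.
by move=> /taylor_eq0/(_ 0%N 1%N isT)/eqP; rewrite oppr_eq0 oner_eq0.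
Qed.

Definition restr : L -> L := lsubst (fun v => lmono (v.1, 0)).

Lemma restr_zmod : zmod_morphism restr. Proof. exact: lsubst_is_zmod. Qed.

Lemma restr_monoid : monoid_morphism restr.
Proof.
apply: lsubst_is_monoid => [|v w]; first exact: lmono0.
by rewrite -lmonoD; congr lmono; congr pair; rewrite addr0.
Qed.

HB.instance Definition _ := GRing.isZmodMorphism.Build L L restr restr_zmod.
HB.instance Definition _ := GRing.isMonoidMorphism.Build L L restr restr_monoid.

Lemma restrB f g : restr (f - g) = restr f - restr g. Proof. exact: rmorphB. Qed.
Lemma restrM f g : restr (f * g) = restr f * restr g. Proof. exact: rmorphM. Qed.
Lemma restrXn f i : restr (f ^+ i) = restr f ^+ i. Proof. exact: rmorphXn. Qed.
Lemma restr1 : restr 1 = 1. Proof. exact: rmorph1. Qed.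

Lemma restr_x : restr x = x.
Proof. by rewrite lx_mono lmonoE /restr lsubst_gmono lgmono1 mul1r -lmonoE. Qed.

Lemma restr_y : restr y = 1.
Proof. by rewrite ly_mono lmonoE /restr lsubst_gmono lgmono1 mul1r lmono0. Qed.

Lemma restr_eq0 f : restr f = 0 -> exists g, f = (1 - y) * g.
Proof.
move=> f0; suff [g E] : exists g, f - restr f = (1 - y) * g.
  by exists g; rewrite -E f0 subr0.
elim/laurent_ind: f {f0} => [|f g [f' Ef] [g' Eg]|c [i j]].
- by exists 0; rewrite rmorph0 mulr0 subr0.
- by exists (f' + g'); rewrite rmorphD mulrDr -Ef -Eg /=; ring.
rewrite /= /restr lsubst_gmono lgmonoE -lconstE /=.
have [h E] := lmonoMz L (0, 1) j.
have -> : (i, j) = (i, 0) + (0, 1) *~ j.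
  by rewrite {1}lattice_basis; congr (_ + _); rewrite [RHS]lattice_basis mulr0z addr0.
exists (- (lconst c * lmono (i, 0) * h)); rewrite lmonoD E -ly_mono; ring.
Qed.

Lemma x1_neq0 : 1 - x != 0.
Proof.
apply/eqP => /lcoef_eqP/(_ 0)/eqP; rewrite -(@lgmono1 k L) lx_mono lmonoE.
by rewrite lcoefB !lcoef_gmono lcoef0 /= mulr1n mulr0n subr0 oner_eq0.
Qed.

Lemma y1_neq0 : 1 - y != 0.
Proof.
apply/eqP => /lcoef_eqP/(_ 0)/eqP; rewrite -(@lgmono1 k L) ly_mono lmonoE.
by rewrite lcoefB !lcoef_gmono lcoef0 /= mulr1n mulr0n subr0 oner_eq0.
Qed.

Lemma cancel_y1 i f g h : restr f != 0 -> (1 - y) ^+ i * g = f * h ->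
  exists h', h = (1 - y) ^+ i * h'.
Proof.
move=> f1; elim: i g h => [|i IH] g h E; first by exists h; rewrite expr0 mul1r.
have /restr_eq0[h1 Eh] : restr h = 0.
  have := congr1 restr E; rewrite !rmorphM rmorphXn rmorphB rmorph1 /= restr_y.
  rewrite subrr exprS !mul0r => /esym/laurent_integral[] // /eqP.
  by rewrite (negbTE f1).
have [h' Eh'] : exists h', h1 = (1 - y) ^+ i * h'.
  apply: (IH g); apply: (lmulfI y1_neq0).
  transitivity ((1 - y) ^+ i.+1 * g); first by rewrite exprS; ring.
  by rewrite E Eh; ring.
by exists h'; rewrite Eh Eh' exprS mulrA.
Qed.

Fixpoint bpoly i : L :=
  if i is j.+1 then x * (1 - y) * bpoly j + (1 - x * y) ^+ i else y.

Lemma bpolyE i :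
  (1 - x) * bpoly i = (1 - x * y) ^+ i.+1 - x ^+ i * (1 - y) ^+ i.+1.
Proof.
elim: i => [|i IH]; first by rewrite /= expr0 !expr1; ring.
transitivity (x * (1 - y) * ((1 - x) * bpoly i) + (1 - x) * (1 - x * y) ^+ i.+1).
  by rewrite /=; ring.
by rewrite IH ![_ ^+ i.+2]exprS [x ^+ i.+1]exprS; ring.
Qed.

Lemma vanishes_y1' : vanishes (1 - y) 1.
Proof. by have := vanishesN (vanishes_y1 L); rewrite opprB. Qed.

Lemma vanishes_xy1 : vanishes (1 - x * y) 1.
Proof.
have -> : 1 - x * y = - (y * (x - 1) + (y - 1)) by ring.
apply: vanishesN; apply: vanishesD; last exact: vanishes_y1.
exact/vanishesMl/vanishes_x1.
Qed.

Lemma vanishes_bpoly i : vanishes (bpoly i) i.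
Proof.
elim: i => [|i IH]; first exact: vanishes_ge0.
apply: vanishesD.
  rewrite -[i.+1]add1n -mulrA; apply/vanishesMl/vanishesM => //; exact: vanishes_y1'.
by have := vanishesX i.+1 vanishes_xy1; rewrite mul1n.
Qed.

Lemma restr_bpoly i : restr (bpoly i) = (1 - x) ^+ i.
Proof.
apply: (lmulfI x1_neq0); have := congr1 restr (bpolyE i).
rewrite !(rmorphM, rmorphB, rmorphXn, rmorph1) /=.
rewrite restr_x restr_y subrr [0 ^+ _]exprS mul0r mulr0 subr0 mulr1 => ->.
by rewrite exprS.
Qed.

Lemma not_vanishes_bpoly i : ~ vanishes (bpoly i) i.+1.
Proof.
case=> g /(congr1 restr); rewrite restr_bpoly rmorph_sum /=.
rewrite (bigD1 ord_max) //= big1 => [|j nj]; last first.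
  rewrite !rmorphM !rmorphXn !rmorphB rmorph1 /= restr_y subrr.
  have lt_j : (j < i.+1)%N.
    by rewrite ltn_neqAle -ltnS ltn_ord andbT; apply: contra nj => /eqP ej; apply/eqP/val_inj.
  by rewrite -(subnSK lt_j) exprS mul0r mulr0.
rewrite addr0 !rmorphM !rmorphXn !rmorphB rmorph1 /= restr_x subnn expr0 mulr1 => E.
apply: not_vanishes1.
have -> : 1 = (x - 1) * (restr (g ord_max) * (-1) ^+ i); last first.
  have := vanishesM (vanishes_x1 L) (vanishes_ge0 (restr (g ord_max) * (-1) ^+ i)).
  by rewrite addn0.
have nz : (1 - x) ^+ i != 0 by rewrite lexpf_neq0 // x1_neq0.
have Ei : (x - 1) ^+ i = (-1) ^+ i * (1 - x) ^+ i by rewrite -exprNn opprB.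
by apply: (lmulfI nz); rewrite mulr1 {1}E exprS Ei; ring.
Qed.

Definition sgn i : L := (-1) ^+ i.

(* The divisibility is seen on the curve bpoly n = 0, where
   x (1 - y) bpoly N = - (1 - x y)^n and (1 - x y)^(n+1) = x^n (1 - y)^(n+1). *)
Lemma gpoly_exists : exists g, bpoly n * g =
  bpoly N ^+ K - sgn K * (x ^+ q * (1 - y) ^+ (N * K)).
Proof.
set v := 1 - y; set u := 1 - x * y.
set T := bpoly N ^+ K - sgn K * (x ^+ q * v ^+ (N * K)).
have [P1 E1] : exists P, (bpoly n - u ^+ n) ^+ K = bpoly n * P + (- u ^+ n) ^+ K.
  exists (\sum_(i < K) (bpoly n - u ^+ n) ^+ (K.-1 - i) * (- u ^+ n) ^+ i).
  have := subrXX (bpoly n - u ^+ n) (- u ^+ n) K; rewrite opprK subrK => <-.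
  by rewrite subrK.
have [P2 E2] : exists P, (u ^+ n.+1) ^+ n = (x ^+ n * v ^+ n.+1) ^+ n + bpoly n * P.
  have E := bpolyE n; rewrite -/u -/v in E.
  have := subrXX (u ^+ n.+1) (x ^+ n * v ^+ n.+1) n; rewrite -E.
  move: (\sum_(i < n) _) => S /eqP; rewrite subr_eq addrC => /eqP ->.
  by exists ((1 - x) * S); congr (_ + _); ring.
have Eb : x * v * bpoly N = bpoly n - u ^+ n.
  by rewrite [bpoly n]/= -/v -/u addrK.
have ET : v ^+ K * (x ^+ K * T) = bpoly n * (P1 + sgn K * P2).
  rewrite /T mulrBr mulrBr.
  have -> : v ^+ K * (x ^+ K * bpoly N ^+ K) = (x * v * bpoly N) ^+ K.
    by rewrite !exprMn; ring.
  rewrite Eb E1 exprNn -exprM mulnC exprM E2 -/v.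
  have -> : (x ^+ n * v ^+ n.+1) ^+ n = x ^+ K * x ^+ q * (v ^+ K * v ^+ (N * K)).
    rewrite exprMn -!exprM -!exprD; congr (_ ^+ _ * _ ^+ _); first by rewrite pqnn addnC.
    by rewrite -mulSn mulnC.
  by rewrite /sgn; ring.
have [|H EH] := cancel_y1 _ ET; first by rewrite restr_bpoly lexpf_neq0 ?x1_neq0.
have nz : v ^+ K != 0 by rewrite lexpf_neq0 ?y1_neq0.
exists (lmono ((- 1, 0) *+ K) * H).
have xK : lmono ((-1, 0) *+ K) * x ^+ K = 1.
  by rewrite lx_mono !lmonoX -lmonoD -mulrnDl -[X in X *+ _]/(0 : lattice) mul0rn lmono0.
have E : x ^+ K * T = bpoly n * H.
  by apply: (lmulfI nz); rewrite ET EH; ring.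
by rewrite mulrCA -E mulrA xK mul1r.
Qed.

Lemma x_neq0 : x != 0. Proof. by rewrite lx_mono lmono_neq0. Qed.
Lemma y_neq0 : y != 0. Proof. by rewrite ly_mono lmono_neq0. Qed.

Lemma ge_x u c : c <= pairing u (1, 0) -> ge u c x.
Proof. by move=> H; rewrite lx_mono lmonoE; exact: ge_gmono. Qed.
Lemma ge_y u c : c <= pairing u (0, 1) -> ge u c y.
Proof. by move=> H; rewrite ly_mono lmonoE; exact: ge_gmono. Qed.

Lemma init_1 u : init u 0 (1 : L) = 1.
Proof. by rewrite -{1}(pairing0r u) -(@lgmono1 k L) init_gmono. Qed.

Local Notation w := (1 - x).

Lemma xy_mono : x * y = lmono (1, 1).
Proof. by rewrite lx_mono ly_mono -lmonoD. Qed.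

Lemma ge_lmono u v c : c <= pairing u v -> ge u c (lmono v).
Proof. by rewrite lmonoE; exact: ge_gmono. Qed.

Lemma init_lmono_eq u v c : pairing u v = c -> init u c (lmono v) = lmono v.
Proof. by move=> <-; rewrite init_lmono. Qed.

End Curves.

Arguments bpoly : simpl never.

Section LeadingForms.
Variables (k : closedFieldType) (L : laurentRing k).
Implicit Types (f g h t : L) (u v : lattice) (c d : int).
Local Notation lmono := (@lmono k L).

Definition lead u c f t := ge u c f /\ init u c f = t.

Lemma lead_eq u c d f t t' : lead u c f t -> c = d -> t = t' -> lead u d f t'.
Proof. by move=> + <- <-. Qed.

Lemma leadM u c d f g t t' :
  lead u c f t -> lead u d g t' -> lead u (c + d) (f * g) (t * t').
Proof. by case=> Hf <- [Hg <-]; split; [exact: geM|exact: init_mul]. Qed.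

Lemma leadX u c f t i : lead u c f t -> lead u (c *+ i) (f ^+ i) (t ^+ i).
Proof. by case=> Hf <-; split; [exact: geX|exact: init_exp]. Qed.

Lemma leadD u c f g t t' : lead u c f t -> lead u c g t' -> lead u c (f + g) (t + t').
Proof. by case=> Hf <- [Hg <-]; split; [exact: geD|exact: initD]. Qed.

Lemma leadN u c f t : lead u c f t -> lead u c (- f) (- t).
Proof. by case=> Hf <-; split; [exact: geN|exact: initN]. Qed.

Lemma leadB u c f g t t' : lead u c f t -> lead u c g t' -> lead u c (f - g) (t - t').
Proof. by move=> ? ?; apply/leadD/leadN. Qed.

Lemma lead_gt u c d f t : lead u d f t -> c < d -> lead u c f 0.
Proof.
by case=> Hf _ cd; split; [apply: geW Hf; exact: ltW|exact: (init_gt cd Hf)].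
Qed.

Lemma lead_lmono u v c : pairing u v = c -> lead u c (lmono v) (lmono v).
Proof. by move=> E; split; [apply: ge_lmono; rewrite E|exact: init_lmono_eq]. Qed.

Lemma lead1 u : lead u 0 (1 : L) 1.
Proof. by split; [exact: ge1|exact: init_1]. Qed.

Lemma lead_div u c d f g t t' : lead u c f t -> t != 0 ->
  lead u (c + d) (f * g) (t * t') -> lead u d g t'.
Proof.
case=> Hf <- nz [Hfg Efg].
have Hg : ge u d g by rewrite -[d](addKr c) addrC; exact: (ge_div Hf nz Hfg).
by split=> //; apply: (lmulfI nz); rewrite -Efg init_mul.
Qed.

Lemma lead_sgn u i : lead u 0 ((-1) ^+ i : L) ((-1) ^+ i).
Proof. by have := leadX i (leadN (lead1 u)); rewrite mul0rn. Qed.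

Lemma lead_supp u c f t v : lead u c f t -> lcoef t v != 0 ->
  lcoef f v = lcoef t v /\ pairing u v = c.
Proof.
by case=> _ <-; rewrite lcoef_init; case: ifP => [/eqP E _|_]; rewrite ?eqxx.
Qed.

End LeadingForms.

#[global] Opaque lead.

Section CurvesLead.
Variables (k : closedFieldType) (L : laurentRing k).
Variable s : nat.
Local Notation lmono := (@lmono k L).
Local Notation x := (lvar1 L).
Local Notation y := (lvar2 L).
Local Notation N := (pN s).
Local Notation n := (pn s).
Local Notation K := (pK s).
Local Notation q := (pq s).
Local Notation b := (pb s).
Local Notation m := (pm s).
Local Notation a := (pa s).
Local Notation uR := (rayR s).
Local Notation uL := (rayL s).
Local Notation uB := rayB.
Local Notation bpoly := (@bpoly k L).
Local Notation w := (1 - x).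
Local Notation v1 := (1 - y).
Local Notation u1 := (1 - x * y).
Implicit Types (f g h t : L).

Lemma mulrn_int (t : int) i : t *+ i = i%:Z * t.
Proof. by rewrite -mulr_natl natz. Qed.

Lemma lead_x u c : pairing u (1, 0) = c -> lead u c x x.
Proof. by rewrite lx_mono; exact: lead_lmono. Qed.
Lemma lead_y u c : pairing u (0, 1) = c -> lead u c y y.
Proof. by rewrite ly_mono; exact: lead_lmono. Qed.
Lemma lead_xy u c : pairing u (1, 1) = c -> lead u c (x * y) (x * y).
Proof. by rewrite xy_mono; exact: lead_lmono. Qed.

Lemma leadL_w : lead uL 0 w 1.
Proof.
rewrite -[X in lead _ _ _ X]subr0; apply: leadB (lead1 _ _) _.
by apply: lead_gt (lead_x erefl) _; rewrite /pairing /= paq /pn; lia.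
Qed.

Lemma leadL_u : lead uL 0 u1 1.
Proof.
rewrite -[X in lead _ _ _ X]subr0; apply: leadB (lead1 _ _) _.
by apply: lead_gt (lead_xy erefl) _; rewrite /pairing /= paq /pn; lia.
Qed.

Lemma leadL_v : lead uL (- q%:Z) v1 (- y).
Proof.
rewrite -[X in lead _ _ _ X]add0r; apply: leadB.
  by apply: lead_gt (lead1 _ _) _; have := pqnN s; rewrite /pn /pN; lia.
by apply: lead_y; rewrite /pairing /=; lia.
Qed.

Lemma leadL_bpoly i : (q * i.+1 < a * i)%N -> lead uL 0 (bpoly i) 1.
Proof.
move=> lt; apply: (lead_div leadL_w (oner_neq0 _)); rewrite bpolyE mul1r add0r.
rewrite -[X in lead _ _ _ X]subr0; apply: leadB.
  by apply: lead_eq (leadX i.+1 leadL_u) _ _; rewrite ?mul0rn ?expr1n.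
apply: lead_gt (leadM (leadX i (lead_x erefl)) (leadX i.+1 leadL_v)) _.
by rewrite /pairing /= !mulrn_int; lia.
Qed.

Lemma leadL_bN : lead uL 0 (bpoly N) 1.
Proof. apply: leadL_bpoly; have := paq s; have := pqnN s; rewrite /pn /pN; nia. Qed.

Lemma leadL_bn : lead uL 0 (bpoly n) 1.
Proof. apply: leadL_bpoly; have := paq s; have := pqnN s; rewrite /pn /pN; nia. Qed.

Lemma bN2 : (b.+1 = K * (N * N))%N. Proof. by rewrite pbE mulnA. Qed.

Lemma leadR_w : lead uR (- b%:Z) w (- x).
Proof.
rewrite -[X in lead _ _ _ X]add0r; apply: leadB.
  by apply: lead_gt (lead1 _ _) _; have := bN2; rewrite /pK /pN; lia.
by apply: lead_x; rewrite /pairing /=; lia.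
Qed.

Lemma leadR_u : lead uR ((N * N)%N%:Z - b%:Z) u1 (- (x * y)).
Proof.
rewrite -[X in lead _ _ _ X]add0r; apply: leadB.
  by apply: lead_gt (lead1 _ _) _; have := bN2; rewrite /pK /pN; nia.
by apply: lead_xy; rewrite /pairing /=; lia.
Qed.

Lemma leadR_v : lead uR 0 v1 1.
Proof.
rewrite -[X in lead _ _ _ X]subr0; apply: leadB (lead1 _ _) _.
by apply: lead_gt (lead_y erefl) _; rewrite /pairing /= /pN; lia.
Qed.

Lemma leadR_bN : lead uR (- (m * N)%N%:Z) (bpoly N) ((-1) ^+ N * (x ^+ N * y ^+ n)).
Proof.
have Eb := bN2; have EM := pqE s; have Em := pmM s; have Eb' := pbq s; have EMn := pMn s.
have nzx : - x != 0 :> L by rewrite oppr_eq0 x_neq0.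
apply: (lead_div leadR_w nzx); rewrite bpolyE.
rewrite -[X in lead _ _ _ X]subr0; apply: leadB.
  apply: lead_eq (leadX n leadR_u) _ _.
    by rewrite mulrn_int Em Eb' EM EMn /pN /pn; lia.
  by rewrite [(- (x * y)) ^+ n]exprNn [(x * y) ^+ n]exprMn [(-1) ^+ n]exprS
    [x ^+ n]exprS; ring.
apply: lead_gt (leadM (leadX N (lead_x erefl)) (leadX n leadR_v)) _.
by rewrite /pairing /= !mulrn_int Em Eb' EM EMn /pN /pn; lia.
Qed.

Lemma leadR_bn : lead uR (- (b * N)%N%:Z) (bpoly n) (x ^+ N).
Proof.
have Eb := bN2.
have nzx : - x != 0 :> L by rewrite oppr_eq0 x_neq0.
apply: (lead_div leadR_w nzx); rewrite bpolyE.
rewrite -[X in lead _ _ _ X]add0r mulNr; apply: leadB.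
  apply: lead_gt (leadX n.+1 leadR_u) _.
  by rewrite mulrn_int; move: Eb; rewrite /pN /pn /pK; nia.
apply: lead_eq (leadM (leadX n (lead_x erefl)) (leadX n.+1 leadR_v)) _ _.
  by rewrite /pairing /= !mulrn_int; rewrite /pN /pn; lia.
by rewrite expr1n mulr1 exprS.
Qed.

Lemma geB_bpoly i : ge uB 0 (bpoly i).
Proof.
elim: i => [|i IH]; rewrite /bpoly -?/bpoly; first by apply: ge_y.
have G1 : ge uB 0 (1 : L) by exact: ge1.
have Gy : ge uB 0 y by exact: ge_y.
have Gx : ge uB 0 x by exact: ge_x.
have GM (f g : L) : ge uB 0 f -> ge uB 0 g -> ge uB 0 (f * g).
  by move=> Hf Hg; rewrite -[0]addr0; exact: geM.
apply: geD; first exact: (GM _ _ (GM _ _ Gx (geB G1 Gy)) IH).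
by have := geX (i := i.+1) (geB G1 (GM _ _ Gx Gy)); rewrite mul0rn.
Qed.

End CurvesLead.

Section NegativeCurve.
Variables (k : closedFieldType) (L : laurentRing k).
Variable s : nat.
Local Notation lmono := (@lmono k L).
Local Notation lgmono := (@lgmono k L).
Local Notation lcoef := (@lcoef k L).
Local Notation x := (lvar1 L).
Local Notation y := (lvar2 L).
Local Notation N := (pN s).
Local Notation n := (pn s).
Local Notation K := (pK s).
Local Notation M := (pM s).
Local Notation q := (pq s).
Local Notation b := (pb s).
Local Notation m := (pm s).
Local Notation uR := (rayR s).
Local Notation uL := (rayL s).
Local Notation uB := rayB.
Local Notation bpoly := (@bpoly k L).
Implicit Types (f g h t : L).

Lemma sgn_mono i (j l : nat) :
  (-1) ^+ i * (x ^+ j * y ^+ l) = lgmono ((-1) ^+ i) (j%:Z, l%:Z).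
Proof. by rewrite lgmonoE lmono_nat rmorphXn rmorphN rmorph1. Qed.

Lemma lgmonoX (c : k) v i : lgmono c v ^+ i = lgmono (c ^+ i) (v *+ i).
Proof.
elim: i => [|i IH]; first by rewrite !expr0 mulr0n lgmono1.
by rewrite !exprS IH lgmonoM mulrS.
Qed.

Lemma sign_KN : (-1) ^+ K * (-1) ^+ (N * K) = 1 :> L.
Proof.
rewrite -exprD -signr_odd /pK /pN oddD oddM /= !negbK.
by case: (odd s); rewrite expr0.
Qed.

Lemma restr_rel i j l c f g h :
  f * g = h ^+ i - c * (x ^+ j * (1 - y) ^+ l.+1) -> restr f * restr g = restr h ^+ i.
Proof.
move/(congr1 (@restr k L)); rewrite restrM restrB !restrM [restr (h ^+ _)]restrXn.
by rewrite [restr ((1 - y) ^+ _)]restrXn restrB restr1 restr_y subrr exprS mul0r !mulr0 subr0.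
Qed.

Lemma lattice_eq (v w : lattice) : v.1 = w.1 -> v.2 = w.2 -> v = w.
Proof. by case: v w => ? ? [? ?] /= -> ->. Qed.

Definition gpoly_spec g := [/\ lead uL 0 g (1 - x ^+ q * y ^+ (N * K)),
  lead uR (- (b * M)%N%:Z) g (- ((-1) ^+ K * x ^+ M)), ge uB 0 g,
  vanishes g q & restr g = (1 - x) ^+ q].

Lemma gpoly_specP : exists g, gpoly_spec g.
Proof.
have [g Eg] := gpoly_exists L s; exists g; rewrite /sgn in Eg.
have EM := pqE s; have Eb' := pbq s; have EMn := pMn s; have Em := pmM s.
have Ea := paK s; have EN := bN2 s; have Eqn := pqnN s.
split.
- apply: (lead_div (leadL_bn L s) (oner_neq0 _)); rewrite Eg mul1r.
  apply: leadB.
    by apply: lead_eq (leadX K (leadL_bN L s)) _ _; rewrite ?mul0rn ?expr1n.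
  apply: lead_eq (leadM (lead_sgn L uL K) (leadM (leadX q (lead_x L erefl))
    (leadX (N * K) (leadL_v L s)))) _ _.
    by rewrite /pairing /= !mulrn_int Ea; lia.
  rewrite [(- y) ^+ _]exprNn; transitivity
    ((-1) ^+ K * (-1) ^+ (N * K) * (x ^+ q * y ^+ (N * K))); first by ring.
  by rewrite sign_KN mul1r.
- have nz : x ^+ N != 0 by rewrite lexpf_neq0 // x_neq0.
  apply: (lead_div (leadR_bn L s) nz); rewrite Eg.
  rewrite -[X in lead _ _ _ X]add0r mulrN; apply: leadB.
    apply: lead_gt (leadX K (leadR_bN L s)) _.
    by rewrite mulrn_int Em Eb' EM EMn /pn /pN /pK; lia.
  apply: lead_eq (leadM (lead_sgn L uR K) (leadM (leadX q (lead_x L erefl))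
    (leadX (N * K) (leadR_v L s)))) _ _.
    by rewrite /pairing /= !mulrn_int EM; lia.
  by rewrite expr1n mulr1 EM exprD; ring.
- have I : init uB 0 (bpoly n) != 0.
    have xN : x ^+ N = lgmono 1 (N%:Z, 0) by rewrite -lmonoE lmono_nat expr0 mulr1.
    have RB := leadR_bn L s; rewrite xN in RB.
    have c1 : lcoef (lgmono 1 (N%:Z, 0)) (N%:Z, 0) = 1 by rewrite lcoef_gmono eqxx.
    have [|E1 _] := lead_supp (v := (N%:Z, 0)) RB; first by rewrite c1 oner_eq0.
    by apply: (@supp_init _ _ _ _ _ (N%:Z, 0)); rewrite ?E1 ?c1 ?oner_eq0 // /pairing /=; lia.
  suff: ge uB (0 - 0) g by rewrite subr0.
  apply: (ge_div (@geB_bpoly _ L n) I); rewrite Eg.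
  have G0 (f h : L) : ge uB 0 f -> ge uB 0 h -> ge uB 0 (f * h).
    by move=> Hf Hh; rewrite -[0]addr0; exact: geM.
  have GX (f : L) i : ge uB 0 f -> ge uB 0 (f ^+ i).
    by move=> Hf; have := geX (i := i) Hf; rewrite mul0rn.
  have G1 : ge uB 0 (1 : L) by exact: ge1.
  apply: geB; first exact: (GX _ _ (@geB_bpoly _ L N)).
  apply: (G0); first by apply: (GX); exact: geN.
  apply: (G0); first by apply: (GX); exact: ge_x.
  by apply: (GX); apply: geB => //; exact: ge_y.
- have := @vanishes_div _ _ (bpoly n) g (N * K) n; rewrite Eg.
  have -> : (N * K - n = q)%N by move: Eqn; rewrite /pN /pK /pn; lia.
  apply; last exact: not_vanishes_bpoly.
  apply: vanishesB; first exact: vanishesX (vanishes_bpoly L N).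
  do 2 apply: vanishesMl; have := vanishesX (N * K) (vanishes_y1' L).
  by rewrite mul1n.
have nz : (1 - x) ^+ n != 0 by rewrite lexpf_neq0 // x1_neq0.
have ENK : (N * K = (N * K).-1.+1)%N by rewrite prednK // muln_gt0.
rewrite ENK in Eg; have := restr_rel Eg.
rewrite !restr_bpoly -exprM => ER.
apply: (lmulfI nz); rewrite ER -exprD; congr (_ ^+ _).
by move: Eqn; rewrite /pN /pK /pn; lia.
Qed.

Definition vtop : lattice := (m%:Z, b%:Z).
Definition vright : lattice := ((M * N)%N%:Z - 1, 0).

Definition xi_spec xi := [/\ exists2 t, lead uL (- n%:Z) xi t &
    exists2 c : k, c != 0 & lead (- uB) (- b%:Z) t (lgmono c vtop),
  exists c d : k, [/\ c != 0, d != 0 &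
    lead uR (b%:Z - (b * M * N)%N%:Z) xi (lgmono c vright + lgmono d vtop)],
  ge uB 0 xi & vanishes xi m].

Lemma xi_specP : exists xi, xi_spec xi.
Proof.
have [g [gL gR gB gV g1]] := gpoly_specP.
have EM := pqE s; have Eb' := pbq s; have EMn := pMn s; have Em := pmM s.
have Ea := paK s; have EN := bN2 s; have Eqn := pqnN s; have Eaq := paq s.
have Em1 := pmE s.
have [xi0 E0] : exists xi0, g ^+ N - bpoly N ^+ q = (1 - y) * xi0.
  apply: restr_eq0; rewrite restrB !restrXn g1 restr_bpoly -!exprM.
  by rewrite mulnC subrr.
pose t1 := x ^+ q * y ^+ (N * K).
have L0 : lead uL q%:Z xi0 (- lmono (0, -1) * ((1 - t1) ^+ N - 1)).
  have nz : - y != 0 :> L by rewrite oppr_eq0 y_neq0.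
  apply: (lead_div (leadL_v L s) nz); rewrite -E0 addNr.
  have yK : y * lmono (0, -1) = 1 by rewrite ly_mono -lmonoD -(lmono0 L).
  have -> : - y * (- lmono (0, -1) * ((1 - t1) ^+ N - 1)) = (1 - t1) ^+ N - 1.
    by rewrite mulrA mulrNN yK mul1r.
  apply: leadB; first by apply: lead_eq (leadX N gL) _ _; rewrite ?mul0rn.
  by apply: lead_eq (leadX q (leadL_bN L s)) _ _; rewrite ?mul0rn ?expr1n.
have R0 : lead uR (- (b * M * N)%N%:Z) xi0
    ((- ((-1) ^+ K * x ^+ M)) ^+ N - ((-1) ^+ N * (x ^+ N * y ^+ n)) ^+ q).
  apply: (lead_div (leadR_v L s) (oner_neq0 _)); rewrite -E0 mul1r add0r.
  apply: leadB.
    by apply: lead_eq (leadX N gR) _ _ => //; rewrite mulrn_int; lia.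
  by apply: lead_eq (leadX q (leadR_bN L s)) _ _ => //; rewrite mulrn_int Em Eb'; lia.
have B0 : ge uB 0 xi0.
  suff: ge uB (0 - 0) xi0 by rewrite subr0.
  apply: (@ge_div _ _ _ _ _ (1 - y)).
  - by apply: geB; [exact: ge1|exact: ge_y].
  - rewrite initB init_1 (@init_gt _ _ _ _ 1 y) ?subr0 ?oner_neq0 //.
    exact: ge_y.
  rewrite -E0; apply: geB; first by have := geX (i := N) gB; rewrite mul0rn.
  by have := geX (i := q) (@geB_bpoly _ L N); rewrite mul0rn.
have V0 : vanishes xi0 m.
  have := @vanishes_div _ _ (1 - y) xi0 m.+1 1; rewrite -E0 subn1; apply.
    rewrite Em1; apply: vanishesB; first by rewrite mulnC; exact: vanishesX.
    exact: vanishesX (vanishes_bpoly L N).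
  exact: not_vanishes_y.
exists (lmono (-1, 0) * xi0); split.
- exists (lmono (-1, 0) * (- lmono (0, -1) * ((1 - t1) ^+ N - 1))).
    apply: lead_eq (leadM (lead_lmono L erefl) L0) _ _ => //.
    by rewrite /pairing /= Eaq; lia.
  exists (- (-1) ^+ N).
    by rewrite oppr_eq0 signr_eq0.
  have T1 : lead (- uB) (- (N * K)%N%:Z) (1 - t1) (- t1).
    rewrite -[X in lead _ _ _ X]add0r; apply: leadB.
      by apply: lead_gt (lead1 _ _) _; rewrite /pN /pK; lia.
    by rewrite /t1 -lmono_nat; apply: lead_lmono; rewrite /pairing /=; lia.
  have T2 : lead (- uB) (- (b%:Z + 1)) ((1 - t1) ^+ N - 1) ((- t1) ^+ N).
    rewrite -[X in lead _ _ _ X]subr0; apply: leadB.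
      by apply: lead_eq (leadX N T1) _ _ => //; rewrite mulrn_int; move: EN; lia.
    by apply: lead_gt (lead1 _ _) _; lia.
  apply: lead_eq (leadM (lead_lmono L erefl) (leadM (leadN (lead_lmono L erefl)) T2)) _ _.
    by rewrite /pairing /=; lia.
  rewrite [(- t1) ^+ N]exprNn /t1 exprMn -!exprM sgn_mono !lmonoE mulNr mulrN.
  rewrite !lgmonoM !mul1r; apply/lcoef_eqP => v; rewrite lcoefN !lcoef_gmono mulNrn.
  congr (- (_ *+ (_ == _))); apply: lattice_eq => /=.
    by have := mulnC q N; lia.
  have E2 : (N * K * N)%N = b.+1 by lia.
  by lia.
- have [c [c0 Ec]] : exists c : k, c != 0 /\ (- ((-1) ^+ K * x ^+ M)) ^+ N =
      lgmono c ((M * N)%N%:Z, 0).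
    exists ((- (-1) ^+ K) ^+ N); split.
      by rewrite expf_neq0 // oppr_eq0 signr_eq0.
    have -> : (-1) ^+ K * x ^+ M = lgmono ((-1) ^+ K) (M%:Z, 0%N%:Z).
      by rewrite -sgn_mono expr0 mulr1.
    have -> : - lgmono ((-1) ^+ K) (M%:Z, 0%N%:Z) = lgmono (- (-1) ^+ K) (M%:Z, 0%N%:Z).
      by apply/lcoef_eqP => v; rewrite lcoefN !lcoef_gmono mulNrn.
    rewrite lgmonoX; congr lgmono; rewrite latticeMn /=; congr pair; rewrite mulrn_int; lia.
  have [d [d0 Ed]] : exists d : k, d != 0 /\ - ((-1) ^+ N * (x ^+ N * y ^+ n)) ^+ q =
      lgmono d (m%:Z + 1, b%:Z).
    exists (- ((-1) ^+ N) ^+ q); split; first by rewrite oppr_eq0 expf_neq0 // signr_eq0.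
    rewrite sgn_mono lgmonoX.
    have -> : ((N%:Z, n%:Z) : lattice) *+ q = (m%:Z + 1, b%:Z).
      by rewrite latticeMn /=; congr pair; rewrite mulrn_int; lia.
    by apply/lcoef_eqP => v; rewrite lcoefN !lcoef_gmono mulNrn.
  exists c, d; split=> //.
  apply: lead_eq (leadM (lead_lmono L erefl) R0) _ _.
    by rewrite /pairing /=; lia.
  rewrite Ec Ed mulrDr lmonoE !lgmonoM !mul1r; congr (lgmono _ _ + lgmono _ _);
    by apply: lattice_eq => /=; lia.
- by rewrite -[0]add0r; apply: geM => //; rewrite lmonoE; exact: ge_gmono.
- exact: vanishesMl.
Qed.

End NegativeCurve.

Section Instance.
Variables (k : closedFieldType) (L : laurentRing k).
Variable s : nat.
Local Notation lgmono := (@lgmono k L).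
Local Notation lcoef := (@lcoef k L).
Local Notation N := (pN s).
Local Notation n := (pn s).
Local Notation K := (pK s).
Local Notation M := (pM s).
Local Notation q := (pq s).
Local Notation b := (pb s).
Local Notation m := (pm s).
Local Notation a := (pa s).
Local Notation c := (pc s).
Local Notation uR := (rayR s).
Local Notation uL := (rayL s).
Local Notation uB := rayB.
Local Notation bpoly := (@bpoly k L).
Implicit Types (f g h t xi : L) (r l d : int).

Definition insec := (@inL k L uR uL uB).
Definition secdeg r l d : int := a%:Z * r + b%:Z * l + c%:Z * d.

Lemma pos_params : [/\ (0 < a)%N, (0 < b)%N, (0 < c)%N, (0 < m)%N & (0 < q)%N].
Proof.
have E1 := paq s; have E4 := pmM s.
have E5 := pMn s; have E6 := pqE s.
have q0 : (0 < q)%N by move: E6; rewrite /pN; lia.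
have b0 : (0 < b)%N by rewrite pbq muln_gt0 q0.
have M0 : (0 < M)%N by rewrite E5 muln_gt0.
split=> //; rewrite ?E1 ?E4 ?muln_gt0 ?M0 ?addn_gt0 ?orbT //.
Qed.

Lemma corner_size r l d : exists E : seq lattice,
  (size E <= m * N * (m * N))%N /\
  forall v, - r <= pairing uR v -> - l <= pairing uL v -> - d <= pairing uB v ->
    pairing uR v + r < (m * m * N)%N%:Z -> pairing uB v + d < (b * N)%N%:Z -> v \in E.
Proof.
have [_ b0 _ _ _] := pos_params.
pose j (i t : nat) : int := ((d + K%:Z * (i%:Z - r)) %% b%:Z)%Z + b%:Z * t%:Z.
pose pt (i t : nat) : lattice :=
  (((((N * N)%N%:Z * (j i t - d) - i%:Z + r)) %/ b%:Z)%Z, j i t - d).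
exists [seq pt i p | i <- iota 0 (m * m * N), p <- iota 0 N]; split.
  by rewrite size_allpairs !size_iota; apply: eq_leq; ring.
move=> [v1 v2]; rewrite /pairing /= !mul0r !add0r !mul1r => HR _ HB.
set R := - b%:Z * v1 + (N * N)%N%:Z * v2 in HR * => HR' HB'.
have [i Ei] : exists i : nat, i%:Z = R + r by exists (absz (R + r)); lia.
have [w Ew] : exists w : nat, w%:Z = v2 + d by exists (absz (v2 + d)); lia.
have bE := bN2 s.
have Ej : ((d + K%:Z * (i%:Z - r)) %% b%:Z)%Z = (w %% b)%N%:Z.
  have -> : d + K%:Z * (i%:Z - r) = (v2 - K%:Z * v1) * b%:Z + w%:Z.
    have E : K%:Z * (N * N)%N%:Z = b%:Z + 1 by rewrite -PoszM -bE; lia.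
    rewrite Ei Ew /R; transitivity (d + (K%:Z * (N * N)%N%:Z) * v2 - K%:Z * b%:Z * v1).
      by ring.
    by rewrite E; ring.
  by rewrite modzMDl modz_nat.
have Ejt : j i (w %/ b)%N = w%:Z.
  by rewrite /j Ej; have := divn_eq w b; lia.
have -> : (v1, v2) = pt i (w %/ b)%N; last first.
  apply: (@allpairs_f_dep _ (fun=> _) lattice pt _ (fun=> iota 0 N)); rewrite mem_iota add0n; first by lia.
  rewrite ltn_divLR //; move: HB'; rewrite -Ew.
  by rewrite ltz_nat leq0n mulnC.
apply: lattice_eq; rewrite /= Ejt; last by lia.
have -> : (N * N)%N%:Z * (w%:Z - d) - i%:Z + r = v1 * b%:Z.
  by rewrite Ei Ew /R; ring.
by rewrite mulzK //; lia.
Qed.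

Lemma box_point r l d (B : nat) : exists (j : nat) (v0 : lattice),
  forall i t : nat, (i <= B)%N -> (t <= B)%N ->
  [/\ - r <= pairing uR (v0 + (i%:Z, t%:Z)), - (l + j%:Z) <= pairing uL (v0 + (i%:Z, t%:Z))
     & - d <= pairing uB (v0 + (i%:Z, t%:Z))].
Proof.
have [_ b0 _ _ _] := pos_params.
pose C := (B + N * N * absz d + absz r)%N.
exists (a * C + q * absz d + q * B + absz l)%N, (- C%:Z, - d) => i t Hi Ht.
rewrite /pairing /= !mul0r !add0r !mul1r; split; last by lia.
- have H1 : b%:Z * (C%:Z - i%:Z) >= C%:Z - i%:Z by rewrite -[X in X <= _]mul1r ler_wpM2r; lia.
  have H2 : (N * N)%N%:Z * (absz d + t)%N%:Z >= (N * N)%N%:Z * - (- d + t%:Z).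
    by rewrite ler_wpM2l //; lia.
  have H3 : (N * N)%N%:Z * (t%:Z - d) >= - (N * N * absz d)%N%:Z.
    have -> : - (N * N * absz d)%N%:Z = (N * N)%N%:Z * - (absz d)%:Z by rewrite !PoszM; ring.
    by rewrite ler_wpM2l //; lia.
  by move: H1 H3; rewrite /C; lia.
- have H1 : a%:Z * (- C%:Z + i%:Z) >= a%:Z * - C%:Z by rewrite ler_wpM2l //; lia.
  have H2 : q%:Z * (- d + t%:Z) <= q%:Z * (absz d + B)%N%:Z by rewrite ler_wpM2l //; lia.
  have H3 : 0 <= (absz l)%:Z + l by lia.
  clearbody C; move: H1 H2 H3; lia.
Qed.

Variable xi : L.
Hypothesis xiP : xi_spec s xi.

Definition rF : int := ((b * M * N)%N%:Z - b%:Z) *+ N.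
Definition lF : int := n%:Z *+ N.

Lemma xi_in : insec ((b * M * N)%N%:Z - b%:Z) n%:Z 0 xi.
Proof.
have [[t [HL _] _] [c1 [c2 [_ _ [HR _]]]] HB _] := xiP; split=> //.
by rewrite opprB.
Qed.

Lemma secdeg_xi : secdeg ((b * M * N)%N%:Z - b%:Z) n%:Z 0 = (b * c)%N%:Z.
Proof.
by have := congr1 (muln b) (pcE' s); rewrite /secdeg; lia.
Qed.

Lemma secdeg_F : secdeg rF lF 0 = (b * c * N)%N%:Z.
Proof.
transitivity (N%:Z * secdeg ((b * M * N)%N%:Z - b%:Z) n%:Z 0).
  by rewrite /rF /lF !mulrn_int /secdeg; ring.
by rewrite secdeg_xi; lia.
Qed.

(* The key theorem is applied to the N-th power of xi and the m-th power of
   bpoly N, which vanish to the same order. *)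
Definition mu := (m * N)%N.
Definition eB := (m * m * N)%N.
Definition bcurve : L := bpoly N ^+ m.

Lemma bcurve_in : insec eB%:Z (-1) 0 (bcurve - 1).
Proof.
have [HL EL] := leadX m (leadL_bN L s); rewrite mul0rn expr1n in HL EL.
have HR := (leadX m (leadR_bN L s)); have {HR} [HR _] := HR.
have HB := geX (i := m) (@geB_bpoly _ L N); rewrite mul0rn in HB.
split.
- apply: geB; last by apply: ge1; lia.
  by apply: geW HR; rewrite mulrn_int /eB; lia.
- by have := ge_sub_init HL; rewrite EL.
- by apply: geB; [rewrite oppr0|apply: ge1].
Qed.

Lemma bcurve_van : vanishes bcurve mu.
Proof. by have := vanishesX m (vanishes_bpoly L N); rewrite mulnC. Qed.

Lemma curve_F_in : insec rF lF 0 (xi ^+ N).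
Proof. by have := inLX N xi_in; rewrite mul0rn. Qed.

Lemma curve_F_van : vanishes (xi ^+ N) mu.
Proof. by have [_ _ _ V] := xiP; exact: vanishesX. Qed.

Lemma dF_le : secdeg rF lF 0 <= a%:Z * eB%:Z.
Proof.
rewrite secdeg_F /eB; have := congr1 (muln^~ N) (pamm s).
rewrite mulnDl; lia.
Qed.

Lemma curve_F_split : exists cF F1 F2, [/\ xi ^+ N = lgmono cF (vtop s *+ N) + F1 + F2,
  cF != 0, lsupported (fun v => (pairing uL v == - lF) &&
    (pairing uB v < pairing uB (vtop s *+ N))) F1,
  insec rF lF 0 F1 & insec rF lF 0 F2 /\ ge uL (- lF + 1) F2].
Proof.
have [[t HL [c1 c0 Ht]] _ _ _] := xiP.
have [HLN EL] := leadX N HL; have [HtN Et] := leadX N Ht.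
rewrite lgmonoX in Et; set g := lgmono _ _ in Et.
have E : - lF = - n%:Z *+ N by rewrite mulNrn.
have [HF1 HF2 HF3] := curve_F_in.
have HT : insec rF lF 0 (t ^+ N) by rewrite -EL; split; exact: ge_init.
have Hg : insec rF lF 0 g by rewrite -Et; case: HT => *; split; exact: ge_init.
have supT : lsupported (fun v => pairing uL v == - lF) (t ^+ N).
  by rewrite -EL E; exact: lsupported_init.
exists (c1 ^+ N), (t ^+ N - g), (xi ^+ N - t ^+ N); split.
- by rewrite -/g; ring.
- exact: expf_neq0.
- move=> v Hv; apply/andP; split.
    move: v Hv; rewrite -/(lsupported _ _); apply: lsupportedB => //.
    by rewrite -Et; exact: lsupported_partW.
  have := ge_sub_init HtN; rewrite Et => /(_ _ Hv).
  by rewrite pairingNl /pairing /vtop latticeMn /= !mulrn_int; lia.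
- exact: inLB.
- split; first by apply: inLB => //; exact: curve_F_in.
  by have := ge_sub_init HLN; rewrite EL -E.
Qed.

Lemma vtopP : [/\ pairing uR (vtop s) = - ((b * M * N)%N%:Z - b%:Z),
  pairing uL (vtop s) = - n%:Z & pairing uB (vtop s) = b%:Z].
Proof.
split; rewrite /pairing /=; last by lia.
- have E1 := pmE s; have E2 := pqE s.
  have : (b * m.+1 = b * N * N + b * M * N)%N by rewrite E1 E2; ring.
  by lia.
- have H0 := pbq s.
  have H1 : (a * m = q * m + n * m)%N by rewrite paq mulnDl.
  have H2 : (q * (n * q) = q * m + n * m.+1)%N by rewrite pmE pmM {2}pqE; ring.
  by rewrite H0; lia.
Qed.

Lemma vtopN : [/\ pairing uR (vtop s *+ N) = - rF, pairing uL (vtop s *+ N) = - lF &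
  pairing uB (vtop s *+ N) = (b * N)%N%:Z - 0].
Proof.
have [E1 E2 E3] := vtopP.
by rewrite !pairingMnr E1 E2 E3 /rF /lF !mulrn_int; split; lia.
Qed.

End Instance.

Section CurveTheory.
Variables (k : closedFieldType) (L : laurentRing k).
Variable s : nat.
Local Notation lgmono := (@lgmono k L).
Local Notation lmono := (@lmono k L).
Local Notation lcoef := (@lcoef k L).
Local Notation N := (pN s).
Local Notation b := (pb s).
Local Notation m := (pm s).
Local Notation a := (pa s).
Local Notation c := (pc s).
Local Notation uR := (rayR s).
Local Notation uL := (rayL s).
Local Notation uB := rayB.
Local Notation insec := (@insec k L s).
Local Notation B := (bcurve L s).
Variable xi : L.
Hypothesis xiP : xi_spec s xi.
Implicit Types (f g h t : L) (r l d : int).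

Definition secpow := @idealpow k L uR uL uB (xi ^+ N) (B - 1) (rF s) (lF s) 0 (eB s).

Lemma sec_idealpow i r l d f : insec r l d f -> vanishes f (mu s * i.+1) ->
  secpow i r l d f.
Proof.
have [a0 b0 c0 m0 _] := pos_params s.
have [cF [F1 [F2 [EF cF0 S1 S2 [S3 S4]]]]] := curve_F_split xiP.
have [VR VL VB] := vtopN s.
apply: (vanishes_idealpow a0 b0 c0 (ray_relation s) EF cF0 (curve_F_in xiP)
  VR VL VB S1 S2 S3 S4 (bcurve_in L s) (curve_F_van xiP) _ (corner_size s) (box_point s)).
by rewrite addrC subrK; exact: bcurve_van.
Qed.

Lemma sec_cdeg r l d f j : insec r l d f -> f != 0 -> vanishes f j ->
  j%:Z * (b * c)%N%:Z <= m%:Z * secdeg s r l d.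
Proof.
have [a0 b0 c0 m0 _] := pos_params s.
have [cF [F1 [F2 [EF cF0 S1 S2 [S3 S4]]]]] := curve_F_split xiP.
have [VR VL VB] := vtopN s; have BV := bcurve_van L s.
rewrite -[B](subrK 1) addrC in BV.
have mu0 : (0 < mu s)%N by rewrite muln_gt0 m0.
move=> Hf f0 Vf.
have := vanishes_cdeg a0 b0 c0 (ray_relation s) EF cF0 (curve_F_in xiP)
  VR VL VB S1 S2 S3 S4 (bcurve_in L s) (curve_F_van xiP) BV (corner_size s) (box_point s)
  mu0 (dF_le s) Hf f0 Vf.
have EF' := secdeg_F s; rewrite /secdeg in EF'; rewrite /cdeg EF' /mu => H.
have N0 : 0 < N%:Z by [].
rewrite -(ler_pM2r N0); move: H; rewrite /secdeg /cdeg; lia.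
Qed.

Lemma sec_dvd r l d f j : insec r l d f -> vanishes f j ->
  secdeg s r l d < j%:Z * (a * m)%N%:Z -> exists i h, f ^+ i = xi * h.
Proof.
have [a0 b0 c0 m0 _] := pos_params s.
have [cF [F1 [F2 [EF cF0 S1 S2 [S3 S4]]]]] := curve_F_split xiP.
have [VR VL VB] := vtopN s; have BV := bcurve_van L s.
rewrite -[B](subrK 1) addrC in BV.
have mu0 : (0 < mu s)%N by rewrite muln_gt0 m0.
move=> Hf Vf Hlt.
have [i [h E]] : exists i h, f ^+ i = xi ^+ N * h; last first.
  by exists i, (xi ^+ N.-1 * h); rewrite E mulrA -exprS.
apply: (vanishes_dvd a0 b0 c0 (ray_relation s) EF cF0 (curve_F_in xiP)
  VR VL VB S1 S2 S3 S4 (bcurve_in L s) (curve_F_van xiP) BV (corner_size s) (box_point s)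
  mu0 (dF_le s) Hf Vf).
rewrite /mu /eB.
have mN0 : 0 < (m * N)%N%:Z by rewrite ltz_nat muln_gt0 m0.
by move: Hlt; rewrite -(ltr_pM2r mN0) /secdeg /cdeg; lia.
Qed.

End CurveTheory.

(** * Irreducibility and uniqueness *)

Section GaussLemma.
Variable k : closedFieldType.
Implicit Types (c d : {poly k}) (P Q W : {poly {poly k}}).

Lemma dvd_XsubC_poly (z : k) P : map_poly (horner_eval z) P = 0 ->
  exists Q, P = ('X - z%:P) *: Q.
Proof.
move=> P0; exists (map_poly (fun p : {poly k} => p %/ ('X - z%:P)) P).
apply/polyP => i; rewrite coefZ coef_map_id0 ?div0p //.
have := congr1 (fun p : {poly k} => p`_i) P0; rewrite coef_map /= coef0 horner_evalE.
by move=> /eqP Ri; rewrite mulrC divpK // dvdp_XsubCl.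
Qed.

(* Gauss' lemma: the roots of c are cleared one at a time, since X - z is prime. *)
Lemma clear_scalar c P Q W : c != 0 -> c *: Q = P * W -> exists c1 c2 P' W',
  [/\ Q = P' * W', P = c1 *: P' & W = c2 *: W'].
Proof.
have [d Hd] := ubnP (size c); elim: d c P Q W Hd => [//|d IH] c P Q W Hd c0 E.
have [/size1_polyC Ec|lt1c] := leqP (size c) 1.
  move: (c`_0) Ec => z Ec; have cc : z != 0 by move: c0; rewrite Ec polyC_eq0.
  exists 1, c, P, ((z^-1)%:P *: W); split; rewrite ?scale1r //.
    by rewrite -scalerAr -E Ec scalerA -polyCM mulVf // scale1r.
  by rewrite Ec scalerA -polyCM mulfV // scale1r.
have /closed_rootP[z /factor_theorem[c' Ec]] : size c != 1%N by rewrite neq_ltn lt1c orbT.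
have c'0 : c' != 0 by apply: contraNneq c0 => c'0; rewrite Ec c'0 mul0r.
have z0 : 'X - z%:P != 0 :> {poly k} by rewrite polyXsubC_eq0.
have Hd' : (size c' < d)%N.
  by move: Hd; rewrite Ec size_Mmonic ?monicXsubC // size_XsubC addn2.
have inj Q1 Q2 : ('X - z%:P) *: Q1 = ('X - z%:P) *: Q2 -> Q1 = Q2.
  by rewrite -!mul_polyC => /mulfI; apply; rewrite polyC_eq0.
have : map_poly (horner_eval z) P * map_poly (horner_eval z) W = 0.
  rewrite -rmorphM -E /= map_polyZ /= horner_evalE Ec hornerM hornerXsubC subrr.
  by rewrite mulr0 scale0r.
move/eqP; rewrite mulf_eq0 => /orP[]/eqP/dvd_XsubC_poly[P1 EP].
- have [|c1 [c2 [P' [W' [E1 E2 E3]]]]] := IH c' P1 Q W Hd' c'0.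
    by apply: inj; rewrite scalerA mulrC -Ec E EP scalerAl.
  by exists (('X - z%:P) * c1), c2, P', W'; rewrite EP E2 scalerA.
- have [|c1 [c2 [P' [W' [E1 E2 E3]]]]] := IH c' P Q P1 Hd' c'0.
    by apply: inj; rewrite scalerA mulrC -Ec E EP scalerAr.
  by exists c1, (('X - z%:P) * c2), P', W'; rewrite EP E3 scalerA.
Qed.

End GaussLemma.

Section Primality.
Variables (k : closedFieldType) (L : laurentRing k).
Local Notation lcoef := (@lcoef k L).
Local Notation lmono := (@lmono k L).
Local Notation lpoly := (@lpoly k L).
Implicit Types (f g h : L).

Definition unit_in f := exists g, f * g = 1.

Definition irr f := [/\ f <> 0, ~ unit_in f &
  forall g h, f = g * h -> unit_in g \/ unit_in h].

Definition ord u f c := ge u c f /\ init u c f <> 0.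

Lemma ord_exists u f : f != 0 -> exists c, ord u f c.
Proof. by move=> /(order_exists u)[c [H /eqP I]]; exists c. Qed.

Lemma ord_uniq u f c d : ord u f c -> ord u f d -> c = d.
Proof. by case=> H1 /eqP I1 [H2 /eqP I2]; exact: (order_unique H1 I1 H2 I2). Qed.

Lemma ordM u f g c d : ord u f c -> ord u g d -> ord u (f * g) (c + d).
Proof.
case=> H1 /eqP I1 [H2 /eqP I2]; split; first exact: geM.
by rewrite init_mul //; apply/eqP/lmulf_neq0.
Qed.

Lemma ordX u f c i : ord u f c -> ord u (f ^+ i) (c *+ i).
Proof.
case=> H1 /eqP I1; split; first exact: geX.
by rewrite init_exp //; apply/eqP/lexpf_neq0.
Qed.

Lemma ord1 u : ord u 1 0.
Proof. by split; [exact: ge1|rewrite init_1; apply/eqP/oner_neq0]. Qed.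

Lemma ord_neq0 u f c : ord u f c -> f != 0.
Proof.
case=> _ I; apply/eqP => f0; apply: I; rewrite f0.
by apply: (@init_gt _ _ _ _ (c + 1)); [lia|exact: ge0l].
Qed.

Lemma ord_le u f c v : ord u f c -> lcoef f v != 0 -> c <= pairing u v.
Proof. by case=> H _; exact: H. Qed.

Lemma ord_attained u f c : ord u f c -> exists v, lcoef f v != 0 /\ pairing u v = c.
Proof. by case=> _ /eqP/init_supp. Qed.

Lemma unit_neq0 f : unit_in f -> f != 0.
Proof. by case=> g E; apply: contra_eq_neq E => ->; rewrite mul0r eq_sym oner_neq0. Qed.

Lemma unit_pairing u f v w : unit_in f -> lcoef f v != 0 -> lcoef f w != 0 ->
  pairing u v = pairing u w.
Proof.
case=> g E fv fw.
have f0 : f != 0 by apply: unit_neq0; exists g.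
have g0 : g != 0 by apply: unit_neq0; exists f; rewrite mulrC.
have [[c1 O1] [c2 O2]] := (ord_exists u f0, ord_exists (- u) f0).
have [[d1 P1] [d2 P2]] := (ord_exists u g0, ord_exists (- u) g0).
have E1 : c1 + d1 = 0 by apply: ord_uniq (ordM O1 P1) _; rewrite E; exact: ord1.
have E2 : c2 + d2 = 0 by apply: ord_uniq (ordM O2 P2) _; rewrite E; exact: ord1.
have [t gt] := lcoef_neq0 g0.
have := (ord_le O1 fv, ord_le O1 fw, ord_le O2 fv, ord_le O2 fw).
have := (ord_le P1 gt, ord_le P2 gt); rewrite !pairingNl.
move=> [H1 H2] [[[H3 H4] H5] H6]; lia.
Qed.

Lemma single_unit f v : lcoef f v != 0 -> (forall w, lcoef f w != 0 -> w = v) ->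
  unit_in f.
Proof.
move=> fv Hf; exists (lgmono L (lcoef f v)^-1 (- v)).
have -> : f = lgmono L (lcoef f v) v.
  apply/lcoef_eqP => w; rewrite !lcoef_gmono; case: (v =P w) => [->//|nvw].
  by rewrite mulr0n; apply/eqP/negPn/negP => /Hf E; apply: nvw.
by rewrite lgmonoM subrr !lcoef_gmono eqxx mulfV ?lgmono1.
Qed.

Lemma unit_inM f g : unit_in (f * g) -> unit_in f.
Proof. by case=> h E; exists (g * h); rewrite mulrA. Qed.

Lemma lpoly_rep f : f != 0 -> exists v P, [/\ lmono v * f = lpoly P, P`_0 != 0 & P != 0].
Proof.
move=> f0; have [i [P E]] := lpoly_dense f.
have P0 : P != 0.
  apply: contraTneq (lmulf_neq0 (lmono_neq0 L (i%:Z, i%:Z)) f0) => P0.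
  by rewrite E P0 lpoly0 eqxx.
have [d Hd] := ubnP (size P); move: (i%:Z, i%:Z) E => v E.
elim: d v P Hd E P0 => [//|d IH] v P Hd E P0.
have [P00|P00] := eqVneq P`_0 0; last by exists v, P.
have [Q EQ] := dvdX_coef0 P00.
have Q0 : Q != 0 by apply: contraNneq P0 => Q0; rewrite EQ Q0 mulr0.
apply: (IH (v - (0, 1)) Q) => //.
  by move: Hd; rewrite EQ mulrC size_mulX.
apply: (@lmono_inj k L (0, 1)); rewrite mulrA -lmonoD addrC subrK E EQ lpolyM lpolyy.
by rewrite ly_mono.
Qed.

Lemma not_unit_lpoly (P : {poly {poly k}}) : P`_0 != 0 -> (1 < size P)%N -> ~ unit_in (lpoly P).
Proof.
move=> P00 szP U.
have [i Hi] : exists i : nat, P`_0`_i != 0.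
  by exists (size P`_0).-1; rewrite -lead_coefE lead_coef_eq0.
have [j Hj] : exists j : nat, P`_(size P).-1`_j != 0.
  exists (size P`_(size P).-1).-1; rewrite -lead_coefE lead_coef_eq0 -lead_coefE.
  by rewrite lead_coef_eq0 -size_poly_gt0 ltnW.
have H1 : lcoef (lpoly P) (i%:Z, 0) != 0 by rewrite lcoef_lpoly.
have H2 : lcoef (lpoly P) (j%:Z, (size P).-1%:Z) != 0 by rewrite lcoef_lpoly.
have := unit_pairing (0, 1) U H1 H2; rewrite /pairing /= !mul0r !add0r !mul1r.
by move: szP; case: (size P) => [|[|d]].
Qed.

Lemma ge_lpoly P : ge (0, 1) 0 (lpoly P).
Proof.
apply/geP => t; rewrite lcoef_lpoly; case: ifP => [/andP[_ H] _|_]; last by rewrite eqxx.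
by rewrite /pairing /= mul0r add0r mul1r.
Qed.

Lemma lpoly_shift f (j : nat) P : ge (0, 1) 0 f ->
  lmono (j%:Z, j%:Z) * f = lpoly P -> exists Q, lmono (j%:Z, 0) * f = lpoly Q.
Proof.
move=> Hf E; apply: lsupported_lpoly => t; rewrite lcoef_lmonoM => /[dup]/Hf Ht.
have -> : t - (j%:Z, 0) = (t + (0, j%:Z)) - (j%:Z, j%:Z).
  by apply: lattice_eq => /=; lia.
rewrite -lcoef_lmonoM E lcoef_lpoly; move: Ht; rewrite /pairing /=.
by case: ifP => [|_]; rewrite ?eqxx //; lia.
Qed.

Lemma irr_dvd_exp f g h i : irr f -> irr g -> f ^+ i = g * h ->
  (exists v w, [/\ lcoef g v != 0, lcoef g w != 0 & v.2 != w.2]) ->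
  exists2 u, unit_in u & f = u * g.
Proof.
move=> [/eqP f0 nUf If] [/eqP g0 nUg Ig] E [v1 [v2 [gv1 gv2 nv]]].
have [v [P [EP P00 P0]]] := lpoly_rep g0.
have [w [F [EF F00 F0]]] := lpoly_rep f0.
have UP : unit_in (lpoly P) -> unit_in g.
  by rewrite -EP mulrC; exact: unit_inM.
have szP : (1 < size P)%N.
  rewrite ltnNge; apply/negP => szP; case/negP: nv; apply/eqP.
  have H t : lcoef g t != 0 -> t.2 = - v.2.
    have -> : lcoef g t = lcoef (lpoly P) (t + v).
      by rewrite -EP lcoef_lmonoM addrK.
    rewrite lcoef_lpoly; case: ifP => [/andP[_ t0]|_]; last by rewrite eqxx.
    have [/eqP E0|/(leq_trans szP) le] := posnP (absz (t + v).2).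
      by move: E0; rewrite absz_eq0 /= => /eqP; lia.
    by rewrite (nth_default _ le) coef0 eqxx.
  by rewrite (H _ gv1) (H _ gv2).
pose G := gcdp P F.
have G0 : G != 0 by rewrite gcdp_eq0 negb_and P0.
have szG : (1 < size G)%N.
  rewrite ltn_neqAle lt0n size_poly_eq0 G0 andbT eq_sym.
  apply/negP => /eqP/eqP; rewrite -coprimep_def => /(coprimep_expr i) cop.
  pose H := lmono (w *+ i - v) * h.
  have EH : lpoly (F ^+ i) = lpoly P * H.
    rewrite lpolyXn -EF exprMn E -EP lmonoX mulrACA -lmonoD addrC subrK; ring.
  have H_ge : ge (0, 1) 0 H.
    rewrite -[0]subr0; apply: (@ge_div _ _ _ _ _ (lpoly P)); last rewrite -EH.
    - exact: ge_lpoly.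
    - have [d Hd] : exists d : nat, P`_0`_d != 0.
        by exists (size P`_0).-1; rewrite -lead_coefE lead_coef_eq0.
      by apply: (@supp_init _ _ _ _ _ (d%:Z, 0)); rewrite ?lcoef_lpoly // /pairing /=; lia.
    exact: ge_lpoly.
  have [j [Q EQ]] := lpoly_dense H.
  have [Q' EQ'] := lpoly_shift H_ge EQ.
  have: P %| 'X^j *: F ^+ i.
    have -> : 'X^j *: F ^+ i = Q' * P; last exact: dvdp_mull.
    apply: (@lpoly_inj k L); rewrite -mul_polyC rmorphXn !lpolyM EH lpolyXn -EQ'.
    rewrite lpolyx -[_ ^+ j]mulr1 -(expr0 (lvar2 L)) -lmono_nat; ring.
  rewrite dvdpZr ?monic_neq0 ?monicXn // => dP.
  by have := coprimep_dvdl dP cop; rewrite coprimepp gtn_eqF.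
have unitl t e A B : irr e -> lmono t * e = A * B -> ~ unit_in B -> unit_in A.
  move=> [_ _ Ie] Et nB; have := Ie (lmono (- t) * A) B.
  rewrite -mulrA -Et mulrA lmonoK mul1r => /(_ erefl)[|//].
  by rewrite mulrC; exact: unit_inM.
have Irrg : irr g by split=> //; exact/eqP.
have Irrf : irr f by split=> //; exact/eqP.
have dGP : G %| P by exact: dvdp_gcdl.
have [[c1 Q] /= c10 E1] := Pdiv.Idomain.dvdpP _ _ dGP.
have [d1 [d2 [Q' [G' [EP' EQ' EG']]]]] := clear_scalar c10 E1.
have P00' : (Q'`_0 != 0) && (G'`_0 != 0).
  by have := P00; rewrite EP' coef0M mulf_eq0 negb_or.
have d20 : d2 != 0 by apply: contraNneq G0 => d20; rewrite EG' d20 scale0r.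
have szG' : (1 < size G')%N by move: szG; rewrite EG' size_scale.
have UQ' : unit_in (lpoly Q').
  apply: (unitl v g _ (lpoly G')) => //; first by rewrite -lpolyM -EP'.
  by apply: not_unit_lpoly => //; case/andP: P00'.
have szQ' : size Q' = 1%N.
  case/andP: P00' => Q00 _; apply/eqP; rewrite eqn_leq leqNgt size_poly_gt0.
  have -> : Q' != 0 by apply: contraNneq Q00 => ->; rewrite coef0.
  by rewrite andbT; apply/negP => /(not_unit_lpoly Q00).
have dPF : P %| F.
  have : G %= P.
    rewrite -dvdp_size_eqp // EP' size_mul ?szQ' ?add1n /=.
    - by rewrite EG' size_scale.
    - by rewrite -size_poly_eq0 szQ'.
    - by rewrite -size_poly_gt0 ltnW.
  by move/eqp_dvdl => <-; exact: dvdp_gcdr.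
have [[c2 Q2] /= c20 E2] := Pdiv.Idomain.dvdpP _ _ dPF.
have [e1 [e2 [Q2' [P' [EF' EQ2' EP2]]]]] := clear_scalar c20 E2.
have e20 : e2 != 0 by apply: contraNneq P0 => e20; rewrite EP2 e20 scale0r.
have nU : ~ unit_in (lpoly P').
  apply: not_unit_lpoly; last by move: szP; rewrite EP2 size_scale.
  by apply: contraNneq P00 => E0; rewrite EP2 coefZ E0 mulr0.
have U1 : unit_in (lpoly Q2').
  by apply: (unitl w f _ (lpoly P')) => //; rewrite -lpolyM -EF'.
have Eg : lmono v * g = lpoly e2%:P * lpoly P' by rewrite EP EP2 -mul_polyC lpolyM.
have Ef : lmono w * f = lpoly Q2' * lpoly P' by rewrite EF EF' lpolyM.
have [u2 Hu2] := unitl _ _ _ _ Irrg Eg nU; have [u1 Hu1] := U1.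
exists (lmono (v - w) * (lpoly Q2' * u2)).
  exists (lmono (w - v) * (u1 * lpoly e2%:P)).
  rewrite mulrACA -lmonoD -opprB addNr lmono0 mul1r mulrACA Hu1 mul1r mulrC //.
apply: (@lmono_inj k L w); rewrite Ef mulrA mulrA -lmonoD addrC subrK.
transitivity (lpoly Q2' * u2 * (lmono v * g)); last by ring.
rewrite Eg; transitivity (lpoly Q2' * lpoly P' * (lpoly e2%:P * u2)); last by ring.
by rewrite Hu2 mulr1.
Qed.

End Primality.

Section NegativeCurveProperties.
Variables (k : closedFieldType) (L : laurentRing k).
Variable s : nat.
Local Notation lgmono := (@lgmono k L).
Local Notation lmono := (@lmono k L).
Local Notation lcoef := (@lcoef k L).
Local Notation N := (pN s).
Local Notation n := (pn s).
Local Notation K := (pK s).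
Local Notation M := (pM s).
Local Notation b := (pb s).
Local Notation m := (pm s).
Local Notation a := (pa s).
Local Notation c := (pc s).
Local Notation uR := (rayR s).
Local Notation uL := (rayL s).
Local Notation uB := rayB.
Local Notation insec := (@insec k L s).
Implicit Types (f g h xi : L) (r l d : int).

Definition ords f r l d := [/\ ord uR f r, ord uL f l & ord uB f d].

Lemma ords_exists f : f != 0 -> exists r l d, ords f r l d.
Proof.
move=> f0; have [r Hr] := ord_exists uR f0; have [l Hl] := ord_exists uL f0.
by have [d Hd] := ord_exists uB f0; exists r, l, d.
Qed.

Lemma ordsM f g r l d r' l' d' : ords f r l d -> ords g r' l' d' ->
  ords (f * g) (r + r') (l + l') (d + d').
Proof. by case=> ? ? ? [? ? ?]; split; exact: ordM. Qed.

Lemma ords_uniq f r l d r' l' d' : ords f r l d -> ords f r' l' d' ->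
  [/\ r = r', l = l' & d = d'].
Proof. by case=> H1 H2 H3 [H4 H5 H6]; split; [move: H1 H4|move: H2 H5|move: H3 H6]; exact: ord_uniq. Qed.

Lemma ords_insec f r l d : ords f r l d -> insec (- r) (- l) (- d) f.
Proof. by case=> [[? _] [? _] [? _]]; split; rewrite opprK. Qed.

Lemma ords_neq0 f r l d : ords f r l d -> f != 0.
Proof. by case=> /ord_neq0. Qed.

Lemma ords_secdeg f r l d v : ords f r l d -> lcoef f v != 0 ->
  secdeg s (- r) (- l) (- d) = a%:Z * (pairing uR v - r) +
    b%:Z * (pairing uL v - l) + c%:Z * (pairing uB v - d) /\
  [/\ 0 <= pairing uR v - r, 0 <= pairing uL v - l & 0 <= pairing uB v - d].
Proof.
case=> H1 H2 H3 fv; split; last first.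
  by rewrite !subr_ge0; split; [exact: ord_le H1 fv|exact: ord_le H2 fv|exact: ord_le H3 fv].
by have := ray_relation s v; rewrite /secdeg; lia.
Qed.

Lemma ords_ge0 f r l d : ords f r l d -> 0 <= secdeg s (- r) (- l) (- d).
Proof.
move=> O; have [v fv] := lcoef_neq0 (ords_neq0 O).
have [-> [H1 H2 H3]] := ords_secdeg O fv.
by rewrite !addr_ge0 // mulr_ge0.
Qed.

Lemma ords_unit f r l d : ords f r l d -> secdeg s (- r) (- l) (- d) = 0 -> unit_in f.
Proof.
have [a0 b0 c0 _ _] := pos_params s.
move=> O E; have H v : lcoef f v != 0 -> pairing uR v = r /\ pairing uB v = d.
  move=> fv; have [] := ords_secdeg O fv; rewrite E => {}E [H1 H2 H3].
  have P1 := mulr_ge0 (ler0n int a) H1; have P2 := mulr_ge0 (ler0n int b) H2.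
  have P3 := mulr_ge0 (ler0n int c) H3; rewrite !natz in P1 P2 P3.
  have E1 : a%:Z * (pairing uR v - r) = 0 by lia.
  have E3 : c%:Z * (pairing uB v - d) = 0 by lia.
  by move: E1 E3 => /eqP; rewrite mulf_eq0 => /orP[|/eqP]; [lia|];
    move=> ? /eqP; rewrite mulf_eq0 => /orP[|/eqP]; lia.
have [v fv] := lcoef_neq0 (ords_neq0 O).
apply: (single_unit fv) => w fw; have [R1 B1] := H _ fv; have [R2 B2] := H _ fw.
have EB : w.2 = v.2 by move: B1 B2; rewrite /pairing /= !mul0r !add0r !mul1r => -> ->.
apply: lattice_eq => //; move: R1 R2; rewrite /pairing /= EB => <- /addIr.
by apply: mulfI; rewrite oppr_eq0; lia.
Qed.

Definition ordE f j := vanishes f j /\ ~ vanishes f j.+1.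

Lemma ordEM f g i j : ordE f i -> ordE g j -> ordE (f * g) (i + j).
Proof.
case=> Vf Nf [Vg Ng]; split; first exact: vanishesM.
by move=> V; apply: Ng; have := vanishes_div V Nf; rewrite -addnS addKn.
Qed.

Lemma ordE_uniq f i j : ordE f i -> ordE f j -> i = j.
Proof.
case=> Vi Ni [Vj Nj]; apply/eqP; rewrite eqn_leq; apply/andP; split.
  by rewrite leqNgt; apply/negP => lt; apply: Nj; exact: vanishesW Vi.
by rewrite leqNgt; apply/negP => lt; apply: Ni; exact: vanishesW Vj.
Qed.

Variable xi : L.
Hypothesis xiP : xi_spec s xi.

Lemma ordE_exists f : f != 0 -> exists j, ordE f j.
Proof.
have [_ b0 c0 _ _] := pos_params s.
move=> f0; have [r [l [d O]]] := ords_exists f0.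
apply: NNPP => H; have V j : vanishes f j.
  elim: j => [|j IH]; first exact: vanishes_ge0.
  by apply: NNPP => nV; apply: H; exists j.
have := sec_cdeg xiP (ords_insec O) f0 (V (absz (m%:Z * secdeg s (- r) (- l) (- d))).+1).
set D := _ * secdeg _ _ _ _; move=> H1.
have bc0 : 0 < (b * c)%N%:Z by rewrite ltz_nat muln_gt0 b0.
have : (absz D).+1%:Z <= (absz D).+1%:Z * (b * c)%N%:Z by rewrite ler_peMr //; lia.
by lia.
Qed.

Lemma xi_coef : lcoef xi (vright s) != 0 /\ lcoef xi (vtop s) != 0.
Proof.
have [_ [c1 [c2 [c10 c20 HR]]] _ _] := xiP.
have nv : vtop s != vright s.
  by rewrite /vtop /vright -pair_eqE /= negb_and; have [_ ? _ _ _] := pos_params s; lia.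
have E1 : lcoef (lgmono c1 (vright s) + lgmono c2 (vtop s)) (vright s) = c1.
  by rewrite lcoefD !lcoef_gmono eqxx (negbTE nv) addr0.
have E2 : lcoef (lgmono c1 (vright s) + lgmono c2 (vtop s)) (vtop s) = c2.
  by rewrite lcoefD !lcoef_gmono eqxx eq_sym (negbTE nv) add0r.
by split; [have [|->] := lead_supp HR (v := vright s)|have [|->] := lead_supp HR (v := vtop s)];
  rewrite ?E1 ?E2.
Qed.

Lemma xi_ords : ords xi (b%:Z - (b * M * N)%N%:Z) (- n%:Z) 0.
Proof.
have [X1 X2] := xi_coef; have [H1 H2 H3] := xi_in xiP.
have [_ PL _] := vtopP s; rewrite opprB in H1; rewrite oppr0 in H3.
split; split=> //; apply/eqP.
- by apply: (supp_init X1); rewrite /pairing /=; lia.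
- exact: supp_init X2 PL.
- by apply: (supp_init X1); rewrite /pairing /=; lia.
Qed.

Lemma xi_secdeg : secdeg s (- (b%:Z - (b * M * N)%N%:Z)) (- - n%:Z) (- 0) = (b * c)%N%:Z.
Proof. by rewrite opprB opprK oppr0 secdeg_xi. Qed.

Lemma xi_neq0 : xi != 0. Proof. exact: ords_neq0 xi_ords. Qed.

Lemma xi_ordE : ordE xi m.
Proof.
have [_ b0 c0 _ _] := pos_params s; have [_ _ _ V] := xiP; split=> // V'.
have := sec_cdeg xiP (ords_insec xi_ords) xi_neq0 V'; rewrite xi_secdeg.
have bc0 : 0 < (b * c)%N%:Z by rewrite ltz_nat muln_gt0 b0.
by rewrite (ler_pM2r bc0); lia.
Qed.

Lemma coprime_bN2 (z w : int) : b%:Z * z = (N * N)%N%:Z * w -> exists t, w = b%:Z * t.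
Proof.
have E : (N * N)%N%:Z * K%:Z = b%:Z + 1 by rewrite -PoszM mulnC -bN2; lia.
move=> H; exists (K%:Z * z - w); rewrite mulrBr mulrCA H mulrA [K%:Z * _]mulrC E; ring.
Qed.

Lemma homogeneous_height f r d d' : lsupported (fun v => pairing uR v == r) f ->
  ord uB f d -> ord (- uB) f d' -> exists t : nat, - d' - d = (b * t)%N%:Z.
Proof.
have [_ b0 _ _ _] := pos_params s.
move=> Hf O O'; have [v [fv Ev]] := ord_attained O.
have [w [fw Ew]] := ord_attained O'; rewrite pairingNl in Ew.
have le0 : pairing uB v <= pairing uB w by rewrite Ev; exact: ord_le O fw.
have [t Et] : exists t, w.2 - v.2 = b%:Z * t.
  apply: (@coprime_bN2 (w.1 - v.1)).
  by have /eqP := Hf _ fv; have /eqP := Hf _ fw; rewrite /pairing /=; lia.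
have t0 : 0 <= t.
  have : 0 <= b%:Z * t by rewrite -Et; move: le0; rewrite /pairing /=; lia.
  by rewrite pmulr_rge0.
exists (absz t); rewrite PoszM gez0_abs // -Et -Ew -Ev /pairing /=; lia.
Qed.

Lemma ordN_exists f d : ord uB f d -> exists d', ord (- uB) f d'.
Proof. by move=> /ord_neq0; exact: ord_exists. Qed.

Lemma init_xi_ord : let P := init uR (b%:Z - (b * M * N)%N%:Z) xi in
  ord uB P 0 /\ ord (- uB) P (- b%:Z).
Proof.
have [_ [c1 [c2 [c10 c20 HR]]] HB _] := xiP.
have nv : vtop s != vright s.
  by rewrite /vtop /vright -pair_eqE /= negb_and; have [_ ? _ _ _] := pos_params s; lia.
have [_ EP] := HR => P; rewrite {}/P EP.
set P := _ + _.
have HP v : lcoef P v != 0 -> v = vright s \/ v = vtop s.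
  rewrite /P lcoefD !lcoef_gmono; case: (vright s =P v) => [->|_]; first by left.
  by case: (vtop s =P v) => [->|_]; [right|rewrite !mulr0n addr0 eqxx].
have E1 : lcoef P (vright s) != 0.
  by rewrite lcoefD !lcoef_gmono eqxx (negbTE nv) addr0.
have E2 : lcoef P (vtop s) != 0.
  by rewrite lcoefD !lcoef_gmono eqxx [vright s == _]eq_sym (negbTE nv) add0r.
split; split; try apply/eqP.
- by apply/geP => v /HP[] ->; rewrite /pairing /=; lia.
- by apply: (supp_init E1); rewrite /pairing /=; lia.
- by apply/geP => v /HP[] ->; rewrite pairingNl /pairing /=; lia.
- by apply: (supp_init E2); rewrite pairingNl /pairing /=; lia.
Qed.

Lemma dvd_exp_height g h r d d' i : ord uR g r ->
  ord uB (init uR r g) d -> ord (- uB) (init uR r g) d' -> g ^+ i = xi * h -> d + d' != 0.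
Proof.
have [_ b0 _ _ _] := pos_params s.
move=> [Hg Ig] O O' E.
have g0 : g != 0 by apply: (@ord_neq0 _ _ uR _ r).
have h0 : h != 0.
  by apply: contraTneq (lexpf_neq0 i g0) => h0; rewrite E h0 mulr0 eqxx.
have [rh [Hh Ih]] := ord_exists uR h0.
have [[Hx Ix] _ _] := xi_ords.
have Er : r *+ i = b%:Z - (b * M * N)%N%:Z + rh.
  by apply: (ord_uniq (ordX i (conj Hg Ig))); rewrite E; apply: ordM.
have EI : init uR r g ^+ i = init uR (b%:Z - (b * M * N)%N%:Z) xi * init uR rh h.
  by rewrite -init_exp // Er E init_mul.
have [OP OP'] := init_xi_ord.
have [dh Oh] := ord_exists uB (introN eqP Ih).
have [dh' Oh'] := ord_exists (- uB) (introN eqP Ih).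
have := ordX i O; rewrite EI => /ord_uniq/(_ (ordM OP Oh)) E1.
have := ordX i O'; rewrite EI => /ord_uniq/(_ (ordM OP' Oh')) E2.
have [v [hv Ev]] := ord_attained Oh.
have := ord_le Oh' hv; rewrite pairingNl Ev => le0.
apply/negP => /eqP Ed; have : d *+ i + d' *+ i = 0 by rewrite -mulrnDl Ed mul0rn.
by rewrite E1 E2; lia.
Qed.

Lemma xi_factor_dvd g h r l d j r' l' d' j' : xi = g * h ->
  ords g r l d -> ordE g j -> ords h r' l' d' -> ordE h j' ->
  [/\ j%:Z * (b * c)%N%:Z = m%:Z * secdeg s (- r) (- l) (- d) & (j + j' = m)%N].
Proof.
move=> E O Oj O' Oj'; have Ej : (j + j' = m)%N.
  by apply: ordE_uniq xi_ordE; rewrite E; exact: ordEM.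
split=> //; have := ordsM O O'; rewrite -E => /ords_uniq/(_ xi_ords)[Er El Ed].
have [Vg _] := Oj; have [Vh _] := Oj'.
have H1 := sec_cdeg xiP (ords_insec O) (ords_neq0 O) Vg.
have H2 := sec_cdeg xiP (ords_insec O') (ords_neq0 O') Vh.
have : secdeg s (- r) (- l) (- d) + secdeg s (- r') (- l') (- d') = (b * c)%N%:Z.
  by rewrite -xi_secdeg -Er -El -Ed /secdeg; ring.
move=> /(congr1 ( *%R m%:Z)); rewrite mulrDr.
have : (j%:Z + j'%:Z) * (b * c)%N%:Z = m%:Z * (b * c)%N%:Z by rewrite -PoszD Ej.
by rewrite mulrDl; lia.
Qed.

Lemma xi_factor_dvd_exp g r l d j : ords g r l d -> ordE g j ->
  j%:Z * (b * c)%N%:Z = m%:Z * secdeg s (- r) (- l) (- d) ->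
  unit_in g \/ exists i h, g ^+ i = xi * h.
Proof.
have [_ b0 c0 m0 _] := pos_params s.
move=> O [Vj _] Ej; have [E0|/eqP n0] := secdeg s (- r) (- l) (- d) =P 0.
  by left; exact: ords_unit O E0.
right; apply: (sec_dvd xiP (ords_insec O) Vj).
have j0 : (0 < j)%N.
  rewrite lt0n; apply: contraNneq n0 => j0; move/esym/eqP: Ej.
  by rewrite j0 mul0r mulf_eq0 => /orP[|//]; lia.
have m0' : 0 < m%:Z by [].
rewrite -(ltr_pM2l m0') -Ej; have := congr1 (muln j) (pamm s).
have : (0 < j * n)%N by rewrite muln_gt0 j0.
by rewrite mulnDr; lia.
Qed.

Lemma xi_irr : irr xi.
Proof.
have [_ b0 c0 m0 _] := pos_params s.
split; first exact/eqP/xi_neq0.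
  move=> U; have [X1 X2] := xi_coef.
  by have := unit_pairing uB U X1 X2; rewrite /pairing /=; lia.
move=> g h E; have gh0 := xi_neq0; rewrite E in gh0.
have g0 : g != 0 by apply: contraNneq gh0 => ->; rewrite mul0r.
have h0 : h != 0 by apply: contraNneq gh0 => ->; rewrite mulr0.
have [r [l [d O]]] := ords_exists g0; have [j Oj] := ordE_exists g0.
have [r' [l' [d' O']]] := ords_exists h0; have [j' Oj'] := ordE_exists h0.
have [Ej _] := xi_factor_dvd E O Oj O' Oj'.
have [] := @xi_factor_dvd h g _ _ _ _ _ _ _ _ _ O' Oj' O Oj; first by rewrite mulrC.
move=> Ej' _.
have [?|[i [g' Eg]]] := xi_factor_dvd_exp O Oj Ej; first by left.
have [?|[i' [h' Eh]]] := xi_factor_dvd_exp O' Oj' Ej'; first by right.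
exfalso.
have [Og _ _] := O; have [Oh _ _] := O'; have [Ox _ _] := xi_ords.
have EI : init uR (b%:Z - (b * M * N)%N%:Z) xi = init uR r g * init uR r' h.
  have [Hg _] := Og; have [Hh _] := Oh; rewrite -init_mul // -E; congr (init _ _ _).
  by apply: (ord_uniq Ox); rewrite E; exact: ordM.
have [OP OP'] := init_xi_ord; rewrite EI in OP OP'.
have [_ Ig] := Og; have [_ Ih] := Oh.
have [e1 P1] := ord_exists uB (introN eqP Ig); have [e1' P1'] := ordN_exists P1.
have [e2 P2] := ord_exists uB (introN eqP Ih); have [e2' P2'] := ordN_exists P2.
have [t1 T1] := homogeneous_height (@lsupported_init _ _ _ _ _) P1 P1'.
have [t2 T2] := homogeneous_height (@lsupported_init _ _ _ _ _) P2 P2'.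
have := dvd_exp_height Og P1 P1' Eg; have := dvd_exp_height Oh P2 P2' Eh.
have E1 := ord_uniq OP (ordM P1 P2); have E2 := ord_uniq OP' (ordM P1' P2').
have Et : (b * (t1 + t2) = b * 1)%N by rewrite mulnDr muln1; lia.
move/eqP: Et; rewrite eqn_pmul2l // => /eqP Et.
by case: t1 T1 Et => [|[|t1]] T1 Et; case: t2 T2 Et => [|[|t2]] T2 Et //; lia.
Qed.

Lemma negative_unique f r l d j : irr f -> ords f r l d -> ordE f j ->
  secdeg s (- r) (- l) (- d) ^+ 2 <= (a * b * c)%N%:Z * j%:Z ^+ 2 ->
  exists2 h, unit_in h & f = h * xi.
Proof.
have [a0 b0 c0 m0 _] := pos_params s.
move=> If O [Vj _] le_d; have d0 := ords_ge0 O.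
have [_ nU _] := If.
have n0 : secdeg s (- r) (- l) (- d) != 0.
  by apply/eqP => E0; apply: nU; exact: ords_unit O E0.
have j0 : (0 < j)%N.
  rewrite lt0n; apply: contraNneq n0 => j0; move: le_d.
  by rewrite j0 expr0n mulr0 -sqrf_eq0 eq_le sqr_ge0 andbT.
have [i [h E]] : exists i h, f ^+ i = xi * h.
  apply: (sec_dvd xiP (ords_insec O) Vj).
  rewrite -(ltr_pXn2r (n := 2)) ?nnegrE ?mulr_ge0 //.
  apply: (le_lt_trans le_d); rewrite exprMn mulrC ltr_pM2l ?exprn_gt0 //.
  have H1 : (b * c < a * m * m)%N by rewrite pamm -addn1 leq_add2l.
  have : (a * (b * c) < a * (a * m * m))%N by rewrite ltn_pmul2l.
  by rewrite expr2; lia.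
have [X1 X2] := xi_coef.
apply: (irr_dvd_exp If xi_irr E); exists (vright s), (vtop s); split=> //=; lia.
Qed.

End NegativeCurveProperties.

(** * The Cox ring *)

Section Noetherian.

Definition is_ideal (R : comNzRingType) (J : R -> Prop) :=
  [/\ J 0, forall x y, J x -> J y -> J (x + y) & forall r x, J x -> J (r * x)].

Variant ideal_gen (R : comNzRingType) (s : seq R) (x : R) : Prop :=
  IdealGen of forall J, is_ideal J -> (forall y, y \in s -> J y) -> J x.

Lemma ideal_genP (R : comNzRingType) (s : seq R) x J :
  ideal_gen s x -> is_ideal J -> (forall y, y \in s -> J y) -> J x.
Proof. by case; exact. Qed.

Definition noetherian (R : comNzRingType) := forall J : R -> Prop, is_ideal J ->
  exists s, (forall x, x \in s -> J x) /\ forall x, J x -> ideal_gen s x.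

Lemma is_ideal_gen (R : comNzRingType) (s : seq R) : is_ideal (ideal_gen s).
Proof.
split=> [|x y Hx Hy|r x Hx]; split=> J IJ Hs; have [J0 JD JM] := IJ => //.
  by apply: JD; [exact: ideal_genP Hx _ _|exact: ideal_genP Hy _ _].
by apply: JM; exact: ideal_genP Hx _ _.
Qed.

Lemma mem_ideal_gen (R : comNzRingType) (s : seq R) x : x \in s -> ideal_gen s x.
Proof. by move=> xs; split=> J _; exact. Qed.

Lemma ideal_genW (R : comNzRingType) (s t : seq R) x :
  {subset s <= t} -> ideal_gen s x -> ideal_gen t x.
Proof.
by move=> st Hx; split=> J IJ Ht; apply: (ideal_genP Hx IJ) => y /st; exact: Ht.
Qed.

Lemma noetherian_field (F : fieldType) : noetherian F.
Proof.
move=> J [J0 JD JM]; have [[x [x0 Jx]]|H] := classic (exists x, x != 0 /\ J x).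
  exists [:: x]; split=> [y|y _]; first by rewrite inE => /eqP->.
  have [_ _ M] := is_ideal_gen [:: x].
  by have := M (y / x) x (mem_ideal_gen (mem_head _ _)); rewrite mulfVK.
exists [::]; split=> // y Jy; have [g0 _ _] := @is_ideal_gen F [::].
have [->//|y0] := eqVneq y 0.
by case: H; exists y.
Qed.

Lemma choose_seq (A B : eqType) (Q : A -> B -> Prop) (s : seq A) :
  (forall x, x \in s -> exists p, Q x p) ->
  exists ps : seq B, (forall x, x \in s -> exists2 p, p \in ps & Q x p) /\
    forall p, p \in ps -> exists2 x, x \in s & Q x p.
Proof.
elim: s => [|x s IH] H; first by exists [::].
have [|ps [H1 H2]] := IH; first by move=> y ys; apply: H; rewrite inE ys orbT.
have [p Qp] := H _ (mem_head x s).
exists (p :: ps); split=> [y|p']; rewrite inE => /orP[/eqP->|].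
- by exists p => //; exact: mem_head.
- by move=> /H1[p' Hp' Qp']; exists p' => //; rewrite inE Hp' orbT.
- by exists x => //; exact: mem_head.
- by move=> /H2[y ys Qy]; exists y => //; rewrite inE ys orbT.
Qed.

Variable R : comNzRingType.
Hypothesis noethR : noetherian R.
Variable J : {poly R} -> Prop.
Hypothesis idJ : is_ideal J.
Implicit Types (p q : {poly R}) (S : seq {poly R}).

Definition leading_gen S n := forall p, J p -> (size p <= n.+1)%N ->
  exists q, [/\ ideal_gen S q, (size q <= n.+1)%N & q`_n = p`_n].

(* Leading coefficients of the elements of J, in the degrees satisfying P. *)
Lemma leading_gen_exists (P : nat -> Prop) (n0 : nat) :
  P n0 -> (forall m n, P m -> P n -> P (maxn m n)) ->
  exists S d, (forall p, p \in S -> J p) /\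
    forall n, P n -> (forall m, P m -> m <= d -> m <= n)%N -> leading_gen S n.
Proof.
move=> Pn0 Pmax; have [J0 JD JM] := idJ.
pose Q (r : R) (pn : {poly R} * nat) :=
  [/\ P pn.2, J pn.1, (size pn.1 <= pn.2.+1)%N & pn.1`_(pn.2) = r].
have lift p n n' : (size p <= n.+1)%N -> (n <= n')%N ->
    (size ('X^(n' - n) * p)%R <= n'.+1)%N /\ ('X^(n' - n) * p)`_n' = p`_n.
  move=> sp le; split; last by rewrite coefXnM ltnNge leq_subr /= subKn.
  apply: leq_trans (size_polyMleq _ _) _; rewrite size_polyXn addSn /=.
  by apply: leq_trans (leq_add (leqnn _) sp) _; rewrite addnS subnK.
have idL : is_ideal (fun r => exists pn, Q r pn).
  split.
  - by exists (0, n0); split=> //=; rewrite ?size_poly0 ?coef0.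
  - move=> x y [[p n] [/= Pn Jp sp <-]] [[p' n'] [/= Pn' Jp' sp' <-]].
    have [s1 c1] := lift _ _ _ sp (leq_maxl n n').
    have [s2 c2] := lift _ _ _ sp' (leq_maxr n n').
    exists ('X^(maxn n n' - n) * p + 'X^(maxn n n' - n') * p', maxn n n').
    split=> /=; [exact: Pmax| |by rewrite (leq_trans (size_polyD _ _)) // geq_max s1|
      by rewrite coefD c1 c2].
    by apply: JD; exact: JM.
  - move=> r x [[p n] [/= Pn Jp sp <-]]; exists (r%:P * p, n); split=> //=.
    + exact: JM.
    + by rewrite mul_polyC (leq_trans (size_scale_leq _ _)).
    + by rewrite coefCM.
have [s [Hs1 Hs2]] := noethR idL.
have [ps [H1 H2]] := choose_seq Hs1.
exists (map fst ps), (\max_(pn <- ps) pn.2)%N; split.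
  by move=> _ /mapP[pn /H2[x _ [_ Jp _ _]] ->].
move=> n Pn Hn p Jp sp.
pose I (r : R) := exists q,
  [/\ ideal_gen (map fst ps) q, (size q <= n.+1)%N & q`_n = r].
have [g0 gD gM] := is_ideal_gen (map fst ps).
have idI : is_ideal I.
  split.
  - by exists 0; rewrite size_poly0 coef0.
  - move=> x y [q [g1 s1 <-]] [q' [g2 s2 <-]]; exists (q + q'); split.
    + exact: gD.
    + by rewrite (leq_trans (size_polyD _ _)) // geq_max s1.
    + by rewrite coefD.
  - move=> r x [q [g1 s1 <-]]; exists (r%:P * q); split.
    + exact: gM.
    + by rewrite mul_polyC (leq_trans (size_scale_leq _ _)).
    + by rewrite coefCM.
apply: (@ideal_genP _ s _ I); [by apply: Hs2; exists (p, n)|exact: idI|].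
move=> r /H1[[q nq] qps [/= Pq Jq sq <-]].
have le : (nq <= n)%N.
  by apply: Hn => //; exact: (@leq_bigmax_seq _ _ xpredT (fun x => x.2) (q, nq)).
have [s1 c1] := lift _ _ _ sq le; exists ('X^(n - nq) * q); split=> //.
by apply/gM/mem_ideal_gen/mapP; exists (q, nq).
Qed.

Lemma leading_genW S S' n : {subset S <= S'} -> leading_gen S n -> leading_gen S' n.
Proof.
move=> sub H p Jp sp; have [q [g1 s1 E]] := H p Jp sp.
by exists q; split=> //; exact: ideal_genW g1.
Qed.

Lemma hilbert_basis_ideal : exists s, (forall x, x \in s -> J x) /\
  forall x, J x -> ideal_gen s x.
Proof.
have [S1 [d [JS1 HS1]]] := @leading_gen_exists (fun=> True) 0 I (fun _ _ _ _ => I).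
have [S2 [JS2 HS2]] : exists S, (forall p, p \in S -> J p) /\
    forall n, (n < d)%N -> leading_gen S n.
  elim: d {HS1} => [|d [S [JS HS]]]; first by exists [::].
  have max_d m n : d = m -> d = n -> d = maxn m n by move=> <- <-; rewrite maxnn.
  have [S' [d' [JS' HS']]] := leading_gen_exists (erefl d) max_d.
  exists (S' ++ S); split=> [p|n].
    by rewrite mem_cat => /orP[/JS'|/JS].
  rewrite ltnS leq_eqVlt => /orP[/eqP->|lt].
    apply: (@leading_genW S'); first by move=> x xs; rewrite mem_cat xs.
    by apply: HS' => // m <-.
  apply: (leading_genW _ (HS _ lt)); first by move=> x xs; rewrite mem_cat xs orbT.
exists (S1 ++ S2).
have JS p : p \in S1 ++ S2 -> J p by rewrite mem_cat => /orP[/JS1|/JS2].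
have [J0 JD JM] := idJ; have [g0 gD gM] := is_ideal_gen (S1 ++ S2).
split=> // p; have [n Hn] := ubnP (size p); elim: n p Hn => [//|[|n] IH] p Hn Jp.
  by have /size_poly_leq0P -> : (size p <= 0)%N by [].
have lead_n : leading_gen (S1 ++ S2) n.
  have [le|lt] := leqP d n; last first.
    by apply: leading_genW (HS2 _ lt) => x xs; rewrite mem_cat xs orbT.
  apply: (@leading_genW S1); first by move=> x xs; rewrite mem_cat xs.
  by apply: HS1 => // m _ md; exact: leq_trans le.
have [q [gq sq Eq]] := lead_n p Jp Hn.
have -> : p = (p + (-1) * q) + q by rewrite mulN1r subrK.
apply: gD => //; apply: IH; last by apply: JD => //; apply/JM/(ideal_genP gq).
rewrite mulN1r ltnS; apply/leq_sizeP => j; rewrite leq_eqVlt => /orP[/eqP <-|lt].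
  by rewrite coefB Eq subrr.
by rewrite coefB (nth_default _ (leq_trans (Hn : (size p <= n.+1)%N) lt)) (nth_default _ (leq_trans sq lt)) subrr.
Qed.

End Noetherian.

Lemma hilbert_basis (R : comNzRingType) : noetherian R -> noetherian {poly R}.
Proof. by move=> H J idJ; exact: hilbert_basis_ideal. Qed.

Import (canonicals) mpoly.

Section FiniteGeneration.
Variables (k : fieldType) (C : comNzRingType) (cc : {rmorphism k -> C}).
Implicit Types (x y z : C) (gs ys : seq C).

Inductive alg_gen gs : C -> Prop :=
| alg_gen_const c : alg_gen gs (cc c)
| alg_gen_mem x : x \in gs -> alg_gen gs x
| alg_genD x y : alg_gen gs x -> alg_gen gs y -> alg_gen gs (x + y)
| alg_genM x y : alg_gen gs x -> alg_gen gs y -> alg_gen gs (x * y).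

Lemma alg_gen0 gs : alg_gen gs 0.
Proof. by rewrite -(rmorph0 cc); exact: alg_gen_const. Qed.

Lemma alg_gen1 gs : alg_gen gs 1.
Proof. by rewrite -(rmorph1 cc); exact: alg_gen_const. Qed.

Lemma alg_genX gs x i : alg_gen gs x -> alg_gen gs (x ^+ i).
Proof.
move=> Hx; elim: i => [|i IH]; first by rewrite expr0; exact: alg_gen1.
by rewrite exprS; exact: alg_genM.
Qed.

Lemma alg_genW gs ys x : {subset gs <= ys} -> alg_gen gs x -> alg_gen ys x.
Proof.
move=> sub; elim=> [c|y /sub ys_y|y z _ Hy _ Hz|y z _ Hy _ Hz];
  by [exact: alg_gen_const|exact: alg_gen_mem|exact: alg_genD|exact: alg_genM].
Qed.

Lemma noetherian_cover ys : exists (R : comNzRingType) (phi : {rmorphism R -> C}),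
  [/\ noetherian R, forall x, alg_gen ys x -> exists r, phi r = x
    & forall r, alg_gen ys (phi r)].
Proof.
elim: ys => [|y ys [R [phi [noethR surj gen]]]].
  exists k, cc; split=> [|x|c]; [exact: noetherian_field| |exact: alg_gen_const].
  elim=> [c|//|_ _ _ [r <-] _ [r' <-]|_ _ _ [r <-] _ [r' <-]].
  - by exists c.
  - by exists (r + r'); rewrite rmorphD.
  - by exists (r * r'); rewrite rmorphM.
pose psi : {rmorphism {poly R} -> C} := horner_eval y \o map_poly phi.
have psiC r : psi r%:P = phi r by rewrite /psi /= map_polyC /= horner_evalE hornerC.
have psiX : psi 'X = y by rewrite /psi /= map_polyX horner_evalE hornerX.
exists {poly R}, psi; split=> [|x|p]; first exact: hilbert_basis.
- elim=> [c|z|_ _ _ [r <-] _ [r' <-]|_ _ _ [r <-] _ [r' <-]].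
  + by have [r Er] := surj _ (alg_gen_const ys c); exists r%:P; rewrite psiC.
  + rewrite inE => /orP[/eqP->|zs]; first by exists 'X.
    by have [r Er] := surj _ (alg_gen_mem zs); exists r%:P; rewrite psiC.
  + by exists (r + r'); rewrite rmorphD.
  + by exists (r * r'); rewrite rmorphM.
- elim/poly_ind: p => [|p c IH]; first by rewrite rmorph0; exact: alg_gen0.
  rewrite rmorphD rmorphM psiC psiX; apply: alg_genD.
    by apply: alg_genM => //; apply/alg_gen_mem/mem_head.
  by apply: alg_genW (gen c) => z zs; rewrite inE zs orbT.
Qed.

Variable A : C -> Prop.
Hypotheses (A0 : A 0) (A_const : forall c, A (cc c))
  (AD : forall x y, A x -> A y -> A (x + y)) (AM : forall x y, A x -> A y -> A (x * y)).

Lemma alg_gen_sub ys x : (forall y, y \in ys -> A y) -> alg_gen ys x -> A x.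
Proof.
by move=> sub; elim=> [c|y /sub|y z _ Hy _ Hz|y z _ Hy _ Hz] //; [exact: AD|exact: AM].
Qed.

(* The elements r with z r in A form an ideal of a Noetherian ring. *)
Lemma shifted_generators ys z : (forall y, y \in ys -> A y) ->
  exists gs, (forall g, g \in gs -> A g) /\
    forall x, alg_gen ys x -> A (z * x) -> alg_gen (ys ++ gs) (z * x).
Proof.
move=> ysA; have [R [phi [noethR surj gen]]] := noetherian_cover ys.
have [|s [Hs1 Hs2]] := noethR (fun r => A (z * phi r)).
  split=> [|r r' Hr Hr'|r r' Hr]; first by rewrite rmorph0 mulr0.
    by rewrite rmorphD mulrDr; exact: AD.
  by rewrite rmorphM mulrCA; apply: AM => //; exact: alg_gen_sub (gen r).
exists [seq z * phi r | r <- s]; split; first by move=> _ /mapP[r /Hs1 Hr ->].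
move=> x /surj[r <-] /Hs2 Hr.
apply: (@ideal_genP _ s r (fun r => alg_gen (ys ++ [seq z * phi r | r <- s]) (z * phi r))).
- exact: Hr.
- split=> [|t t' Ht Ht'|t t' Ht]; first by rewrite rmorph0 mulr0; exact: alg_gen0.
    by rewrite rmorphD mulrDr; exact: alg_genD.
  rewrite rmorphM mulrCA; apply: alg_genM => //.
  by apply: alg_genW (gen t) => w ws; rewrite mem_cat ws.
move=> t ts; apply: alg_gen_mem; rewrite mem_cat; apply/orP; right.
by apply/mapP; exists t.
Qed.

Lemma shifted_generators_upto ys (z : nat -> C) n : (forall y, y \in ys -> A y) ->
  exists gs, (forall g, g \in gs -> A g) /\
    forall i x, (i < n)%N -> alg_gen ys x -> A (z i * x) -> alg_gen (ys ++ gs) (z i * x).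
Proof.
move=> ysA; elim: n => [|n [gs [Hgs IH]]]; first by exists [::].
have [gs' [Hgs' H]] := shifted_generators (z n) ysA.
exists (gs ++ gs'); split=> [g|i x].
  by rewrite mem_cat => /orP[/Hgs|/Hgs'].
rewrite ltnS leq_eqVlt => /orP[/eqP->|lt] Hx Ax.
  by apply: alg_genW (H _ Hx Ax) => w; rewrite !mem_cat => /orP[]->; rewrite ?orbT.
by apply: alg_genW (IH _ _ lt Hx Ax) => w; rewrite !mem_cat => /orP[]->; rewrite ?orbT.
Qed.

Lemma alg_gen_mmap gs x : alg_gen gs x -> exists p : mpoly.mpoly (size gs) k,
  x = mpoly.mmap cc (fun i => gs`_i) p.
Proof.
elim=> [c|y ys|_ _ _ [p ->] _ [p' ->]|_ _ _ [p ->] _ [p' ->]].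
- by exists (mpoly.mpolyC _ c); rewrite mpoly.mmapC.
- have Hi : (index y gs < size gs)%N by rewrite index_mem.
  by exists (mpoly.mpolyX _ (mpoly.mnm1 (Ordinal Hi))); rewrite mpoly.mmapX mpoly.mmap1U /= nth_index.
- by exists (p + p'); rewrite mpoly.mmapD.
- by exists (p * p'); rewrite rmorphM.
Qed.

End FiniteGeneration.

Section CoxRing.
Variables (k : closedFieldType) (L : laurentRing k).
Variable s : nat.
Local Notation lgmono := (@lgmono k L).
Local Notation lmono := (@lmono k L).
Local Notation lcoef := (@lcoef k L).
Local Notation N := (pN s).
Local Notation M := (pM s).
Local Notation q := (pq s).
Local Notation b := (pb s).
Local Notation a := (pa s).
Local Notation c := (pc s).
Local Notation uR := (rayR s).
Local Notation uL := (rayL s).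
Local Notation uB := rayB.
Local Notation insec := (@insec k L s).
Local Notation B := (bcurve L s).
Implicit Types (f g h : L) (r l d e j : int).

Variable xi : L.
Hypothesis xiP : xi_spec s xi.

(* An abstract copy of the ambient ring of the Cox ring, for the same reason as
   laurentRing. *)
Variables (C : comNzRingType) (gm : L -> int * int -> C) (cf : C -> int * int -> L).
Variable cc : {rmorphism k -> C}.
Hypothesis gmM : forall f g v w, gm f v * gm g w = gm (f * g) (v + w).
Hypothesis gmD : forall f g v, gm (f + g) v = gm f v + gm g v.
Hypothesis gm1 : gm 1 0 = 1.
Hypothesis cfD : forall x y v, cf (x + y) v = cf x v + cf y v.
Hypothesis cf_gm : forall f v w, cf (gm f v) w = f *+ (v == w).
Hypothesis cox_ind : forall (P : C -> Prop) x, P 0 ->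
  (forall y z, P y -> P z -> P (y + z)) -> (forall v, P (gm (cf x v) v)) -> P x.
Hypothesis ccE : forall t, cc t = gm (lconst L t) 0.

Definition sec d j f := insec (d * N%:Z) (- d) 0 f /\
  forall i : nat, i%:Z = j -> vanishes f i.

Definition cox x := forall d j, sec d j (cf x (d, j)).

Lemma sec0 d j : sec d j 0.
Proof. by split=> [|i _]; [exact: inL0|exact: vanishes0n]. Qed.

Lemma secD d j f g : sec d j f -> sec d j g -> sec d j (f + g).
Proof.
by case=> H1 V1 [H2 V2]; split=> [|i Ei]; [exact: inLD|apply: vanishesD; [exact: V1|exact: V2]].
Qed.

Lemma secM d j d' j' f g : sec d j f -> sec d' j' g -> sec (d + d') (j + j') (f * g).
Proof.
case=> H1 V1 [H2 V2]; split=> [|i Ei].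
  by have := inLM H1 H2; rewrite mulrDl opprD addr0.
case: j V1 Ei => [j|j] V1 Ei; last first.
  apply: vanishesMl; case: j' V2 Ei => [j'|j'] V2 Ei; last by lia.
  by apply: vanishesW (V2 j' erefl); lia.
case: j' V2 Ei => [j'|j'] V2 Ei.
  have -> : i = (j + j')%N by lia.
  by apply: vanishesM; [exact: V1|exact: V2].
by rewrite mulrC; apply: vanishesMl; apply: vanishesW (V1 j erefl); lia.
Qed.

Lemma gm0 v : gm 0 v = 0.
Proof. by have /eqP := gmD 0 0 v; rewrite addr0 -subr_eq0 opprD addNKr oppr_eq0 => /eqP. Qed.

Lemma cf0 v : cf 0 v = 0.
Proof. by rewrite -(gm0 0) cf_gm mul0rn. Qed.

Lemma cox0 : cox 0.
Proof. by move=> d j; rewrite cf0; exact: sec0. Qed.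

Lemma coxD x y : cox x -> cox y -> cox (x + y).
Proof. by move=> Hx Hy d j; rewrite cfD; exact: secD. Qed.

Lemma cox_gm d j f : sec d j f -> cox (gm f (d, j)).
Proof.
move=> Hf d' j'; rewrite cf_gm; case: eqP => [[<- <-]|_]; first by rewrite mulr1n.
by rewrite mulr0n; exact: sec0.
Qed.

Lemma coxM x y : cox x -> cox y -> cox (x * y).
Proof.
move=> Hx Hy; apply: (@cox_ind (fun x => cox (x * y))).
- by rewrite mul0r; exact: cox0.
- by move=> ? ? ? ?; rewrite mulrDl; exact: coxD.
move=> [d j]; apply: (@cox_ind (fun y => cox (_ * y))).
- by rewrite mulr0; exact: cox0.
- by move=> ? ? ? ?; rewrite mulrDr; exact: coxD.
by move=> [d' j']; rewrite gmM; apply/cox_gm/secM; [exact: Hx|exact: Hy].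
Qed.

Lemma cox_const t : cox (cc t).
Proof.
rewrite ccE; apply: (@cox_gm 0 0); split=> [|i [->]]; last exact: vanishes_ge0.
by rewrite lconstE mul0r oppr0; split; apply: ge_gmono; rewrite pairing0r oppr0.
Qed.

(* The class of r D_R + l D_L + d D_B is e (N D_R - D_L) with
   e = secdeg s r l d, up to the divisor of the monomial tau r l d. *)
Definition tau r l d : lattice := (r + N%:Z * l + (N * M)%N%:Z * d, d).
Definition section r l d j f := gm (lmono (tau r l d) * f) (secdeg s r l d, j).

Lemma aN1 : (a * N = b.+1)%N.
Proof. by have := paK s; have := pbE s; move=> -> ->. Qed.

Lemma tauD r l d r' l' d' : tau (r + r') (l + l') (d + d') = tau r l d + tau r' l' d'.
Proof. by apply: lattice_eq; rewrite /=; ring. Qed.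

Lemma pairing_tau r l d (e := secdeg s r l d) :
  [/\ pairing uR (tau r l d) = r - e * N%:Z, pairing uL (tau r l d) = l + e
    & pairing uB (tau r l d) = d].
Proof.
have E1 : (a * N = b + 1)%N by rewrite aN1 addn1.
have E2 : (c * N + N * N = b * (N * M))%N.
  have := congr1 (muln^~ N) (pcE s); have := congr1 (muln (N * N)) E1.
  by have := pqE s; move=> ->; nia.
have E3 : (a * (N * M) + 0 = q + c)%N.
  have := pcE' s; have := paq s; lia.
rewrite /e /secdeg /pairing /tau /=; split; last by ring.
- have /(congr1 (fun x : nat => x%:Z * r)) := E1; have /(congr1 (fun x : nat => x%:Z * l * b%:Z)) := E1.
  by have /(congr1 (fun x : nat => x%:Z * d)) := E2; lia.
- have /(congr1 (fun x : nat => x%:Z * l)) := E1.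
  by have /(congr1 (fun x : nat => x%:Z * d)) := E3; lia.
Qed.

Lemma tau_pairing v : tau (pairing uR v) (pairing uL v) (pairing uB v) = v.
Proof.
have E1 : (a * N = b + 1)%N by rewrite aN1 addn1.
have E2 : (q * N = N * N + N * M)%N by rewrite pqE; ring.
case: v => v1 v2; apply: lattice_eq; rewrite /tau /pairing /=; last by ring.
have /(congr1 (fun x : nat => x%:Z * v1)) := E1.
by have /(congr1 (fun x : nat => x%:Z * v2)) := E2; lia.
Qed.

Lemma cox_section r l d j f : insec r l d f -> (forall i : nat, i%:Z = j -> vanishes f i) ->
  cox (section r l d j f).
Proof.
have [P1 P2 P3] := pairing_tau r l d.
case=> H1 H2 H3 V; apply: cox_gm; split=> [|i Ei]; last by rewrite vanishes_lmono; exact: V.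
have G u : ge u (pairing u (tau r l d)) (lmono (tau r l d)) by exact: ge_lmono.
split; first by apply: (geW _ (geM (G uR) H1)); rewrite P1; lia.
  by apply: (geW _ (geM (G uL) H2)); rewrite P2; lia.
by apply: (geW _ (geM (G uB) H3)); rewrite P3; lia.
Qed.

Lemma sectionM r l d j f r' l' d' j' g :
  section r l d j f * section r' l' d' j' g =
  section (r + r') (l + l') (d + d') (j + j') (f * g).
Proof.
rewrite /section gmM tauD lmonoD; congr (gm _ _); first by ring.
by congr pair; rewrite /= /secdeg; ring.
Qed.

Lemma sectionD r l d j f g : section r l d j (f + g) = section r l d j f + section r l d j g.
Proof. by rewrite /section mulrDr gmD. Qed.

Lemma section0 r l d j : section r l d j 0 = 0.
Proof. by rewrite /section mulr0 gm0. Qed.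

Lemma section1 : section 0 0 0 0 1 = 1.
Proof.
rewrite /section mulr1 -[RHS]gm1 /tau /secdeg !mulr0 !addr0.
by rewrite -[(0, 0) : lattice]/(0 : lattice) lmono0.
Qed.

Lemma sectionX r l d j f i :
  section r l d j f ^+ i = section (r *+ i) (l *+ i) (d *+ i) (j *+ i) (f ^+ i).
Proof.
elim: i => [|i IH]; first by rewrite !mulr0n !expr0 section1.
by rewrite !exprS IH sectionM -!mulrS.
Qed.

Lemma section_const t r l d j f :
  cc t * section r l d j f = section r l d j (lconst L t * f).
Proof. by rewrite ccE gmM add0r mulrCA. Qed.

Lemma section_std d j f : section (d * N%:Z) (- d) 0 j f = gm f (d, j).
Proof.
rewrite /section; have -> : tau (d * N%:Z) (- d) 0 = 0.
  by apply: lattice_eq; rewrite /=; ring.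
rewrite lmono0 mul1r; congr (gm _ (_, _)); rewrite /secdeg.
have /(congr1 (fun x : nat => x%:Z * d)) := aN1; rewrite PoszM; lia.
Qed.

Definition cox_gens : seq C :=
  [:: section 1 0 0 0 1; section 0 1 0 0 1; section 0 0 1 0 1;
      section (rF s) (lF s) 0 (mu s)%:Z (xi ^+ N); section (eB s)%:Z 0 0 (mu s)%:Z B].

Lemma cox_gens_cox y : y \in cox_gens -> cox y.
Proof.
have one r l d : 0 <= r -> 0 <= l -> 0 <= d -> cox (section r l d 0 1).
  move=> r0 l0 d0; apply: cox_section; last by move=> i [->]; exact: vanishes_ge0.
  by split; apply: ge1; rewrite oppr_le0.
rewrite !inE => /or4P[/eqP->|/eqP->|/eqP->|/orP[]/eqP->]; try exact: one.
- by apply: cox_section; [exact: curve_F_in|move=> i [->]; exact: curve_F_van].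
- apply: cox_section; last by move=> i [->]; exact: bcurve_van.
  have [H1 H2 H3] := bcurve_in L s; rewrite -[B](subrK 1).
  split; apply: geD => //; [apply: ge1| |apply: ge1|apply: ge1]; rewrite ?oppr0 ?oppr_le0 //.
  by apply: geW H2.
Qed.

Lemma alg_gen_section r l d f : insec r l d f -> alg_gen cc cox_gens (section r l d 0 f).
Proof.
case=> H1 H2 H3; apply: (@laurent_sum_ind _ L (fun f => alg_gen cc cox_gens (section r l d 0 f))).
- by rewrite section0; exact: alg_gen0.
- by move=> f1 f2 Hf1 Hf2; rewrite sectionD; exact: alg_genD.
move=> v fv; have h1 := H1 _ fv; have h2 := H2 _ fv; have h3 := H3 _ fv.
set t := lcoef f v.
pose i1 := absz (r + pairing uR v); pose i2 := absz (l + pairing uL v).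
pose i3 := absz (d + pairing uB v).
have E1 : i1%:Z = r + pairing uR v by rewrite /i1; lia.
have E2 : i2%:Z = l + pairing uL v by rewrite /i2; lia.
have E3 : i3%:Z = d + pairing uB v by rewrite /i3; lia.
have -> : section r l d 0 (lgmono t v) = cc t * (section 1 0 0 0 1 ^+ i1 *
    section 0 1 0 0 1 ^+ i2 * section 0 0 1 0 1 ^+ i3).
  rewrite !sectionX !sectionM section_const !mul0rn !add0r !addr0 !expr1n !mulr1 !natz.
  rewrite E1 E2 E3 /section lgmonoE tauD tau_pairing lmonoD; congr (gm _ (_, _)); first by ring.
  by have := ray_relation s v; rewrite /secdeg; lia.
apply: alg_genM; first exact: alg_gen_const.
by apply: alg_genM; [apply: alg_genM|]; apply/alg_genX/alg_gen_mem; rewrite !inE eqxx ?orbT.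
Qed.

Lemma alg_gen_secpow i r l d f : secpow s xi i r l d f ->
  alg_gen cc cox_gens (section r l d (mu s * i)%N%:Z f).
Proof.
elim: i r f => [|i IH] r f; first by rewrite muln0; exact: alg_gen_section.
case=> g [h [/alg_gen_section Hg /IH Hh ->]]; rewrite sectionD; apply: alg_genD.
  have -> : section r l d (mu s * i.+1)%N%:Z ((xi ^+ N) ^+ i.+1 * g) =
      section (rF s) (lF s) 0 (mu s)%:Z (xi ^+ N) ^+ i.+1 *
      section (r - rF s *+ i.+1) (l - lF s *+ i.+1) (d - 0 *+ i.+1) 0 g.
    rewrite sectionX sectionM !mul0rn; congr (section _ _ _ _ _); ring.
  by apply: alg_genM => //; apply/alg_genX/alg_gen_mem; rewrite !inE eqxx !orbT.
have -> : section r l d (mu s * i.+1)%N%:Z ((1 + (B - 1)) * h) =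
    section (eB s)%:Z 0 0 (mu s)%:Z B * section (r - (eB s)%:Z) l d (mu s * i)%N%:Z h.
  by rewrite sectionM addrC subrK; congr (section _ _ _ _ _); ring.
by apply: alg_genM => //; apply: alg_gen_mem; rewrite !inE eqxx !orbT.
Qed.

(* A section vanishing to order j >= mu lies in the image of cox_gens, except
   for a defect less than 2 mu in the E-degree, which is handled by the Hilbert
   basis theorem. *)
Lemma cox_finite : exists gs : seq C, (forall y, y \in gs -> cox y) /\
  forall x, cox x -> alg_gen cc gs x.
Proof.
have [_ _ _ m0 _] := pos_params s.
have mu0 : (0 < mu s)%N by rewrite muln_gt0 m0.
pose z (i : nat) := section 0 0 0 i%:Z 1.
have [gs [Hgs gsP]] := shifted_generators_upto cox0 cox_const coxD coxM z (mu s + mu s)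
  cox_gens_cox.
pose t := section 0 0 0 (-1) 1.
have t_cox : cox t.
  by apply: cox_section => [|i //]; split; apply: ge1; rewrite oppr0.
have zE i r l d j f : z i * section r l d j f = section r l d (i%:Z + j) f.
  by rewrite sectionM !add0r mul1r.
exists (t :: (cox_gens ++ gs)); split=> [y|x xA].
  by rewrite inE mem_cat => /or3P[/eqP->//|/cox_gens_cox|/Hgs].
apply: cox_ind; [exact: alg_gen0|by move=> *; exact: alg_genD|].
move=> [d j]; have [] := xA d j; move: (cf x (d, j)) => f Hf Vf.
rewrite -section_std; case: j Vf => [j|j] Vf.
  have Vj := Vf j erefl.
  have Aj : cox (section (d * N%:Z) (- d) 0 j f) by exact: cox_section.
  suff [i [j' [lt_i Ej Gj']]] : exists i j' : nat, [/\ (i < mu s + mu s)%N, j = (i + j')%N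
      & alg_gen cc cox_gens (section (d * N%:Z) (- d) 0 j' f)].
    move: Aj; rewrite Ej PoszD -zE => Aj.
    by apply: alg_genW (gsP _ _ lt_i Gj' Aj) => y ys; rewrite inE ys orbT.
  have [lt|le] := ltnP j (mu s).
    exists j, 0%N; split; [exact: ltn_addl|by rewrite addn0|exact: alg_gen_section].
  have dj := divn_eq j (mu s); have lt := ltn_pmod j mu0.
  have : (0 < j %/ mu s)%N by rewrite divn_gt0.
  case: (j %/ mu s)%N dj => [//|i] dj _.
  exists (mu s + j %% mu s)%N, (mu s * i)%N; split; first by rewrite ltn_add2l.
    by rewrite {1}dj; ring.
  apply/alg_gen_secpow/sec_idealpow => //; apply: vanishesW Vj.
  by rewrite dj mulnC leq_addr.
have -> : section (d * N%:Z) (- d) 0 (Negz j) f = t ^+ j.+1 * section (d * N%:Z) (- d) 0 0 f.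
  rewrite sectionX sectionM !mul0rn !add0r addr0 expr1n mul1r NegzE; congr (section _ _ _ _ _).
  by rewrite mulrn_int; lia.
apply: alg_genM; first by apply/alg_genX/alg_gen_mem/mem_head.
by apply: alg_genW (alg_gen_section Hf) => y ys; rewrite inE mem_cat ys orbT.
Qed.

End CoxRing.

(** * The triangle *)

Section LatticeCount.

Lemma floor_reflection (n q r : nat) : coprime n q -> (0 < r < q)%N ->
  (n * r %/ q + n * (q - r) %/ q = n.-1)%N.
Proof.
move=> cop /andP[r0 rq]; have q0 : (0 < q)%N by exact: leq_trans rq.
have y0 : (0 < n * r %% q)%N.
  rewrite lt0n; apply/negP => dv; have : (q %| n * r)%N by [].
  by rewrite Gauss_dvdr 1?coprime_sym // gtnNdvd.
have n0 : (0 < n)%N by case: n y0 {cop} => [|//]; rewrite mul0n mod0n.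
have E := divn_eq (n * r) q; have y1 := ltn_pmod (n * r) q0.
set x := (n * r %/ q)%N in E *; set y := (n * r %% q)%N in E y0 y1.
have lt_x : (x < n)%N by rewrite /x ltn_divLR // ltn_pmul2l.
have -> : (n * (q - r) = (n.-1 - x) * q + (q - y))%N.
  rewrite mulnBr E mulnBl; have : (x.+1 * q <= n * q)%N by rewrite leq_pmul2r.
  by have : (n.-1 * q + q = n * q)%N by [rewrite -mulSnr prednK]; lia.
rewrite divnMDl // divn_small ?addn0 ?subnKC //; first by lia.
by rewrite ltn_subrL y0.
Qed.

Lemma sum_floor_period (n q : nat) : coprime n q -> (0 < q)%N ->
  (2 * \sum_(i < q) (n * i %/ q) = q.-1 * n.-1)%N.
Proof.
case: q => // q cop _; rewrite big_ord_recl muln0 div0n add0n /= mul2n -addnn.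
rewrite {2}(reindex_inj rev_ord_inj) -big_split /=.
rewrite (eq_bigr (fun=> n.-1)) ?sum_nat_const ?card_ord // => i _.
have lt_i := ltn_ord i; rewrite /bump /= !add1n.
have -> : (q - i.+1).+1 = (q.+1 - i.+1)%N by lia.
by apply: floor_reflection => //; lia.
Qed.

Lemma sum_floor (n q t : nat) : coprime n q -> (0 < q)%N ->
  (2 * \sum_(i < t * q) (n * i %/ q) + q * n * t = q * n * (t * t) + t * (q.-1 * n.-1))%N.
Proof.
move=> cop q0; elim: t => [|t IH]; first by rewrite big_ord0; lia.
have -> : (\sum_(i < t.+1 * q) (n * i %/ q) =
    \sum_(i < q) (n * i %/ q) + (t * q * n + \sum_(i < t * q) (n * i %/ q)))%N.
  rewrite mulSn big_split_ord /=; congr addn.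
  have -> : (t * q * n = \sum_(i < t * q) n)%N by rewrite sum_nat_const card_ord.
  rewrite -big_split; apply: eq_bigr => i _ /=.
  by rewrite mulnDr divnMDl.
have := sum_floor_period cop q0; move: IH; lia.
Qed.

Variable s : nat.
Local Notation N := (pN s).
Local Notation n := (pn s).
Local Notation K := (pK s).
Local Notation M := (pM s).
Local Notation q := (pq s).
Local Notation b := (pb s).
Local Notation m := (pm s).
Local Notation a := (pa s).
Local Notation c := (pc s).
Local Notation uR := (rayR s).
Local Notation uL := (rayL s).
Local Notation uB := rayB.

Definition in_delta (v : lattice) :=
  [&& - ((b * M * N)%N%:Z - b%:Z) <= pairing uR v, - n%:Z <= pairing uL v & 0 <= pairing uB v].

(* The column of abscissa i - 1 of the triangle is [low i, high i). *)
Definition high i := (i + n * i %/ q)%N.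
Definition low i := (K * (i - M * N) - (i - M * N) %/ (N * N))%N.
Definition delta_points : seq lattice :=
  [seq (i%:Z - 1, t%:Z) | i <- iota 0 (N * q).+1, t <- iota (low i) (high i - low i)].

Lemma q_gt0 : (0 < q)%N. Proof. by have [] := pos_params s. Qed.

Lemma lowE i t : (i <= N * q)%N -> (low i <= t)%N = (b * (i - M * N) <= N * N * t)%N.
Proof.
move=> le_i; have N20 : (0 < N * N)%N by rewrite muln_gt0.
have Eq := pqE s; have Eb := bN2 s; rewrite /low.
have : (i - M * N <= N * N)%N by move: le_i; rewrite Eq; lia.
move: (i - M * N)%N => j; rewrite leq_eqVlt => /orP[/eqP ->|lt_j].
  rewrite divnn N20 -[X in (X - 1 <= _)%N]Eb subn1 /= mulnC leq_pmul2l //.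
rewrite (divn_small lt_j) subn0.
have -> : (K * j <= t)%N = (N * N * (K * j) <= N * N * t)%N by rewrite leq_pmul2l.
have E : (N * N * (K * j) = b * j + j)%N by rewrite mulnA [(N * N * K)%N]mulnC -Eb mulSn addnC.
rewrite E; apply/idP/idP => [|H]; first exact: leq_trans (leq_addr _ _).
have [le|lt] := leqP (K * j) t; first by rewrite -E leq_pmul2l.
have : (N * N * t + N * N <= N * N * (K * j))%N by rewrite -mulnSr leq_pmul2l.
by rewrite E; lia.
Qed.

Lemma low_high i : (i <= N * q)%N -> (low i <= high i)%N.
Proof.
move=> le_i; have Eq := pqE s; have Ea := paq s; have EK := paK s.
set j := (i - M * N)%N; have le_K : (low i <= K * j)%N by exact: leq_subr.
apply: leq_trans le_K _; rewrite /high -leq_subLR leq_divRL ?q_gt0 // mulnBl leq_subLR.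
rewrite [(i * q)%N]mulnC -mulnDl.
rewrite -Ea EK -!mulnA leq_mul2l /=.
have [lt|le] := leqP (M * N) i; last first.
  by have -> : j = 0%N by rewrite /j; apply/eqP; rewrite subn_eq0 ltnW.
have -> : i = (M * N + j)%N by rewrite subnKC.
have lej : (j <= N * N)%N by rewrite /j leq_subLR; move: le_i; rewrite Eq; lia.
have : (M * j <= M * (N * N))%N by rewrite leq_mul2l lej orbT.
by rewrite Eq; lia.
Qed.

Lemma column_le i t : (N * N)%N%:Z * t%:Z >= b%:Z * (i%:Z - (M * N)%N%:Z) ->
  (q * t.+1 <= a * i)%N -> (i <= N * q)%N.
Proof.
move=> H1 H2; rewrite leqNgt; apply/negP => lt_i.
have [_ _ c0 _ _] := pos_params s; have E1 := pcE s; have E2 := pcE' s.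
have E3 := paq s; have E4 := pqE s.
have H3 : q%:Z * ((N * N)%N%:Z * t%:Z) >= q%:Z * (b%:Z * (i%:Z - (M * N)%N%:Z)).
  by rewrite ler_wpM2l.
have H4 : (N * N * (q * t.+1) <= N * N * (a * i))%N by rewrite leq_mul2l H2 orbT.
have H5 : (c * (N * q).+1 <= c * i)%N by rewrite leq_mul2l lt_i orbT.
have E5 := congr1 (muln^~ i) E1; have E6 := congr1 (muln^~ (M * N)%N) E1.
have E7 : (c * (N * q).+1 = c * (N * N) + c * (N * M) + c)%N by rewrite {1}E4; ring.
have E8 : ((c + q) * (N * N) = a * M * N * (N * N))%N by congr muln; lia.
by lia.
Qed.

Lemma mem_delta_points v : (v \in delta_points) = in_delta v.
Proof.
case: v => v1 v2; rewrite /in_delta /pairing /= !mul0r !add0r !mul1r.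
have q0 := q_gt0; have Ea := paq s.
apply/allpairsPdep/idP => [[i [t [Hi Ht [-> ->]]]]|/and3P[HR HL HB]].
  move: Hi Ht; rewrite !mem_iota add0n /= ltnS => le_i.
  rewrite subnKC ?low_high // lowE // => /andP[Hl Hh].
  have {}Hh : (q * t.+1 <= a * i)%N.
    by move: Hh; rewrite /high -leq_subLR leq_divRL // mulnBl leq_subLR Ea; lia.
  have Hl' : b%:Z * (i%:Z - (M * N)%N%:Z) <= (b * (i - M * N))%N%:Z.
    by rewrite (PoszM b (i - M * N)%N) ler_wpM2l //; lia.
  by apply/and3P; split; lia.
have Hq : q%:Z * v2 <= a%:Z * (v1 + 1) - q%:Z by lia.
have v10 : 0 <= v1 + 1.
  rewrite leNgt; apply/negP => lt0.
  have A1 : a%:Z * (v1 + 1) <= 0 by rewrite mulr_ge0_le0 //; lia.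
  have A2 : 0 <= q%:Z * v2 by rewrite mulr_ge0.
  by lia.
pose i := absz (v1 + 1); pose t := absz v2.
have Ei : v1 = i%:Z - 1 by rewrite /i; lia.
have Et : v2 = t%:Z by rewrite /t; lia.
rewrite Ei Et in HR Hq *.
have H2 : (q * t.+1 <= a * i)%N by lia.
have H1 : (N * N)%N%:Z * t%:Z >= b%:Z * (i%:Z - (M * N)%N%:Z) by lia.
have le_i := column_le H1 H2.
exists i, t; split=> //; first by rewrite mem_iota add0n.
rewrite mem_iota subnKC ?low_high // lowE //; apply/andP; split.
  have [le|lt] := leqP (M * N) i; first by move: H1; rewrite subzn //; lia.
  by rewrite (eqP (_ : i - M * N == 0)%N) ?muln0 // subn_eq0 ltnW.
rewrite /high -leq_subLR leq_divRL // mulnBl leq_subLR; move: H2; rewrite Ea; lia.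
Qed.

Lemma uniq_delta_points : uniq delta_points.
Proof.
apply: allpairs_uniq_dep; [exact: iota_uniq|by move=> *; exact: iota_uniq|].
by move=> [i t] [j u] _ _ /= [/addIr [-> ->]] .
Qed.

Lemma double_sum_ord j : (2 * \sum_(i < j) i + j = j * j)%N.
Proof.
elim: j => [|j IH]; first by rewrite big_ord0.
by rewrite big_ord_recr mulnDr /=; move: IH; move: (\sum_(i < j) i)%N => S; lia.
Qed.

Lemma sum_high : (2 * \sum_(i < (N * q).+1) high i + q * n * N + N * q + N * n =
  (N * q).+1 * (N * q) + q * n * (N * N) + (N * q * n + N) + 2 * (n * N))%N.
Proof.
have q0 := q_gt0.
have -> : (\sum_(i < (N * q).+1) high i =
    \sum_(i < (N * q).+1) i + (\sum_(i < N * q) (n * i %/ q) + n * N))%N.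
  by rewrite big_split; congr addn; rewrite big_ord_recr /= mulnA mulnK.
have /andP[cop _] : coprime n q && coprime N q by rewrite -coprimeMl -pqnN coprimeSn.
have E1 := double_sum_ord (N * q).+1; have E2 := sum_floor N cop q0.
have E3 : (q.-1 * n.-1 + q + n = q * n + 1)%N.
  by case: (q) q0 => // q' _; rewrite /pn /=; lia.
have := congr1 (muln N) E3; move: E1 E2.
move: (\sum_(i < (N * q).+1) i)%N (\sum_(i < N * q) (n * i %/ q))%N => S1 S2; lia.
Qed.

Lemma sum_low : (2 * \sum_(i < (N * q).+1) low i + K * (N * N) =
  K * (N * N * (N * N)) + 2 * b)%N.
Proof.
have -> : ((N * q).+1 = M * N + (N * N).+1)%N by rewrite pqE; lia.
rewrite big_split_ord /= big1 ?add0n => [|i _]; last first.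
  by rewrite /low (eqP (_ : i - M * N == 0)%N) ?muln0 // subn_eq0 ltnW.
rewrite big_ord_recr /= /low addKn divnn (_ : 0 < N * N)%N // -bN2 subn1 /=.
rewrite (eq_bigr (fun i : 'I_(N * N) => (K * i)%N)) => [|i _]; last first.
  by rewrite addKn divn_small ?subn0.
rewrite -big_distrr /=; have := congr1 (muln K) (double_sum_ord (N * N)).
by have := bN2 s; move: (\sum_(i < N * N) i)%N => S; lia.
Qed.

Lemma size_delta_points : (2 * size delta_points + N * N.-1 = m * m.+1 + 2)%N.
Proof.
have E : (size delta_points + \sum_(i < (N * q).+1) low i = \sum_(i < (N * q).+1) high i)%N.
  rewrite size_allpairs_dep sumnE big_map big_iota0 -big_split; apply: eq_bigr => i _ /=.
  by rewrite size_iota subnK // low_high // -ltnS.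
have EN : (N * N.-1 + N = N * N)%N by rewrite -mulnSr.
have := sum_high; have := sum_low; have := count_identity s; move: E EN.
by move: (\sum_(i < (N * q).+1) low i)%N (\sum_(i < (N * q).+1) high i)%N => S1 S2; lia.
Qed.

End LatticeCount.

Local Notation o0 := (Ordinal (isT : 0 < 3)%N).
Local Notation o1 := (Ordinal (isT : 1 < 3)%N).
Local Notation o2 := (Ordinal (isT : 2 < 3)%N).

Section PlaneGeometry.
Implicit Types (p z : plane) (u : lattice).

Lemma conv_halfplane (I : finType) (P : I -> plane) u (h : rat) p :
  (forall i, h <= pairingQ u (P i)) -> conv P p -> h <= pairingQ u p.
Proof.
move=> H [t [t0 t1 ->]].
have -> : pairingQ u (\sum_i t i * (P i).1, \sum_i t i * (P i).2) =
    \sum_i t i * pairingQ u (P i).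
  rewrite /pairingQ /= !mulr_sumr -big_split; apply: eq_bigr => i _ /=; ring.
rewrite -[h]mul1r -t1 mulr_suml; apply: ler_sum => i _; exact: ler_wpM2l.
Qed.

Lemma in_homothet (r : rat) z (D : triangle) p : r != 0 ->
  in_triangle (homothet r z D) p <->
  in_triangle D ((p.1 - z.1) / r, (p.2 - z.2) / r).
Proof.
move=> r0; split=> -[t [t0 t1 E]]; exists t; split=> //.
  rewrite E /homothet /=; congr pair; apply: (mulIf r0); rewrite mulfVK //;
    under eq_bigr => i _ do rewrite mulrDr mulrCA;
    by rewrite big_split -mulr_sumr -mulr_suml t1 mul1r addrK mulrC.
case: E => E1 E2; rewrite /homothet [p]surjective_pairing /=; congr pair;
  under eq_bigr => i _ do rewrite mulrDr mulrCA;
  rewrite big_split -mulr_sumr -mulr_suml t1 mul1r /=.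
  by rewrite -E1 [r * _]mulrC mulfVK // subrK.
by rewrite -E2 [r * _]mulrC mulfVK // subrK.
Qed.

Lemma pairingQ_to_plane u v : pairingQ u (to_plane v) = (pairing u v)%:~R.
Proof. by rewrite /pairingQ /pairing /= rmorphD !rmorphM. Qed.

Variables (a b c n q N MN N2 m : nat).
Hypotheses (a0 : (0 < a)%N) (b0 : (0 < b)%N) (c0 : (0 < c)%N) (MN0 : (0 < MN)%N).
Hypotheses (E1 : (c + a = a * MN + n)%N) (E2 : (a * N2 + c = b * q)%N)
  (E3 : (a * m + n = q * b)%N) (E4 : (m.+1 = N2 + MN)%N) (E5 : (a * N = b.+1)%N).

Let uR : lattice := (- b%:Z, N2%:Z).
Let uL : lattice := (a%:Z, - q%:Z).
Let uB : lattice := (0, 1).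
Let D : triangle := mk_triangle (- (n%:R / a%:R), 0) (MN%:R - 1, 0) (m%:R, b%:R).

Let a0Q : a%:R != 0 :> rat. Proof. by rewrite pnatr_eq0 -lt0n. Qed.
Let b0Q : b%:R != 0 :> rat. Proof. by rewrite pnatr_eq0 -lt0n. Qed.
Let c0Q : c%:R != 0 :> rat. Proof. by rewrite pnatr_eq0 -lt0n. Qed.

Let F1 : c%:R + a%:R = a%:R * MN%:R + n%:R :> rat.
Proof. by rewrite -natrM -!natrD E1. Qed.
Let F2 : a%:R * N2%:R + c%:R = b%:R * q%:R :> rat.
Proof. by rewrite -!natrM -!natrD E2. Qed.
Let F3 : a%:R * m%:R + n%:R = q%:R * b%:R :> rat.
Proof. by rewrite -!natrM -!natrD E3. Qed.
Let F4 : m%:R + 1 = N2%:R + MN%:R :> rat.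
Proof. by rewrite natr1 -natrD E4. Qed.

Let PR p : pairingQ uR p = - b%:R * p.1 + N2%:R * p.2.
Proof. by rewrite /pairingQ /= rmorphN /= -!pmulrn. Qed.
Let PL p : pairingQ uL p = a%:R * p.1 - q%:R * p.2.
Proof. by rewrite /pairingQ /= rmorphN /= -!pmulrn mulNr. Qed.
Let PB p : pairingQ uB p = p.2.
Proof. by rewrite /pairingQ /= mul0r mul1r add0r. Qed.

Lemma all_ord3 (P : 'I_3 -> Prop) :
  P o0 -> P o1 -> P o2 ->
  forall i, P i.
Proof.
move=> P0 P1 P2 [[|[|[|i]]] Hi] //.
- by rewrite (bool_irrelevance Hi isT).
- by rewrite (bool_irrelevance Hi isT).
- by rewrite (bool_irrelevance Hi isT).
Qed.

Lemma sum_ord3 (V : nmodType) (F : 'I_3 -> V) :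
  \sum_i F i = F o0 + F o1 +
    F o2.
Proof.
rewrite !big_ord_recl big_ord0 addr0 addrA.
by congr (F _ + F _ + F _); apply: val_inj.
Qed.

Lemma in_triangle_halfplanes p : in_triangle D p <->
  [/\ - (b%:R * (MN%:R - 1)) <= pairingQ uR p, - n%:R <= pairingQ uL p & 0 <= pairingQ uB p].
Proof.
have n0 : 0 <= n%:R :> rat by [].
have ge1MN : 1 <= MN%:R :> rat by rewrite ler1n.
have aP : 0 < a%:R :> rat by rewrite ltr0n.
have bP : 0 < b%:R :> rat by rewrite ltr0n.
have cP : 0 < c%:R :> rat by rewrite ltr0n.
split=> [H|[]].
  split; apply: conv_halfplane H; apply: all_ord3; rewrite /D /mk_triangle /tnth /=;
    rewrite ?PR ?PL ?PB /= ?mulr0 ?addr0 ?subr0 ?mulNr //.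
  - rewrite mulrN opprK (@le_trans _ _ 0) //; last by rewrite mulr_ge0 ?divr_ge0.
    by rewrite oppr_le0 mulr_ge0 // subr_ge0.
  - have -> : b%:R * m%:R = b%:R * (N2%:R + MN%:R - 1) :> rat by rewrite -F4 addrK.
    lra.
  - by rewrite mulrN mulrCA mulfV // mulr1.
  - have : 0 <= a%:R * (MN%:R - 1) :> rat by rewrite mulr_ge0 // subr_ge0.
    lra.
  - by have := F3; lra.
rewrite PR PL PB => HR HL HB.
pose t0 := a%:R * (- b%:R * p.1 + N2%:R * p.2 + b%:R * (MN%:R - 1)) / (b%:R * c%:R) : rat.
pose t1 := (a%:R * p.1 - q%:R * p.2 + n%:R) / c%:R : rat.
pose t2 := p.2 / b%:R : rat.
exists (tnth [tuple t0; t1; t2]); split.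
- apply: all_ord3; rewrite /tnth /=.
  + by rewrite divr_ge0 ?mulr_ge0 //; lra.
  + by rewrite divr_ge0 //; lra.
  + by rewrite divr_ge0.
- rewrite sum_ord3 /tnth /= /t0 /t1 /t2.
  apply: (mulIf (mulf_neq0 b0Q c0Q)).
  have -> : (a%:R * (- b%:R * p.1 + N2%:R * p.2 + b%:R * (MN%:R - 1)) / (b%:R * c%:R) +
      (a%:R * p.1 - q%:R * p.2 + n%:R) / c%:R + p.2 / b%:R) * (b%:R * c%:R) =
     (a%:R * N2%:R + c%:R - b%:R * q%:R) * p.2 + b%:R * (a%:R * MN%:R + n%:R - a%:R) :> rat.
    by field; rewrite b0Q c0Q.
  by rewrite F2 -F1; ring.
rewrite !sum_ord3 /tnth /= /t0 /t1 /t2 [p]surjective_pairing /=; congr pair.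
  apply: (mulIf (mulf_neq0 b0Q c0Q)).
  have Fm : m%:R = N2%:R + MN%:R - 1 :> rat by rewrite -F4 addrK.
  have Fc : c%:R = a%:R * MN%:R + n%:R - a%:R :> rat by rewrite -F1 addrK.
  have Ey : c%:R * m%:R - n%:R * N2%:R - (b%:R * q%:R) * (MN%:R - 1) = 0 :> rat.
    by rewrite -F2 Fm Fc; ring.
  transitivity (p.1 * b%:R * (a%:R * MN%:R + n%:R - a%:R) +
    p.2 * (c%:R * m%:R - n%:R * N2%:R - (b%:R * q%:R) * (MN%:R - 1))).
    by rewrite Ey -Fc; ring.
  by field; rewrite a0Q b0Q c0Q.
by field; rewrite b0Q c0Q.
Qed.

Lemma pairingQ_vertices : [/\
  [/\ pairingQ uR (D o1) = - (b%:R * (MN%:R - 1)),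
      pairingQ uR (D o2) = - (b%:R * (MN%:R - 1)) &
      - (b%:R * (MN%:R - 1)) < pairingQ uR (D o0)],
  [/\ pairingQ uL (D o0) = - n%:R,
      pairingQ uL (D o2) = - n%:R &
      - n%:R < pairingQ uL (D o1)] &
  [/\ pairingQ uB (D o0) = 0,
      pairingQ uB (D o1) = 0 &
      0 < pairingQ uB (D o2)]].
Proof.
have Fm : m%:R = N2%:R + MN%:R - 1 :> rat by rewrite -F4 addrK.
have Fc : c%:R = a%:R * MN%:R + n%:R - a%:R :> rat by rewrite -F1 addrK.
have aP : 0 < a%:R :> rat by rewrite ltr0n.
have bP : 0 < b%:R :> rat by rewrite ltr0n.
have cP : 0 < c%:R :> rat by rewrite ltr0n.
rewrite !PR !PL !PB /D /mk_triangle /tnth /= ?mulr0 ?addr0 ?subr0 ?mulNr.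
split; split=> //.
- by rewrite Fm; ring.
- rewrite mulrN opprK -subr_gt0.
  have -> : b%:R * (n%:R / a%:R) - - (b%:R * (MN%:R - 1)) =
    b%:R * (a%:R * MN%:R + n%:R - a%:R) / a%:R :> rat by field.
  by rewrite -Fc divr_gt0 ?mulr_gt0.
- by rewrite mulrN mulrCA mulfV // mulr1.
- by have := F3; lra.
- by move: cP; rewrite Fc; lra.
Qed.

Hypotheses (cop_R : coprime b N2) (cop_L : coprime a q).

Lemma normal_fan_triangle : normal_fan D (tnth [tuple uR; uL; uB]).
Proof.
have [[R1 R2 R0] [L0 L2 L1] [B0 B1 B2]] := pairingQ_vertices.
apply: all_ord3; rewrite [tnth _ _]/=; split.
- by rewrite /coprimez /gcdz /= abszN.
- by exists (- (b%:R * (MN%:R - 1))); split=> //; apply: all_ord3.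
- by rewrite /coprimez /gcdz /= abszN.
- by exists (- n%:R); split=> //; apply: all_ord3.
- by [].
- by exists 0; split=> //; apply: all_ord3.
Qed.

Lemma wps_fan_triangle :
  wps_fan (tnth [tuple a%:Z; b%:Z; c%:Z]) (tnth [tuple uR; uL; uB]).
Proof.
have G5 : a%:Z * N%:Z = b%:Z + 1 by rewrite -PoszM E5 -addn1 PoszD.
have G2 : a%:Z * N2%:Z + c%:Z = b%:Z * q%:Z by rewrite -!PoszM -PoszD E2.
have comb (t : 'I_3 -> int) : \sum_i tnth [tuple uR; uL; uB] i *~ t i =
   (- b%:Z * t o0 + a%:Z * t o1,
    N2%:Z * t o0 - q%:Z * t o1 +
      t o2).
  have scale (v : lattice) (i : int) : v *~ i = (v.1 * i, v.2 * i).
    have E (j : nat) : v *+ j = (v.1 * j%:Z, v.2 * j%:Z).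
      by rewrite latticeMn; congr pair; rewrite mulrn_int mulrC.
    case: i => j; rewrite ?NegzE ?mulrNz -pmulrn E //.
    by apply: lattice_eq; rewrite /= mulrN.
  rewrite sum_ord3 /tnth /= !scale; apply: lattice_eq; rewrite /=; ring.
split=> [[v1 v2]|t].
  exists (tnth [tuple v1; N%:Z * v1; v2 - N2%:Z * v1 + q%:Z * (N%:Z * v1)]).
  rewrite comb /tnth /=; apply: lattice_eq; rewrite /=; last by ring.
  by rewrite mulrA G5; ring.
rewrite comb; split=> [|[z Hz]].
  move=> H; have /= H1 := congr1 fst H; have /= H2 := congr1 snd H.
  move: H1 H2; set t0 := t _; set t1 := t _; set t2 := t _ => H1 H2.
  exists (N%:Z * t0 - t1).
  have T0 : t0 = (N%:Z * t0 - t1) * a%:Z.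
    transitivity (t0 * (a%:Z * N%:Z - b%:Z)); first by rewrite G5; ring.
    by transitivity (t0 * (a%:Z * N%:Z) - a%:Z * t1 + (- b%:Z * t0 + a%:Z * t1));
      [ring|rewrite H1; ring].
  have T1 : t1 = (N%:Z * t0 - t1) * b%:Z.
    transitivity (t1 * (a%:Z * N%:Z - b%:Z)); first by rewrite G5; ring.
    by transitivity (N%:Z * (b%:Z * t0) - b%:Z * t1 + N%:Z * (- b%:Z * t0 + a%:Z * t1));
      [ring|rewrite H1; ring].
  apply: all_ord3; rewrite /tnth /= -/t0 -/t1 -/t2 //.
  have -> : t2 = - (N2%:Z * t0) + q%:Z * t1.
    transitivity ((N2%:Z * t0 - q%:Z * t1 + t2) - N2%:Z * t0 + q%:Z * t1); first by ring.
    by rewrite H2; ring.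
  move: T0 T1; move: (N%:Z * t0 - t1) => z -> ->.
  transitivity (z * (b%:Z * q%:Z - a%:Z * N2%:Z)); first by ring.
  by rewrite -G2; ring.
rewrite !Hz /tnth /=; apply: lattice_eq; rewrite /=; first by ring.
transitivity (z * (a%:Z * N2%:Z + c%:Z - b%:Z * q%:Z)); first by ring.
by rewrite G2; ring.
Qed.

Lemma homothet_triangle (P : plane -> Prop) : (forall p, P p -> in_triangle D p) ->
  P (MN%:R - 1, 0) -> P (m%:R, b%:R) -> forall (r : rat) z, 0 < r ->
  (forall p, P p -> in_triangle (homothet r z D) p) ->
  forall p, in_triangle D p -> in_triangle (homothet r z D) p.
Proof.
move=> PD P1 P2 r z r0 PH p /in_triangle_halfplanes[HR HL HB].
have rn : r != 0 by rewrite gt_eqF.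
have /(in_homothet _ _ _ rn)/in_triangle_halfplanes[] := PH _ P1.
have /(in_homothet _ _ _ rn)/in_triangle_halfplanes[] := PH _ P2.
have [[R1 R2 R0] [L0 L2 L1] [B0 B1 B2]] := pairingQ_vertices.
have shift u (w : plane) : pairingQ u ((w.1 - z.1) / r, (w.2 - z.2) / r) =
    (pairingQ u w - pairingQ u z) / r.
  by rewrite /pairingQ /=; field.
rewrite !shift !ler_pdivlMr // => R2' L2' B2' R1' L1' B1'.
apply/in_homothet => //; apply/in_triangle_halfplanes.
rewrite !shift !ler_pdivlMr //; move: R1 L2 B1; rewrite /D /mk_triangle /tnth /= => R1 L2 B1.
by rewrite R1 in R1'; rewrite L2 in L2'; rewrite B1 in B1'; split; lra.
Qed.

Lemma in_triangle_lattice v : in_triangle D (to_plane v) <->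
  [/\ - ((b * MN)%N%:Z - b%:Z) <= pairing uR v, - n%:Z <= pairing uL v & 0 <= pairing uB v].
Proof.
have E i j : (i%:~R <= j%:~R :> rat) = (i <= j) by rewrite ler_int.
have EbMN : - (b%:R * (MN%:R - 1)) = (- ((b * MN)%N%:Z - b%:Z))%:~R :> rat.
  by rewrite rmorphN rmorphB /= -!pmulrn natrM; ring.
have En : - n%:R = (- n%:Z)%:~R :> rat by rewrite rmorphN /= -pmulrn.
split=> [/in_triangle_halfplanes[]|[HR HL HB]].
  by rewrite !pairingQ_to_plane EbMN En !E -[0 : rat]/(0%:~R) E.
by apply/in_triangle_halfplanes; rewrite !pairingQ_to_plane EbMN En !E -[0 : rat]/(0%:~R) E.
Qed.

End PlaneGeometry.

Section ConstantEmbedding.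
Variables (R : comNzRingType) (G : zmodType).

Definition gconst (c : R) : grpalg R G := gmono c 0.

Lemma gconst_is_zmod : zmod_morphism gconst.
Proof. by move=> c d; apply/gcoef_eqP => v; rewrite gcoefB !gcoef_mono mulrnBl. Qed.

Lemma gconst_is_monoid : monoid_morphism gconst.
Proof. by split=> // c d; rewrite /gconst gmonoM addr0. Qed.

HB.instance Definition _ := GRing.isZmodMorphism.Build R (grpalg R G) gconst gconst_is_zmod.
HB.instance Definition _ := GRing.isMonoidMorphism.Build R (grpalg R G) gconst gconst_is_monoid.

Lemma gsum_ind (P : grpalg R G -> Prop) f : P 0 -> (forall g h, P g -> P h -> P (g + h)) ->
  (forall v, gcoef f v != 0 -> P (gmono (gcoef f v) v)) -> P f.
Proof.
move=> P0 PD PU; rewrite [f]gsumE big_seq; apply: (big_ind P) => // v.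
by rewrite gsuppE; exact: PU.
Qed.

End ConstantEmbedding.

Section Instantiation.
Variable k : closedFieldType.

Definition laurent_ring : laurentRing k.
Proof.
refine (@LaurentRing k (laurent k) (@gcoef k lattice) (@gmono k lattice) (@gpart k lattice)
  (fun chi => geval (@gconst k lattice) chi) _ _ _ _ _ _ _ _ _ _ _).
- by move=> f g /gcoef_eqP.
- exact: gcoefB.
- exact: gcoef_mono.
- exact: gcoef_monoM.
- exact: gmonoM.
- exact: gmono1.
- exact: gsum_ind.
- exact: gcoef_part.
- by move=> chi c v; rewrite geval_mono.
- by move=> chi; exact: geval_is_additive.
- by move=> chi chi0 chiD; exact: geval_is_monoid.
Defined.

End Instantiation.

Section Conclusion.
Variables (k : closedFieldType) (s : nat).
Local Notation L := (laurent_ring k).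
Local Notation N := (pN s).
Local Notation n := (pn s).
Local Notation M := (pM s).
Local Notation b := (pb s).
Local Notation m := (pm s).
Local Notation a := (pa s).
Local Notation c := (pc s).

Definition curve_rays : rays := tnth [tuple rayR s; rayL s; rayB].
Definition curve_weights : 'I_3 -> int := tnth [tuple a%:Z; b%:Z; c%:Z].
Definition curve_triangle : triangle :=
  mk_triangle (- (n%:R / a%:R), 0) ((M * N)%N%:R - 1, 0) (m%:R, b%:R).

Lemma geE u d (f : L) : ge u d f <-> forall v, v \in gsupp (f : laurent k) -> d <= pairing u v.
Proof.
split=> H v; first by rewrite gsuppE => fv; exact: H.
by move=> fv; apply: H; rewrite gsuppE.
Qed.

Lemma order_alongE u (f : laurent k) d : order_along u f d <-> ord u (f : L) d.
Proof.
split=> [[H1 [v fv Ev]]|[H1 H2]].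
  split; first exact/geE.
  by apply/eqP; apply: supp_init Ev; rewrite -[lcoef _ _]/(gcoef f v) -gsuppE.
split; first exact/geE.
have /eqP/init_supp[v [fv Ev]] := H2.
by exists v => //; rewrite gsuppE.
Qed.

Lemma insecE r l d (f : L) : insec s r l d f <->
  forall i v, v \in gsupp (f : laurent k) ->
    - tnth [tuple r; l; d] i <= pairing (curve_rays i) v.
Proof.
split=> [[/geE H1 /geE H2 /geE H3]|H]; last first.
  by split; apply/geE => v fv; [exact: (H o0)|
    exact: (H o1)|exact: (H o2)].
by apply: all_ord3.
Qed.

Lemma negative_curveP (f : laurent k) : negative_curve curve_weights curve_rays f <->
  irr (f : L) /\ exists r l d j, [/\ ords s (f : L) r l d, ordE (f : L) j &
    secdeg s (- r) (- l) (- d) ^+ 2 <= (a * b * c)%N%:Z * j%:Z ^+ 2].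
Proof.
have [a0 b0 c0 _ _] := pos_params s.
have num (e : int) (j : nat) :
    (intersection curve_weights e j%:Z e j%:Z <= 0) = (e ^+ 2 <= (a * b * c)%N%:Z * j%:Z ^+ 2).
  rewrite /intersection /curve_weights !big_ord_recl big_ord0 mulr1 /tnth /=.
  have P0 : 0 < (a%:Z * (b%:Z * c%:Z))%:~R :> rat by rewrite ltr0z !mulr_gt0.
  rewrite subr_le0 ler_pdivrMr // -rmorphM ler_int !expr2 !PoszM.
  by rewrite [X in _ <= X]mulrC mulrA.
split=> -[If].
  case=> e [j [[[o [Ho Ee]] Oj] He]]; split=> //.
  exists (o o0), (o o1),
    (o o2), j; split=> //.
    by split; apply/order_alongE; [exact: (Ho o0)|
      exact: (Ho o1)|exact: (Ho o2)].
  rewrite -num; suff <- : e = secdeg s (- o o0)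
    (- o o1) (- o o2) by [].
  by rewrite Ee sum_ord3 /curve_weights /tnth /= /secdeg; ring.
case=> r [l [d [j [[O1 O2 O3] Oj He]]]]; split=> //.
exists (secdeg s (- r) (- l) (- d)), j; split; last by rewrite num.
split=> //; exists (tnth [tuple r; l; d]); split.
  by apply: all_ord3; apply/order_alongE.
by rewrite sum_ord3 /curve_weights /tnth /= /secdeg; ring.
Qed.

Variable xi : L.
Hypothesis xiP : xi_spec s xi.

Lemma xi_negative : negative_curve curve_weights curve_rays xi.
Proof.
apply/negative_curveP; split; first exact: (xi_irr xiP).
exists (b%:Z - (b * M * N)%N%:Z), (- n%:Z), 0, m.
split; [exact: xi_ords|exact: xi_ordE|].
rewrite xi_secdeg; have H : (b * c <= a * m * m)%N by rewrite pamm leq_addr.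
have := leq_mul (leqnn (b * c)%N) H; rewrite !expr2; lia.
Qed.

Lemma xi_unique f : negative_curve curve_weights curve_rays f -> same_curve xi f.
Proof.
move=> /negative_curveP[If [r [l [d [j [Of Oj Hd]]]]]].
have [h Uh Eh] := negative_unique xiP If Of Oj Hd.
by exists h.
Qed.

Lemma curve_mds : mori_dream_space k curve_weights curve_rays.
Proof.
exists (tnth [tuple N%:Z; -1; 0]); split.
  rewrite sum_ord3 /curve_weights /tnth /=; have := aN1 s; lia.
have secE d j (f : laurent k) :
    H0 curve_rays (fun i => d * tnth [tuple N%:Z; -1; 0] i) j f <-> sec s d j (f : L).
  have E i : - (d * tnth [tuple N%:Z; -1; 0] i) = - tnth [tuple d * N%:Z; - d; 0] i.
    by move: i; apply: all_ord3; rewrite /tnth /= ?mulr0 ?mulrN1.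
  split=> -[H V]; split=> //.
    by apply/insecE => i v fv; rewrite -E; exact: H.
  by move=> i v fv; rewrite E; move/insecE: H; exact.
pose cc : {rmorphism k -> cox_ambient k} :=
  @gconst (laurent k) (int * int)%type \o @gconst k lattice.
have [gs [gsA gsP]] := @cox_finite k L s xi xiP (cox_ambient k)
  (@gmono (laurent k) (int * int)%type) (@gcoef (laurent k) (int * int)%type) cc
  (fun f g v w => gmonoM f g v w) (fun f g v => gmonoD f g v) (gmono1 _ _)
  (@gcoefD _ _) (@gcoef_mono _ _)
  (fun P x P0 PD PU => @gsum_ind _ _ P x P0 PD (fun v _ => PU v)) (fun=> erefl).
have coxE x : cox s (@gcoef (laurent k) (int * int)%type : cox_ambient k -> _ -> L) x <->
    cox_ring curve_rays (tnth [tuple N%:Z; -1; 0]) x.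
  by split=> H d j; apply/secE; exact: H.
exists (size gs), (fun i => gs`_i); split=> [i|F /coxE/gsP/alg_gen_mmap[p ->]].
  by apply/coxE/gsA/mem_nth.
by exists p.
Qed.

End Conclusion.

Section Triangle.
Variables (k : closedFieldType) (s : nat).
Local Notation L := (laurent_ring k).
Local Notation N := (pN s).
Local Notation n := (pn s).
Local Notation K := (pK s).
Local Notation M := (pM s).
Local Notation q := (pq s).
Local Notation b := (pb s).
Local Notation m := (pm s).
Local Notation a := (pa s).
Local Notation c := (pc s).

Lemma MN_gt0 : (0 < M * N)%N.
Proof. by rewrite pMn !muln_gt0. Qed.

Lemma params_E1 : (c + a = a * (M * N) + n)%N.
Proof. by rewrite pcE' mulnA. Qed.

Lemma params_E3 : (a * m + n = q * b)%N.
Proof. by have [_ E _] := vtopP s; move: E; rewrite /pairing /=; lia. Qed.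

Lemma params_E4 : (m.+1 = N * N + M * N)%N.
Proof. by rewrite pmE pqE; ring. Qed.

Lemma in_curve_triangle v : in_triangle (curve_triangle s) (to_plane v) <-> v \in delta_points s.
Proof.
have [a0 b0 c0 _ _] := pos_params s.
have H := in_triangle_lattice a0 b0 c0 MN_gt0 params_E1 (pcE s) params_E3 params_E4 v.
rewrite mem_delta_points /in_delta -mulnA.
by split=> [/H[? ? ?]|/and3P[? ? ?]]; [apply/and3P; split|apply/H; split].
Qed.

Lemma curve_lattice_count : lattice_count (curve_triangle s) (size (delta_points s)).
Proof.
exists (delta_points s); split=> // [|v]; first exact: uniq_delta_points.
by split=> /in_curve_triangle.
Qed.

Lemma curve_normal_fan : normal_fan (curve_triangle s) (curve_rays s).
Proof.
have [a0 b0 c0 _ _] := pos_params s.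
have /andP[_ copR] : coprime b K && coprime b (N * N).
  by rewrite -coprimeMr -bN2 coprimenS.
have /andP[copL _] : coprime q n && coprime q N.
  by rewrite -coprimeMr -pqnN coprimenS.
have {}copL : coprime a q by rewrite /coprime paq gcdnC gcdnDl.
exact: (normal_fan_triangle a0 b0 c0 params_E1 params_E3 params_E4 copR copL).
Qed.

Lemma curve_wps_fan : wps_fan (curve_weights s) (curve_rays s).
Proof. exact: (wps_fan_triangle (pcE s) (aN1 s)). Qed.

Variable xi : L.
Hypothesis xiP : xi_spec s xi.

Lemma newton_vertex (f : laurent k) v : v \in gsupp f -> newton_polygon f (to_plane v).
Proof.
move=> fv; pose i0 : gsupp f := [` fv]%fset.
have E (F : gsupp f -> rat) : \sum_i (i == i0)%:R * F i = F i0.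
  rewrite (bigD1 i0) //= eqxx mul1r big1 ?addr0 // => i /negbTE ->; exact: mul0r.
exists (fun i => (i == i0)%:R); split=> [i||]; first exact: ler0n.
  by rewrite (bigD1 i0) //= eqxx big1 ?addr0 // => i /negbTE ->.
by rewrite [X in (X, _)]E [X in (_, X)]E.
Qed.

Lemma xi_supported : supported_in (xi : laurent k) (curve_triangle s).
Proof.
have [a0 b0 c0 _ _] := pos_params s.
have [X1 X2] := xi_coef xiP.
have PD p : newton_polygon (xi : laurent k) p -> in_triangle (curve_triangle s) p.
  case=> t [t0 t1 ->].
  have /fin_all_exists[T HT] : forall v : gsupp (xi : laurent k),
      exists T : {ffun 'I_3 -> rat}, [/\ forall i, 0 <= T i, \sum_i T i = 1 &
        to_plane (val v) = (\sum_i T i * (curve_triangle s i).1,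
          \sum_i T i * (curve_triangle s i).2)].
    move=> v; have /in_curve_triangle[T [T0 T1 ET]] : val v \in delta_points s.
      rewrite mem_delta_points /in_delta.
      have xv : lcoef xi (val v) != 0 by rewrite -[lcoef _ _]/(gcoef _ _) -gsuppE; exact: valP.
      have [H1 H2 H3] := xi_in xiP.
      by apply/and3P; split; [exact: H1|exact: H2|have := H3 _ xv; rewrite oppr0].
    exists (finfun T); split=> [i||]; first by rewrite ffunE.
      by rewrite -T1; apply: eq_bigr => i _; rewrite ffunE.
    by rewrite ET; congr pair; apply: eq_bigr => i _; rewrite ffunE.
  exists (fun i => \sum_v t v * T v i); split=> [i||].
  - by apply: sumr_ge0 => v _; rewrite mulr_ge0 //; case: (HT v).
  - rewrite exchange_big -[RHS]t1; apply: eq_bigr => v _.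
    by rewrite -mulr_sumr; case: (HT v) => _ -> _; rewrite mulr1.
  - congr pair; under [RHS]eq_bigr => i _ do rewrite mulr_suml;
      rewrite exchange_big; apply: eq_bigr => v _; case: (HT v) => _ _ -> /=;
      by rewrite mulr_sumr; apply: eq_bigr => i _; rewrite mulrA.
split=> // r z r0 Hr.
apply: (@homothet_triangle _ _ _ _ _ _ _ _ a0 b0 c0 MN_gt0 params_E1 (pcE s) params_E3
  params_E4 (newton_polygon (xi : laurent k))) => //.
- have -> : ((M * N)%N%:R - 1, 0) = to_plane (vright s).
    by rewrite /to_plane /vright /= rmorphB /= -pmulrn.
  by apply: newton_vertex; rewrite gsuppE.
- have -> : (m%:R, b%:R) = to_plane (vtop s) by rewrite /to_plane /vtop /= -!pmulrn.
  by apply: newton_vertex; rewrite gsuppE.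
Qed.

Lemma xi_order : order_at_e (xi : laurent k) m.
Proof. exact: (xi_ordE xiP). Qed.

Lemma bin_delta_points :
  (2 * ('C(m.+1, 2) + 1) = 2 * size (delta_points s) + N * N.-1)%N.
Proof.
have -> : (2 * ('C(m.+1, 2) + 1) = m * m.+1 + 2)%N.
  rewrite -triangular_sum big_mkord; have := double_sum_ord m.+1.
  by move: (\sum_(i < m.+1) i)%N => S; lia.
by rewrite size_delta_points.
Qed.

Lemma xi_special : special (curve_weights s) (curve_rays s) (xi : laurent k) (curve_triangle s).
Proof.
split; [exact: xi_negative|exact: xi_supported|].
exists m, (size (delta_points s)); split; [exact: xi_order|exact: curve_lattice_count|].
have := bin_delta_points; have : (0 < N * N.-1)%N by rewrite muln_gt0.
by move: (size _) ('C(_, _)) => S1 S2; lia.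
Qed.

Lemma xi_deficiency :
  has_deficiency (xi : laurent k) (curve_triangle s) ((N * N.-1)%N%:R / 2).
Proof.
exists m, (size (delta_points s)); split; [exact: xi_order|exact: curve_lattice_count|].
have /(congr1 (fun i => i%:R : rat)) := bin_delta_points.
rewrite natrM natrD natrM => E.
by apply: (mulfI (_ : 2 != 0)) => //; rewrite mulrBr E [2 * (_ / 2)]mulrCA mulfV // mulr1; ring.
Qed.

End Triangle.

Theorem theorem5p1 (k : closedFieldType) (chark : [pchar k] =i pred0)
    (K N M a b c : int) (hK : 4 <= K)
    (hN : N = K - 2) (hM : M = N ^+ 2 - 1)
    (ha : a = K * N) (hb : b = K * N ^+ 2 - 1)
    (hc : c = K * M * N ^+ 2 - (M + N))
    (left right top : plane) (Delta : triangle)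
    (hDelta : Delta = mk_triangle left right top)
    (htop : top = ((N * (M + N) - 1)%:~R, (K * N ^+ 2 - 1)%:~R))
    (hright : right = ((M * N - 1)%:~R, 0))
    (hbase : left.2 = right.2)
    (hslope : (top.2 - left.2) / (top.1 - left.1)
              = (K * N)%:~R / (M + N)%:~R) :
  let w := tnth [tuple a; b; c] in
  left = (- ((K - 1)%:~R / (K * N)%:~R), 0) /\
  exists u : rays,
    [/\ normal_fan Delta u, wps_fan w u, mori_dream_space k w u &
        exists xi : laurent k,
          [/\ negative_curve w u xi,
              forall xi', negative_curve w u xi' -> same_curve xi xi',
              supported_in xi Delta,
              special w u xi Delta &
              (exists m : nat, order_at_e xi m /\ m%:Z = N * (M + N) - 1) /\
              has_deficiency xi Delta (((K - 2) * (K - 3))%:~R / 2)]].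
Proof.
have [s Es] : exists s, K = (pK s)%:Z by exists (absz (K - 4)); rewrite /pK; lia.
have EN : N = (pN s)%:Z by rewrite hN Es /pK /pN; lia.
have EM : M = (pM s)%:Z by rewrite hM EN pMn /pN /pn expr2; lia.
have Ea : a = (pa s)%:Z by rewrite ha Es EN paK PoszM.
have Eb : b = (pb s)%:Z by rewrite hb Es EN expr2; have := pbE s; lia.
have Ec : c = (pc s)%:Z.
  have E3 : (pc s + pq s = pa s * pM s * pN s)%N by have := pcE' s; have := paq s; lia.
  by rewrite paK pqE in E3; rewrite hc EM EN Es expr2; lia.
have Etop : top = ((pm s)%:R, (pb s)%:R).
  rewrite htop; congr pair; rewrite pmulrn; congr (_%:~R); last by rewrite -hb Eb.
  by rewrite EM EN; have := pmE s; have := pqE s; lia.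
have Eright : right = ((pM s * pN s)%N%:R - 1, 0).
  by rewrite hright rmorphB /= EM EN -PoszM -pmulrn.
have Eleft : left = (- ((pn s)%:R / (pa s)%:R), 0).
  move: hbase hslope; rewrite Eright Etop; case: (left) => l1 l2 /= ->.
  have -> : (K * N)%:~R = (pa s)%:R :> rat by rewrite -ha Ea pmulrn.
  have -> : (M + N)%:~R = (pq s)%:R :> rat.
    by rewrite [RHS]pmulrn EM EN; congr (_%:~R); have := pqE s; lia.
  have [a0 _ _ _ q0] := pos_params s.
  have aQ : (pa s)%:R != 0 :> rat by rewrite pnatr_eq0 -lt0n.
  have qQ : (pq s)%:R != 0 :> rat by rewrite pnatr_eq0 -lt0n.
  rewrite subr0; have [->|d0] := eqVneq ((pm s)%:R - l1) 0.
    by rewrite invr0 mulr0 => /esym/eqP; rewrite mulf_eq0 invr_eq0 (negbTE aQ) (negbTE qQ).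
  move/eqP; rewrite eqr_div // => /eqP H; congr pair; apply: (mulIf aQ).
  have F : (pa s)%:R * (pm s)%:R + (pn s)%:R = (pq s)%:R * (pb s)%:R :> rat.
    by rewrite -!natrM -natrD params_E3.
  by rewrite mulNr mulfVK //; lra.
have w_eq : tnth [tuple a; b; c] = curve_weights s by rewrite Ea Eb Ec.
have D_eq : Delta = curve_triangle s by rewrite hDelta Eleft Eright Etop.
have [xi xiP] := xi_specP (laurent_ring k) s.
rewrite w_eq D_eq; split.
  rewrite Eleft; congr (- (_ / _), _); rewrite pmulrn; congr (_%:~R).
    by rewrite Es /pK /pn; lia.
  by rewrite -ha Ea.
exists (curve_rays s); split.
- exact: curve_normal_fan.
- exact: curve_wps_fan.
- exact: (curve_mds xiP).
exists xi; split.
- exact: xi_negative.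
- by move=> f; exact: xi_unique.
- exact: xi_supported.
- exact: xi_special.
split.
  exists (pm s); split; first exact: xi_order.
  by rewrite EM EN; have := pmE s; have := pqE s; lia.
have -> : ((K - 2) * (K - 3))%:~R / 2 = (pN s * (pN s).-1)%N%:R / 2 :> rat.
  by congr (_ / 2); rewrite [RHS]pmulrn; congr (_%:~R); rewrite Es /pK /pN; lia.
exact: xi_deficiency.
Qed.
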